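(* Let $a>0$ and let $H$ be a probability measure on a measurable space $(\mathfrak{X},\mathcal{A})$. Let $(\theta_i)_{i\ge1}$ be a sequence of i.i.d. random variables with values in $\mathfrak{X}$ and common distribution $H$, independent of $(\Gamma_i)_{i\ge1}$, where $\Gamma_i=E_1+\cdots+E_i$ and $(E_i)_{i\ge1}$ are i.i.d. exponential random variables with mean $1$. Then, as $n\to\infty$, $$P^{\text{new}}_{n,H,a}=\sum_{i=1}^n\frac{G_n^{-1}\!\left(\frac{\Gamma_i}{\Gamma_{n+1}}\right)}{\sum_{j=1}^n G_n^{-1}\!\left(\frac{\Gamma_j}{\Gamma_{n+1}}\right)}\,\delta_{\theta_i}\ \overset{a.s.}{\to}\ P_{H,a}=\sum_{i=1}^\infty\frac{L^{-1}(\Gamma_i)}{\sum_{j=1}^\infty L^{-1}(\Gamma_j)}\,\delta_{\theta_i}.$$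
   Context: For $x>0$, $$L(x)=\frac{a}{\sqrt{2\pi}}\int_x^\infty e^{-t/2}t^{-3/2}\,dt,$$ $$G_n(x)=\Pr(X_n>x)=\int_x^\infty\frac{a}{n\sqrt{2\pi}}\,t^{-3/2}\exp\left\{-\frac12\left(\frac{a^2}{n^2t}+t\right)+\frac an\right\}dt,$$ where $X_n$ is a random variable having the inverse-Gaussian distribution with parameters $a/n$ and $1$ (the distribution whose density is the integrand above). $L$ and $G_n$ are continuous and strictly decreasing on $(0,\infty)$, and $L^{-1}$, $G_n^{-1}$ denote their inverse functions. $\delta_X$ denotes the Dirac measure at $X$ ($\delta_X(B)=1$ if $X\in B$ and $0$ otherwise), and $\overset{a.s.}{\to}$ denotes almost sure convergence. The right-hand series is the (normalized) Ferguson and Klass representation of the normalized inverse-Gaussian process with parameters $a$ and $H$, that is, of the random probability measure $P_{H,a}$ on $(\mathfrak{X},\mathcal{A})$ such that, for every finite measurable partition $A_1,\dots,A_m$ of $\mathfrak{X}$, the vector $(P_{H,a}(A_1),\dots,P_{H,a}(A_m))$ has the normalized inverse-Gaussian distribution with parameters $\gamma_i=aH(A_i)$ (with $P_{H,a}(A_i)=0$ with probability one if $H(A_i)=0$). The normalized inverse-Gaussian distribution with parameters $\gamma_1,\dots,\gamma_m>0$ has density $$f(z_1,\dots,z_m)=\frac{e^{\sum_{i=1}^m\gamma_i}\prod_{i=1}^m\gamma_i}{2^{m/2-1}\pi^{m/2}}\,K_{-m/2}\!\left(\sqrt{\sum_{i=1}^m\frac{\gamma_i^2}{z_i}}\right)\left(\sum_{i=1}^m\frac{\gamma_i^2}{z_i}\right)^{-m/4}\prod_{i=1}^m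 z_i^{-3/2}$$ on $\{(z_1,\dots,z_m): z_i\ge0,\ \sum_{i=1}^m z_i=1\}$, where $K_\nu$ is the modified Bessel function of the third type. *)

(* Defs.v *)
From HB Require Import structures.
From mathcomp Require Import all_boot all_order all_algebra.
From mathcomp Require Import finmap.
From mathcomp Require Import all_classical all_reals all_analysis.

Set Implicit Arguments.
Unset Strict Implicit.
Unset Printing Implicit Defensive.

Import Order.TTheory GRing.Theory Num.Theory.
Import numFieldNormedType.Exports.

Local Open Scope classical_set_scope.
Local Open Scope ring_scope.

Section inverse_gaussian.
Context {R : realType}.

(* Density, on t > 0, of the inverse-Gaussian law with parameters g and 1. *)
Definition ig_pdf (g t : R) : R :=
  g / Num.sqrt (2 * pi) * t `^ (- (3 / 2))
  * expR (- (g ^+ 2 / t + t) / 2 + g).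

Definition ig_tail (a : R) (n : nat) (x : R) : R :=
  (\int[lebesgue_measure]_(t in `]x, +oo[) ig_pdf (a / n%:R) t)%R.

Definition levy_tail (a x : R) : R :=
  a / Num.sqrt (2 * pi)
  * (\int[lebesgue_measure]_(t in `]x, +oo[)
       (expR (- t / 2) * t `^ (- (3 / 2))))%R.

(* Inverses of the restrictions to ]0, +oo[; the default value 0 is taken
   outside the ranges, which are ]0, 1[ and ]0, +oo[ respectively. *)
Definition ig_tail_inv (a : R) (n : nat) : R -> R :=
  'pinv_(fun=> 0) `]0, +oo[ (ig_tail a n).

Definition levy_tail_inv (a : R) : R -> R :=
  'pinv_(fun=> 0) `]0, +oo[ (levy_tail a).

End inverse_gaussian.

Section normalized_inverse_gaussian.
Context {R : realType}.

(* K_nu(x) for x > 0, by its standard integral representation. *)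
Definition besselK (nu x : R) : R :=
  2^-1 * (\int[lebesgue_measure]_(t in `]0, +oo[)
            (t `^ (nu - 1) * expR (- (x / 2) * (t + t^-1))))%R.

Definition nig_pdf (m : nat) (g : 'I_m -> R) (z : m.-tuple R) : R :=
  let S := \sum_(i < m) g i ^+ 2 / tnth z i in
  expR (\sum_(i < m) g i) * (\prod_(i < m) g i)
  / (2 `^ (m%:R / 2 - 1) * pi `^ (m%:R / 2))
  * besselK (- (m%:R / 2)) (Num.sqrt S) * S `^ (- (m%:R / 4))
  * \prod_(i < m) (tnth z i) `^ (- (3 / 2)).

(* Iterated Lebesgue integral over R^k; for nonnegative measurable f this is
   the integral with respect to k-dimensional Lebesgue measure (Tonelli),
   R^0 carrying the unit point mass. *)
Fixpoint lebesgue_int (k : nat) : (k.-tuple R -> \bar R) -> \bar R :=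
  match k with
  | 0 => fun f => f [tuple]
  | k'.+1 => fun f =>
      (\int[lebesgue_measure]_x
         lebesgue_int (fun t : k'.-tuple R => f (cons_tuple x t)))%E
  end.

Definition simplex (m : nat) : set (m.-tuple R) :=
  [set z | (forall i, 0 <= tnth z i) /\ \sum_(i < m) tnth z i = 1].

(* The simplex of R^(k+1) is parametrized by its first k coordinates, and
   densities on it are with respect to Lebesgue measure in these. *)
Definition simplex_point (k : nat) (t : k.-tuple R) : k.+1.-tuple R :=
  rcons_tuple t (1 - \sum_(i < k) tnth t i).

Definition has_nig_law d (Omega : measurableType d) (P : probability Omega R)
    (k : nat) (V : Omega -> k.+1.-tuple R) (g : 'I_k.+1 -> R) : Prop :=
  measurable_fun setT V /\
  forall B : set (k.+1.-tuple R), measurable B ->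
    P (V @^-1` B) =
    lebesgue_int (fun t : k.-tuple R =>
      (nig_pdf g (simplex_point t)
       * \1_(@simplex k.+1 `&` B) (simplex_point t))%:E).

(* A random probability measure on X is a probability kernel from Omega to X.
   The injection s enumerates the blocks of positive H-mass. *)
Definition is_nig_process d (Omega : measurableType d)
    (P : probability Omega R) d' (X : measurableType d')
    (H : probability X R) (a : R) (Q : R.-pker Omega ~> X) : Prop :=
  forall (m : nat) (A : 'I_m -> set X),
    (forall i, measurable (A i)) -> trivIset setT A ->
    \bigcup_i A i = setT ->
    (forall i, H (A i) = 0%E -> {ae P, forall w, Q w (A i) = 0%E}) /\
    (forall (k : nat) (s : 'I_k.+1 -> 'I_m), injective s ->
      (forall i, (0 < H (A i))%E <-> exists j, s j = i) ->
      has_nig_law P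
        (fun w => [tuple fine (Q w (A (s j))) | j < k.+1])
        (fun j => a * fine (H (A (s j))))).

End normalized_inverse_gaussian.

Section independence.
Context {R : realType} d (Omega : measurableType d) (P : probability Omega R).

Definition iid_seq d' (T : measurableType d') (Y : nat -> {RV P >-> T})
    (mu : set T -> \bar R) : Prop :=
  (forall i B, measurable B -> distribution P (Y i) B = mu B) /\
  (forall (J : {fset nat}) (B : nat -> set T), (forall i, measurable (B i)) ->
    P (\bigcap_(i in [set` J]) (Y i @^-1` B i)) =
    (\prod_(i <- J) P (Y i @^-1` B i))%E).

Definition sigma_of_seq d' (T : measurableType d') (Y : nat -> Omega -> T) :
    set (set Omega) :=
  <<s \bigcup_i preimage_set_system setT (Y i) measurable >>.

Definition indep_seqs d1 (T1 : measurableType d1) d2 (T2 : measurableType d2)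
    (Y : nat -> Omega -> T1) (Z : nat -> Omega -> T2) : Prop :=
  forall A B, sigma_of_seq Y A -> sigma_of_seq Z B ->
    P (A `&` B) = (P A * P B)%E.

End independence.

(* Sequences are indexed from 0: [E k] and [theta k] are the (k+1)-st terms,
   while [arrival E i] = E_1 + ... + E_i keeps its usual index. *)
Section random_measures.
Context {R : realType} {Omega : Type} d' {X : measurableType d'}.
Variables (a : R) (theta : nat -> Omega -> X) (E : nat -> Omega -> R).

Definition arrival (i : nat) (w : Omega) : R := \sum_(k < i) E k w.

Definition nig_approx (n : nat) (w : Omega) (B : set X) : \bar R :=
  let J i := ig_tail_inv a n (arrival i.+1 w / arrival n.+1 w) in
  (\sum_(i < n) (J i / \sum_(j < n) J j)%R%:E * \d_(theta i w) B)%E.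

Definition nig_series (w : Omega) (B : set X) : \bar R :=
  let J i := (levy_tail_inv a (arrival i.+1 w))%:E in
  (\sum_(0 <= i <oo) J i / (\sum_(0 <= j <oo) J j) * \d_(theta i w) B)%E.

End random_measures.

(* Main.v *)
(* Write L^{-1} = J. The points Gamma_i are the arrival times of a unit-rate Poisson process and
   the marks theta_i are independent of them, so the masses W_j = sum_i J(Gamma_i) 1(theta_i in A_j)
   should be independent inverse-Gaussian variables with parameters a H(A_j). This is proved
   without Poisson random measures: with g(u) = sum_j H(A_j) exp(-l_j J(u)), the function
   Phi(t) = exp(- int_t^oo (1 - g)) solves the renewal equation
   Phi(t) = int_0^oo e^{-x} g(t + x) Phi(t + x) dx, hence E[prod_{i <= n} g(Gamma_i) Phi(Gamma_n)]
   = Phi(0) for every n, and n -> oo gives the joint Laplace transform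
   prod_j exp(- a H(A_j) (sqrt(1 + 2 l_j) - 1)). Uniqueness of Laplace transforms is elementary:
   (1 - exp(-n l x))^(n 2^n) tends to the indicator of {l x > ln 2}. The normalized
   inverse-Gaussian density follows by integrating the product density along rays.
   For the convergence, n G_n -> L pointwise and n G_n <= e^a L; since Gamma_n / n -> 1 almost surely
   (Chernoff bounds and Borel-Cantelli) and J(y) = O(1 / y^2), the jumps
   G_n^{-1}(Gamma_i / Gamma_{n+1}) converge to J(Gamma_i) and are dominated by C / i^2. *)
Require Import Defs.
From HB Require Import structures.
From mathcomp Require Import all_boot all_order all_algebra.
From mathcomp Require Import finmap.
From mathcomp Require Import all_classical all_reals all_analysis.
From mathcomp Require Import measurable_realfun.
From mathcomp Require Import ring lra.

Set Implicit Arguments.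
Unset Strict Implicit.
Unset Printing Implicit Defensive.

Import Order.TTheory GRing.Theory Num.Theory.
Import numFieldNormedType.Exports.

Local Open Scope classical_set_scope.
Local Open Scope ring_scope.

(** * Product measures on tuples, determined by rectangles *)

Section product_on_tuples.
Context {R : realType}.

(** [Phi t] is the Laplace functional of the arrivals after t, so the product up to Gamma_n times
    [Phi] at Gamma_n is a martingale. Only its constant expectation is used, and the renewal
    equation behind it is an integration: - e^{-y} Phi(x + y) is an antiderivative. Inverses default
    to 0 outside their range and real integrals to 0 when they diverge, so range membership and
    finiteness are settled before an identity is used. The almost sure statements live on one event
    (positive waiting times, Gamma_n / n -> 1, positive total jump mass) that does not involve the
    set B; on it everything is deterministic analysis, which gives the convergence for all B at
    once. The limit has to be a probability for every outcome, while its finite-dimensional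
    densities only see blocks of positive mass. This forces a correction of the weights on a null
    set and, almost surely, the replacement of the total mass by the sum over the charged blocks. *)

Definition consp n (z : R * n.-tuple R) : n.+1.-tuple R := cons_tuple z.1 z.2.

Lemma measurable_consp n : measurable_fun setT (@consp n).
Proof. exact: measurable_cons. Qed.

HB.instance Definition _ n := isMeasurableFun.Build _ _ _ _ (@consp n) (@measurable_consp n).

Definition dirac0 : probability (0.-tuple R) R := \d_([tuple] : 0.-tuple R).

(** Peeling off the head, as [lebesgue_int] does, lets integrals unfold by Tonelli; indexing the
    factors by [nat] makes the law of the tail a mere shift of [mu]. *)
Fixpoint pm (mu : nat -> probability R R) n : probability (n.-tuple R) R :=
  match n with
  | 0 => dirac0
  | n'.+1 => distribution (mu 0%N \x pm (fun i => mu i.+1) n')%E (@consp n')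
  end.

Lemma integral_pmS (mu : nat -> probability R R) n (F : n.+1.-tuple R -> \bar R) :
  measurable_fun setT F -> (forall t, (0 <= F t)%E) ->
  (\int[pm mu n.+1]_t F t =
   \int[mu 0%N]_x \int[pm (fun i => mu i.+1) n]_t F (cons_tuple x t))%E.
Proof.
move=> mF F0 /=.
rewrite ge0_integral_distribution//.
rewrite fubini_tonelli1//.   exact: (measurableT_comp mF (@measurable_consp n)).
by move=> x; exact: F0.
Qed.

Lemma integral_pm0 (mu : nat -> probability R R) (F : 0.-tuple R -> \bar R) :
  measurable_fun setT F -> (forall t, (0 <= F t)%E) ->
  (\int[pm mu 0]_t F t = F [tuple])%E.
Proof.
move=> mF F0 /=.
by rewrite integral_dirac// diracT mul1e.
Qed.

Definition rect n (B : nat -> set R) : set (n.-tuple R) :=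
  [set t | forall i : 'I_n, B i (tnth t i)].

Lemma measurable_rect n B : (forall i, measurable (B i)) -> measurable (@rect n B).
Proof.
move=> mB.
rewrite (_ : rect _ = \bigcap_(i in [set: 'I_n]) ((@tnth n R ^~ i) @^-1` B i)).
  apply: fin_bigcap_measurable => // i _.
  by rewrite -[X in measurable X]setTI; exact: measurable_tnth.
by apply/seteqP; split => t /= h i => [_|]; exact: h.
Qed.

Lemma pm_rect (mu : nat -> probability R R) n B : (forall i, measurable (B i)) ->
  pm mu n (rect B) = (\prod_(i < n) mu i (B i))%E.
Proof.
elim: n mu B => [|n IH] mu B mB /=.
  rewrite big_ord0 diracE mem_set//.
  by move=> [].
rewrite /distribution /pushforward /=.
rewrite (_ : _ @^-1` _ = B 0%N `*` @rect n (fun i => B i.+1)).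
  rewrite product_measure1E//; last exact: measurable_rect.
  by rewrite big_ord_recl; congr (_ * _)%E; exact: (IH _ (fun i => B i.+1)).
apply/seteqP; split => -[x t] /= h.
  split; first exact: (h ord0).
  by move=> i; have := h (lift ord0 i); rewrite tnthS.
move=> i; case: (unliftP ord0 i) => [j ->|->]; last exact: h.1.
by rewrite tnthS; exact: h.2.
Qed.

(** Rectangles are stable under intersection, so with them as generators a measure on tuples is
    pinned down by its values on rectangles. *)
Lemma measurable_tupleE n :
  measurable = <<s [set A : set (n.-tuple R) |
     exists2 B, (forall i, measurable (B i)) & A = rect B] >>.
Proof.
apply/seteqP; split.
- apply: smallest_sub; first exact: smallest_sigma_algebra.
  case: n => [|n].
    by rewrite big_ord0 => ? [].
  move=> A; rewrite -bigcup_seq => -[/= i _ [B mB <-]].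
  apply: sub_sigma_algebra; exists (fun j : nat => if j == i :> nat then B else setT).
    by move=> j; case: ifP.
  apply/seteqP; split => t /=; rewrite /rect/=.
    by move=> [_ Bt] j; case: ifPn => // /eqP/val_inj ->.
  by move=> /(_ i); rewrite eqxx.
- apply: smallest_sub; first exact: sigma_algebra_measurable.
  by move=> A [B mB ->]; exact: measurable_rect.
Qed.

(** The factor [c] allows for the restriction of a probability to an event, whose total mass is the
    probability of that event. *)
Lemma pm_unique (mu : nat -> probability R R) n (c : R) (m : {measure set (n.-tuple R) -> \bar R}) :
  0 <= c ->
  (forall B, (forall i, measurable (B i)) ->
    m (rect B) = (c%:E * \prod_(i < n) mu i (B i))%E) ->
  forall A, measurable A -> m A = (c%:E * pm mu n A)%E.
Proof.
move=> c0 mE A mA.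
have := @measure_unique _ _ _ _ (fun=> setT) (measurable_tupleE n) _ _ _ m
  (mscale (NngNum c0) (pm mu n)).
apply => //.
- move=> _ _ [B1 mB1 ->] [B2 mB2 ->]; exists (fun i => B1 i `&` B2 i).
    by move=> i; exact: measurableI.
  apply/seteqP; split => t /=; first by move=> [h1 h2] i.
  by move=> h; split => i; have [] := h i.
- move=> i; exists (fun=> setT) => //.
  by apply/seteqP; split.
- by rewrite bigcup_const.
- by move=> _ [B mB ->]; rewrite mE//; congr (_ * _)%E; rewrite -pm_rect.
- move=> _; rewrite (_ : setT = @rect n (fun=> setT)); last by apply/seteqP; split.
  rewrite mE// big1 ?mule1 ?ltry// => i _; exact: probability_setT.
Qed.

End product_on_tuples.

(** * Measures given by a density *)

Section integral_against_density.
Context d (T : measurableType d) (R : realType).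
Variables (mu nu : {measure set T -> \bar R}) (p : T -> R).
Hypotheses (mp : measurable_fun setT p) (p0 : forall x, 0 <= p x).
Hypothesis nuE : forall A, measurable A -> nu A = (\int[mu]_(x in A) (p x)%:E)%E.
Import HBNNSimple.
Local Open Scope ereal_scope.

Lemma ge0_integral_density (f : T -> \bar R) :
  measurable_fun setT f -> (forall x, 0 <= f x) ->
  \int[nu]_x f x = \int[mu]_x (f x * (p x)%:E).
Proof.
move=> mf f0.
have mE := @measurableT _ T.
pose h := nnsfun_approx mE mf.
have hf x : (h n x)%:E @[n --> \oo] --> f x by exact: cvg_nnsfun_approx.
have -> : \int[nu]_x f x = limn (fun n => \int[nu]_x (h n x)%:E).
  rewrite -monotone_convergence//.
  - by apply: eq_integral => x _; apply/esym/cvg_lim.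
  - by move=> n; exact/measurable_EFinP.
  - by move=> n x _; rewrite lee_fin.
  - by move=> x _ a b ab; rewrite lee_fin; exact/lefP/nd_nnsfun_approx.
have -> : \int[mu]_x (f x * (p x)%:E) =
    limn (fun n => \int[mu]_x ((h n x)%:E * (p x)%:E)).
  rewrite -monotone_convergence//.
  - by apply: eq_integral => x _; apply/esym/cvg_lim => //; exact: cvgeZr.
  - move=> n; apply: emeasurable_funM; exact/measurable_EFinP.
  - by move=> n x _; rewrite mule_ge0 ?lee_fin.
  - move=> x _ a b ab; rewrite lee_wpmul2r ?lee_fin//.
    exact/lefP/nd_nnsfun_approx.
congr (limn _); apply/funext => n.
under eq_integral do rewrite fimfunE -fsumEFin//.
rewrite ge0_integral_fsum//; last 2 first.
- by move=> y; exact/measurable_EFinP/measurable_funM.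
- by move=> m x _; exact: nnfun_muleindic_ge0.
transitivity (\sum_(y \in range (h n))
   \int[mu]_x ((y * \1_(h n @^-1` [set y]) x)%:E * (p x)%:E)); last first.
  rewrite -ge0_integral_fsum//.
  - apply: eq_integral => x _.
    rewrite -ge0_mule_fsuml; last by move=> y; exact: nnfun_muleindic_ge0.
    by rewrite fsumEFin // -(fimfunE _ x).
  - move=> y; apply: emeasurable_funM; last exact/measurable_EFinP.
    exact/measurable_EFinP/measurable_funM.
  - move=> y x _; rewrite mule_ge0 ?lee_fin//.
    by rewrite -lee_fin EFinM nnfun_muleindic_ge0.
apply: eq_fsbigr => r rhn.
have r0 : (0 <= r)%R by move: rhn; rewrite inE => -[x _ <-].
under eq_integral do rewrite EFinM.
rewrite ge0_integralZl//; [|exact/measurable_EFinP|by rewrite lee_fin..].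
rewrite integral_indic// setIT nuE//.
under [RHS]eq_integral do rewrite EFinM -muleA.
rewrite [RHS]ge0_integralZl//; last 2 first.
- apply: emeasurable_funM; exact/measurable_EFinP.
- by move=> x _; rewrite mule_ge0 ?lee_fin.
congr (_ * _); rewrite integral_mkcond; apply: eq_integral => x _.
by rewrite patchE indicE; case: (x \in _); rewrite ?mul1e ?mul0e.
Qed.

End integral_against_density.

Section density_measure.
Context d (T : measurableType d) (R : realType).
Variables (mu : {measure set T -> \bar R}) (p : T -> R).
Hypotheses (mp : measurable_fun setT p) (p0 : forall x, 0 <= p x).

(** The base measure is general because it is Lebesgue measure for the inverse-Gaussian law, and [P]
    when a product of random factors serves as weight. *)
Definition density_meas (A : set T) := (\int[mu]_(x in A) (p x)%:E)%E.

Let density0 : density_meas set0 = 0%E.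
Proof. by rewrite /density_meas integral_set0. Qed.

Let density_ge0 A : (0 <= density_meas A)%E.
Proof. by apply: integral_ge0 => x _; rewrite lee_fin. Qed.

Let density_sigma_additive : semi_sigma_additive density_meas.
Proof.
move=> F mF tF mUF; rewrite /density_meas; apply: cvg_toP.
  apply: ereal_nondecreasing_is_cvgn => m n mn.
  apply: lee_sum_nneg_natr => // k _ _; apply: integral_ge0 => x _.
  by rewrite lee_fin.
rewrite ge0_integral_bigcup//=.
- by apply/measurable_funTS; exact/measurable_EFinP.
- by move=> x _; rewrite lee_fin.
Qed.

HB.instance Definition _ := isMeasure.Build _ _ _
  density_meas density0 density_ge0 density_sigma_additive.

Definition density_measure : {measure set T -> \bar R} := density_meas.

Hypothesis p1 : (\int[mu]_x (p x)%:E = 1)%E.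

HB.instance Definition _ := @Measure_isProbability.Build _ _ R density_meas p1.

Definition density_prob : probability T R := density_meas.

End density_measure.

(** * Lebesgue measure under translations and dilations *)

Section lebesgue_affine.
Context {R : realType}.
Let mu := @lebesgue_measure R.
Local Open Scope ereal_scope.

Lemma lebesgue_shift (c : R) (f : R -> \bar R) :
  measurable_fun setT f -> (forall x, 0 <= f x) ->
  \int[mu]_x f (x + c)%R = \int[mu]_x f x.
Proof.
move=> mf f0.
have mphi : measurable_fun [set: R] (fun x : R => (x + c)%R).
  exact: measurable_funD.
have E A : measurable A ->
    mu A = pushforward mu (fun x : measurableTypeR R => (x + c)%R : measurableTypeR R) A.
  move=> mA; apply: lebesgue_measure_unique => // _ [[a b]/= _ <-].
  rewrite /pushforward/=.
  rewrite (_ : _ @^-1` _ = `](a - c)%R, (b - c)%R]%classic).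
    rewrite /mu !lebesgue_measure_itv/= !lte_fin ltrD2r.
    by case: ifP => // _; rewrite -!EFinB; congr EFin; lra.
  by apply/seteqP; split => x /=; rewrite !in_itv/= ltrBlDr lerBrDr.
rewrite [RHS](eq_measure_integral (pushforward mu
  (fun x : measurableTypeR R => (x + c)%R : measurableTypeR R))); last first.
  by move=> A mA _; exact: E.
by rewrite ge0_integral_pushforward.
Qed.

Lemma lebesgue_scale (c : R) (f : R -> \bar R) : (0 < c)%R ->
  measurable_fun setT f -> (forall x, 0 <= f x) ->
  c%:E * \int[mu]_x f (c * x)%R = \int[mu]_x f x.
Proof.
move=> c0 mf f0.
have mphi : measurable_fun [set: R] (fun x : R => (c * x)%R).
  exact: measurable_funM.
have E A : measurable A ->
    mu A = mscale (NngNum (ltW c0)) (pushforward mu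
      (fun x : measurableTypeR R => (c * x)%R : measurableTypeR R)) A.
  move=> mA; apply: lebesgue_measure_unique => // _ [[a b]/= _ <-].
  rewrite /mscale/= /pushforward/=.
  rewrite (_ : _ @^-1` _ = `](c^-1 * a)%R, (c^-1 * b)%R]%classic).
    rewrite /mu !lebesgue_measure_itv/= !lte_fin ltr_pM2l ?invr_gt0//.
    case: ifP => // _; rewrite ?mule0// -!EFinB -EFinM -mulrBr mulrA mulfV ?mul1r//.
    by rewrite gt_eqF.
  by apply/seteqP; split => x /=;
    rewrite !in_itv/= ltr_pdivrMl// ler_pdivlMl.
rewrite [RHS](eq_measure_integral (mscale (NngNum (ltW c0)) (pushforward mu
  (fun x : measurableTypeR R => (c * x)%R : measurableTypeR R)))); last first.
  by move=> A mA _; exact: E.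
by rewrite ge0_integral_mscale// ge0_integral_pushforward.
Qed.

End lebesgue_affine.

(* [lebesgue_measure] lives on [measurableTypeR R], whose display differs from
   that of [R]; pushing forward along the identity bridges the two. *)
Lemma ge0_integral_density_R {R : realType} (nu : {measure set R -> \bar R}) (p : R -> R) :
  measurable_fun setT p -> (forall x, 0 <= p x) ->
  (forall A, measurable A -> nu A = \int[lebesgue_measure]_(x in A) (p x)%:E)%E ->
  forall f : R -> \bar R, measurable_fun setT f -> (forall x, (0 <= f x)%E) ->
  (\int[nu]_x f x = \int[lebesgue_measure]_x (f x * (p x)%:E))%E.
Proof.
move=> mp p0 nuE f mf f0.
have mid : measurable_fun setT (id : R -> measurableTypeR R).
  by move=> _ A mA; rewrite setTI; exact: mA.
pose nu' : {measure set (measurableTypeR R) -> \bar R} :=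
  measure_function_pushforward__canonical__measure_function_Measure nu mid.
transitivity (\int[nu']_x f x)%E; first by rewrite [RHS]ge0_integral_pushforward.
exact: (ge0_integral_density (T := measurableTypeR R)).
Qed.

Section pm_law.
Context {R : realType} d (Omega : measurableType d) (P : {measure set Omega -> \bar R}).

(** [P] is only a measure here, of mass [c], so that a probability restricted to an event of the
    marks is covered too. *)
Lemma pm_law (mu : nat -> probability R R) n (c : R) (V : Omega -> n.-tuple R) :
  0 <= c -> measurable_fun setT V ->
  (forall B : nat -> set R, (forall i, measurable (B i)) ->
    P [set w | forall i : 'I_n, B i (tnth (V w) i)] = (c%:E * \prod_(i < n) mu i (B i))%E) ->
  forall F : n.-tuple R -> \bar R, measurable_fun setT F ->
    (forall t, (0 <= F t)%E) ->
  (\int[P]_w F (V w) = c%:E * \int[pm mu n]_t F t)%E.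
Proof.
move=> c0 mV PE F mF F0.
have h := @pm_unique R mu n c (pushforward P V) c0 PE.
rewrite -(ge0_integral_mscale (pm mu n) _ (NngNum c0))//.
rewrite [RHS](eq_measure_integral (pushforward P V)).
  by rewrite [RHS]ge0_integral_pushforward.
by move=> A mA _; apply/esym; exact: h.
Qed.

End pm_law.

(** * Iterated Lebesgue integrals: measurability, Tonelli, scaling, product densities *)

Section lebesgue_int_theory.
Context {R : realType}.
Local Open Scope ereal_scope.

Lemma lebesgue_int_ge0 k (f : k.-tuple R -> \bar R) :
  (forall t, 0 <= f t) -> 0 <= lebesgue_int f.
Proof.
elim: k f => [|k IH] f f0 /=; first exact: f0.
by apply: integral_ge0 => x _; exact: IH.
Qed.

Lemma eq_lebesgue_int k (f g : k.-tuple R -> \bar R) :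
  f =1 g -> lebesgue_int f = lebesgue_int g.
Proof. by move=> /funext ->. Qed.

(** The parameter space is arbitrary because the induction moves the head coordinate from the tuple
    into the parameter. *)
Lemma measurable_lebesgue_int k d (T : measurableType d)
    (f : T * k.-tuple R -> \bar R) :
  measurable_fun setT f -> (forall t, 0 <= f t) ->
  measurable_fun [set: T] (fun y => lebesgue_int (fun t => f (y, t))).
Proof.
elim: k d T f => [|k IH] d T f mf f0 /=.
  by apply: measurableT_comp => //; exact: measurable_pair2.
pose g (z : (T * R) * k.-tuple R) := f (z.1.1, cons_tuple z.1.2 z.2).
have mg : measurable_fun setT g.
  apply: measurableT_comp => //; apply/measurable_fun_pairP; split => /=.
    exact: (measurableT_comp measurable_fst measurable_fst).
  apply: measurable_cons => //.
  exact: (measurableT_comp measurable_snd measurable_fst).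
have := IH _ _ g mg (fun=> f0 _) => mG.
have := @measurable_fun_fubini_tonelli_F _ _ T _ R (@lebesgue_measure R) _ mG.
by apply => z; apply: lebesgue_int_ge0 => t; exact: f0.
Qed.

Lemma lebesgue_int_tonelli k (f : R * k.-tuple R -> \bar R) :
  measurable_fun setT f -> (forall t, 0 <= f t) ->
  \int[lebesgue_measure]_x lebesgue_int (fun t => f (x, t)) =
  lebesgue_int (fun t => \int[lebesgue_measure]_x f (x, t)).
Proof.
elim: k f => [|k IH] f mf f0 //=.
pose g (z : (R * R) * k.-tuple R) := f (z.1.1, cons_tuple z.1.2 z.2).
have mg : measurable_fun setT g.
  apply: measurableT_comp => //; apply/measurable_fun_pairP; split => /=.
    exact: (measurableT_comp measurable_fst measurable_fst).
  apply: measurable_cons => //.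
  exact: (measurableT_comp measurable_snd measurable_fst).
have mG := measurable_lebesgue_int mg (fun=> f0 _).
have := @fubini_tonelli _ _ _ _ R (@lebesgue_measure R) (@lebesgue_measure R) _ mG.
rewrite /fubini_F /fubini_G /= => ->; last first.
  by move=> z; apply: lebesgue_int_ge0 => t; exact: f0.
apply: eq_integral => y _.
pose h (z : R * k.-tuple R) := f (z.1, cons_tuple y z.2).
rewrite /g /=.
apply: (IH h) => [|t]; last exact: f0.
apply: measurableT_comp => //; apply/measurable_fun_pairP; split.
  exact: measurable_fst.
apply: measurable_cons; first exact: measurable_cst.
exact: measurable_snd.
Qed.

Lemma lebesgue_intZl k (c : R) (f : k.-tuple R -> \bar R) : (0 <= c)%R ->
  measurable_fun setT f -> (forall t, 0 <= f t) ->
  lebesgue_int (fun t => c%:E * f t) = c%:E * lebesgue_int f.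
Proof.
move=> c0; elim: k f => [|k IH] f mf f0 //=.
rewrite -ge0_integralZl//.
- apply: eq_integral => x _; rewrite IH//.
  apply: measurableT_comp => //.
  by apply: measurable_cons => //; exact: measurable_cst.
- apply: (@measurable_lebesgue_int k _ _ (fun z => f (cons_tuple z.1 z.2))) => //.
  exact: (measurableT_comp mf (@measurable_consp R k)).
- by move=> x _; exact: lebesgue_int_ge0.
Qed.

Lemma lebesgue_int_scale k (c : R) (f : k.-tuple R -> \bar R) : (0 < c)%R ->
  measurable_fun setT f -> (forall t, 0 <= f t) ->
  (c ^+ k)%:E * lebesgue_int (fun t => f [tuple c * tnth t i | i < k]%R) = lebesgue_int f.
Proof.
move=> c0; elim: k f => [|k IH] f mf f0 /=.
  by rewrite expr0 mul1e; congr f; exact: tuple0.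
have mg : measurable_fun setT (fun x : R => lebesgue_int (fun t => f (cons_tuple x t))).
  apply: (@measurable_lebesgue_int k _ _ (fun z => f (cons_tuple z.1 z.2))) => //.
  exact: (measurableT_comp mf (@measurable_consp R k)).
rewrite -[RHS](lebesgue_scale c0)//; last by move=> x; exact: lebesgue_int_ge0.
rewrite exprS EFinM -muleA; congr (_ * _).
have mt : measurable_fun [set: R * k.-tuple R]
    (fun z => [tuple c * tnth (cons_tuple z.1 z.2) i | i < k.+1]%R).
  apply/measurable_fun_tnthP => i.
  rewrite (_ : _ \o _ = fun z : R * k.-tuple R => (c * tnth (cons_tuple z.1 z.2) i)%R); last first.
    by apply/funext => z /=; rewrite tnth_mktuple.
  apply: measurable_funM => //.
  by apply: (measurableT_comp (measurable_tnth i)); exact: measurable_consp.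
rewrite -ge0_integralZl//; last 3 first.
- apply: (@measurable_lebesgue_int k _ _
    (fun z => f [tuple c * tnth (cons_tuple z.1 z.2) i | i < k.+1]%R)) => //.
  exact: (measurableT_comp mf mt).
- by move=> x _; exact: lebesgue_int_ge0.
- by rewrite lee_fin exprn_ge0// ltW.
apply: eq_integral => x _.
rewrite -[RHS]IH//; last first.
  apply: measurableT_comp => //.
  by apply: measurable_cons => //; exact: measurable_cst.
congr (_ * _); apply: eq_lebesgue_int => t; congr f.
apply: eq_from_tnth => i; rewrite tnth_mktuple.
case: (unliftP ord0 i) => [j ->|->]; first by rewrite !tnthS tnth_mktuple.
by rewrite !tnth0.
Qed.

Lemma integral_pm_density (p : nat -> R -> R) (mu : nat -> probability R R) n :
  (forall i, measurable_fun setT (p i)) -> (forall i x, (0 <= p i x)%R) ->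
  (forall i A, measurable A -> mu i A = \int[lebesgue_measure]_(x in A) (p i x)%:E) ->
  forall F : n.-tuple R -> \bar R, measurable_fun setT F ->
    (forall t, 0 <= F t) ->
  \int[pm mu n]_t F t = lebesgue_int (fun t => F t * (\prod_(i < n) p i (tnth t i))%:E).
Proof.
elim: n p mu => [|n IH] p mu mp p0 muE F mF F0.
  by rewrite integral_pm0//= big_ord0 mule1.
rewrite integral_pmS//=.
pose G x := \int[pm (fun i => mu i.+1) n]_t F (cons_tuple x t).
have mFc : measurable_fun setT (fun z : R * n.-tuple R => F (cons_tuple z.1 z.2)).
  by apply: measurableT_comp => //; exact: measurable_consp.
have mG : measurable_fun setT G.
  exact: (@measurable_fun_fubini_tonelli_F _ _ _ _ R (pm (fun i => mu i.+1) n) _ mFc).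
transitivity (\int[lebesgue_measure]_x (G x * (p 0%N x)%:E)).
  apply: (ge0_integral_density_R (mp 0%N) (p0 0%N) (muE 0%N)) => //.
  by move=> x; exact: integral_ge0.
apply: eq_integral => x _.
have mFx : measurable_fun [set: n.-tuple R] (fun t => F (cons_tuple x t)).
  apply: measurableT_comp => //.
  by apply: measurable_cons => //; exact: measurable_cst.
have -> : G x = lebesgue_int (fun t : n.-tuple R =>
    F (cons_tuple x t) * (\prod_(i < n) p i.+1 (tnth t i))%:E).
  by apply: (IH (fun i => p i.+1)) => //; move=> i A; exact: muE.
rewrite muleC -lebesgue_intZl//.
- apply: eq_lebesgue_int => t.
  rewrite big_ord_recl tnth0 EFinM muleCA; congr (_ * (_ * _)).
  by congr EFin; apply: eq_bigr => i _; rewrite tnthS.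
- apply: emeasurable_funM => //; apply/measurable_EFinP.
  apply: measurable_prod => i _.
  by apply: measurableT_comp => //; exact: measurable_tnth.
- by move=> t; rewrite mule_ge0 ?lee_fin ?prodr_ge0.
Qed.

End lebesgue_int_theory.

(** * Improper integrals by antiderivatives, and bounded convergence *)

Section ftc_open.
Context {R : realType}.
Let mu := @lebesgue_measure R.

(** The integrands to come may blow up at [a]. The half-lines [[e n, +oo[] exhaust []a, +oo[], and
    nonnegativity makes the integrals over them converge monotonically. *)
Lemma ge0_FTC_open (f F : R -> R) (a la l : R) :
  (forall x, a < x -> 0 <= f x) ->
  (forall x, a < x -> {for x, continuous f}) ->
  (forall x, a < x -> is_derive x 1 F (f x)) ->
  F x @[x --> a^'+] --> la -> F x @[x --> +oo] --> l ->
  (\int[mu]_(x in `]a, +oo[) (f x)%:E = (l - la)%:E)%E.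
Proof.
move=> f0 cf dF Fa Fy.
pose e n : R := a + n.+1%:R^-1.
have ae n : a < e n by rewrite ltrDl invr_gt0.
pose A n := [set` `[e n, +oo[].
have AU : `]a, +oo[%classic = \bigcup_n A n.
  apply/seteqP; split => x /=.
    rewrite in_itv/= andbT => ax.
    have xa : 0 < x - a by rewrite subr_gt0.
    exists (Num.truncn (x - a)^-1) => //; rewrite /A/= in_itv/= andbT /e -lerBrDl.
    rewrite -[leRHS]invrK lef_pV2 ?posrE ?invr_gt0//.
    by rewrite ltW// truncnS_gt.
  move=> [n _]; rewrite /A/= !in_itv/= !andbT; exact: lt_le_trans.
have mf : measurable_fun `]a, +oo[ f.
  apply: open_continuous_measurable_fun => // x.
  by rewrite inE/= in_itv/= andbT; exact: cf.
have E n : (\int[mu]_(x in A n) (f x)%:E = (l - F (e n))%:E)%E.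
  rewrite (@ge0_continuous_FTC2y _ _ F _ l)//.
  - by move=> x ex; rewrite f0// (lt_le_trans (ae n)).
  - apply/continuous_within_itvcyP; split.
      by move=> x; rewrite in_itv/= andbT => ex; apply: cf; exact: lt_trans ex.
    by apply/cvg_at_right_filter; exact: cf.
  - by move=> x ex; have := dF x (lt_trans (ae n) ex); case.
  - apply/cvg_at_right_filter.
    have := dF _ (ae n) => -[] /derivable1_diffP/differentiable_continuous.
    exact.
  - move=> x; rewrite in_itv/= andbT => ex; rewrite derive1E.
    by have := dF x (lt_trans (ae n) ex) => ?; rewrite derive_val.
have mA n : measurable (A n) by exact: measurable_itv.
have ndA : nondecreasing_seq A.
  move=> m n mn; apply/subsetPset => x; rewrite /A/= !in_itv/= !andbT.
  apply: le_trans; rewrite /e lerD2l lef_pV2 ?posrE//.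
  by rewrite ler_nat ltnS.
have mfA n : measurable_fun (A n) (EFin \o f).
  apply/measurable_EFinP; apply: measurable_funS mf => //.
  by rewrite AU; exact: bigcup_sup.
have f0A n x : A n x -> (0 <= (EFin \o f) x)%E.
  by rewrite /A/= in_itv/= andbT lee_fin => ex; apply: f0; exact: lt_le_trans ex.
have := @ge0_nondecreasing_set_cvg_integral _ (measurableTypeR R) R A
  (EFin \o f) (@lebesgue_measure R) ndA mA mfA f0A.
rewrite -AU => /cvg_lim <-//.
under eq_fun do rewrite E.
apply/cvg_lim => //; apply: cvg_EFin; first exact: nearW.
rewrite (_ : fine \o _ = fun n => l - F (e n))//.
apply: cvgB; first exact: cvg_cst.
move/cvg_at_rightP : Fa; apply; split => //.
rewrite -[X in _ --> X]addr0; apply: cvgD; first exact: cvg_cst.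
exact: cvg_harmonic.
Qed.

End ftc_open.

Section bounded_convergence.
Context d (T : measurableType d) (R : realType) (mu : {measure set T -> \bar R}).

Lemma bounded_convergence (f_ : nat -> T -> R) (f : T -> R) :
  (mu [set: T] < +oo)%E ->
  (forall n, measurable_fun setT (f_ n)) -> measurable_fun setT f ->
  {ae mu, forall x, f_ n x @[n --> \oo] --> f x} ->
  (forall n x, `|f_ n x| <= 1) ->
  (\int[mu]_x (f_ n x)%:E @[n --> \oo] --> \int[mu]_x (f x)%:E)%E.
Proof.
move=> muoo mf_ mf ff f1.
have [] // := @dominated_convergence _ _ _ mu setT measurableT
  (fun n x => (f_ n x)%:E) (EFin \o f) (fun=> 1%E).
- by move=> n; exact/measurable_EFinP.
- exact/measurable_EFinP.
- case: ff => N [mN N0 sN]; exists N; split => // x /= h; apply: sN => /= fx.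
  by apply: h => _; apply: cvg_EFin; [exact: nearW|exact: fx].
- apply: (measurable_bounded_integrable (f := fun=> 1)) => //.
  exact: bounded_cst.
- by apply: aeW => x n _; rewrite lee_fin.
Qed.

End bounded_convergence.

(** * Uniqueness of Laplace transforms on the half-line *)

Section laplace_uniqueness.
Context {R : realType}.

(** Splitting r^n as s^n s^n, with s the square root of r, leaves one factor to absorb n: by
    Bernoulli's inequality n s^n stays below [(s^-1 - 1)^-1]. *)
Lemma cvg_mulrn_geometric (r : R) : 0 <= r < 1 -> (n%:R * r ^+ n) @[n --> \oo] --> (0 : R).
Proof.
move=> /andP[r0 r1].
have [->|rn0] := eqVneq r 0.
  apply: cvg_near_cst; near=> n.
  by rewrite expr0n; case: (n == 0%N) / eqP => [->|]; rewrite ?mul0r ?mulr0.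
have {}r0 : 0 < r by rewrite lt_neqAle eq_sym rn0.
pose s := Num.sqrt r.
have s0 : 0 < s by rewrite sqrtr_gt0.
have s1 : s < 1 by rewrite -sqrtr1 ltr_sqrt.
have d0 : 0 < s^-1 - 1 by rewrite subr_gt0 invf_gt1.
have B n : n%:R * s ^+ n <= (s^-1 - 1)^-1.
  rewrite -ler_pdivlMr ?exprn_gt0// -exprVn.
  rewrite ler_pdivlMl//.
  elim: n => [|n IH]; first by rewrite mulr0.
  rewrite exprS -natr1 mulrDr mulr1.
  have : 1 <= s^-1 ^+ n by apply: exprn_ege1; rewrite ltW// invf_gt1.
  set x := s^-1 ^+ n in IH *; nra.
apply: (@squeeze_cvgr _ _ _ _ (fun=> 0) (fun n => (s^-1 - 1)^-1 * s ^+ n)).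
- near=> n; rewrite mulr_ge0 ?exprn_ge0 ?(ltW r0)//=.
  have -> : r ^+ n = s ^+ n * s ^+ n by rewrite -exprMn -expr2 sqr_sqrtr// ltW.
  by rewrite mulrA ler_wpM2r ?exprn_ge0 ?(ltW s0).
- exact: cvg_cst.
- rewrite -[X in _ --> X](mulr0 (s^-1 - 1)^-1); apply: cvgM; first exact: cvg_cst.
  by apply: cvg_expr; rewrite ger0_norm ?(ltW s0).
Unshelve. all: by end_near. Qed.

Lemma bernoulli_onem (v : R) N : 0 <= v <= 1 -> 1 - N%:R * v <= (1 - v) ^+ N.
Proof.
move=> /andP[v0 v1]; elim: N => [|N IH]; first by rewrite mul0r subr0.
rewrite exprS -natr1.
have : 0 <= N%:R * v by rewrite mulr_ge0.
set x := N%:R in IH *; set y := (1 - v) ^+ N in IH *; nra.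
Qed.

(** Below 1/2, Bernoulli's inequality gives the lower bound 1 - n (2u)^n, which tends to 1. From 1/2
    on, 1 - v <= e^{-v} gives the upper bound e^{-n}. The factor n beside 2^n in the exponent is
    what forces the limit 0 at u = 1/2 too. *)
Lemma threshold_cvg (u : R) : 0 <= u <= 1 ->
  ((1 - u ^+ n) ^+ (n * 2 ^ n)) @[n --> \oo] --> ((u < 2^-1)%R%:R : R).
Proof.
move=> /andP[u0 u1].
have un n : 0 <= u ^+ n <= 1 by rewrite exprn_ge0// exprn_ile1.
case: ltP => u2.
- apply: (@squeeze_cvgr _ _ _ _ (fun n => 1 - n%:R * (2 * u) ^+ n) (fun=> 1)).
  + near=> n; have /andP[? ?] := un n.
    rewrite exprn_ile1 ?subr_ge0 ?gerBl// andbT.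
    apply: le_trans (bernoulli_onem _ (un n)).
    by rewrite natrM natrX exprMn mulrA.
  + rewrite -[X in _ --> X](subr0 1); apply: cvgB; first exact: cvg_cst.
    apply: cvg_mulrn_geometric; lra.
  + exact: cvg_cst.
- apply: (@squeeze_cvgr _ _ _ _ (fun=> 0) (fun n => expR (- n%:R))).
  + near=> n; have /andP[? ?] := un n.
    rewrite exprn_ge0 ?subr_ge0//=.
    have -> : expR (- n%:R) = expR (- (2^-1 ^+ n)) ^+ (n * 2 ^ n) :> R.
      rewrite -expRM_natr natrM natrX mulNr mulrCA exprVn mulVf ?mulr1//.
    apply: lerXn2r; rewrite ?nnegrE ?subr_ge0 ?expR_ge0//.
    apply: le_trans (expR_ge1Dx _).
    by rewrite lerD2l lerN2 lerXn2r ?nnegrE.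
  + exact: cvg_cst.
  + exact: (cvg_comp _ (fun x : R => expR (- x)) (@cvgr_idn R) (@cvgr_expR R)).
Unshelve. all: by end_near. Qed.

Variables m1 m2 : {measure set R -> \bar R}.
Hypothesis m1oo : (m1 [set: R] < +oo)%E.
Hypothesis m2oo : (m2 [set: R] < +oo)%E.
Hypothesis m1neg : m1 `]-oo, 0[%classic = 0%E.
Hypothesis m2neg : m2 `]-oo, 0[%classic = 0%E.
Hypothesis lapE : forall l : R, 0 <= l ->
  (\int[m1]_x (expR (- l * `|x|))%:E = \int[m2]_x (expR (- l * `|x|))%:E)%E.

(** With the absolute value the exponential stays in [0, 1] on the whole line; for measures that
    vanish on []-oo, 0[] the integral is still the Laplace transform. *)
Let e (l x : R) := expR (- l * `|x|).

Let e01 l x : 0 <= l -> 0 <= e l x <= 1.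
Proof.
move=> l0; rewrite expR_ge0/= -expR0 ler_expR mulNr oppr_le0.
by rewrite mulr_ge0.
Qed.

Let me_ l : measurable_fun setT (e l).
Proof. by apply: measurableT_comp => //; apply: measurable_funM. Qed.

Let eX l n x : e l x ^+ n = e (n%:R * l) x.
Proof. by rewrite /e -expRM_natl mulrA mulrN. Qed.

Let ebnd (m : {measure set R -> \bar R}) l k n N : (m setT < +oo)%E -> 0 <= l ->
  m.-integrable setT (fun x => (e l x ^+ k * (1 - e l x ^+ n) ^+ N)%:E).
Proof.
move=> moo l0.
have h x : 0 <= e l x ^+ k * (1 - e l x ^+ n) ^+ N <= 1.
  have /andP[a b] := e01 x l0.
  rewrite mulr_ge0 ?exprn_ge0 ?subr_ge0 ?exprn_ile1//= mulr_ile1 ?exprn_ge0 ?exprn_ile1//.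
  - by rewrite subr_ge0 exprn_ile1.
  - by rewrite subr_ge0 exprn_ile1.
  - by rewrite gerBl exprn_ge0.
apply: (measurable_bounded_integrable (f := fun x => e l x ^+ k * (1 - e l x ^+ n) ^+ N)) => //.
  apply: measurable_funM; apply: measurable_funX => //.
  by apply: measurable_funB => //; exact: measurable_funX.
exists 1; split => // M M1 x _ /=.
have /andP[a b] := h x.
by rewrite ger0_norm// (le_trans b)// ltW.
Qed.

(** Expanding one factor 1 - e^n lowers N at the price of a larger exponent k, so k is generalized
    in the induction. At N = 0 there remains a Laplace transform at the rate k l. *)
Let polyE l k n N : 0 <= l ->
  (\int[m1]_x (e l x ^+ k * (1 - e l x ^+ n) ^+ N)%:E =
   \int[m2]_x (e l x ^+ k * (1 - e l x ^+ n) ^+ N)%:E)%E.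
Proof.
move=> l0; elim: N k => [|N IH] k.
  under eq_integral do rewrite expr0 mulr1 eX.
  under [RHS]eq_integral do rewrite expr0 mulr1 eX.
  by apply: lapE; rewrite mulr_ge0.
have E x : (e l x ^+ k * (1 - e l x ^+ n) ^+ N.+1)%:E =
  ((e l x ^+ k * (1 - e l x ^+ n) ^+ N)%:E
   - (e l x ^+ (k + n) * (1 - e l x ^+ n) ^+ N)%:E)%E.
  by rewrite -EFinB exprD exprS; congr EFin; ring.
under eq_integral do rewrite E.
under [RHS]eq_integral do rewrite E.
by rewrite !integralB ?IH//; exact: ebnd.
Qed.

Let mray (c : R) : measurable [set x : R | c < `|x|].
Proof.
rewrite (_ : [set x | _] = (fun x : R => `|x|) @^-1` `]c, +oo[).
  by rewrite -[X in measurable X]setTI; exact: normr_measurable.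
by apply/seteqP; split => x /=; rewrite in_itv/= andbT.
Qed.

Let ray_abs (c : R) : 0 < c -> m1 [set x | c < `|x|] = m2 [set x | c < `|x|].
Proof.
(* At this rate e^{-l|x|} < 1/2 exactly when |x| > c, so the threshold functions converge to the
   indicator of that set. *)
move=> c0; pose l := ln 2 / c.
have ln2 : 0 < ln (2 : R) by rewrite ln_gt0// ltr1n.
have l0 : 0 < l by rewrite divr_gt0.
have E x : (e l x < 2^-1) = (c < `|x|).
  have -> : 2^-1 = expR (- ln 2) :> R by rewrite expRN lnK// posrE.
  rewrite ltr_expR mulNr ltrN2 /l mulrAC ltr_pdivlMr//.
  by rewrite ltr_pM2l.
pose f_ n x := (1 - e l x ^+ n) ^+ (n * 2 ^ n).
have mf_ n : measurable_fun setT (f_ n).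
  by apply: measurable_funX; apply: measurable_funB => //; exact: measurable_funX.
have f1 n x : `|f_ n x| <= 1.
  have /andP[a b] := e01 x (ltW l0).
  by rewrite ger0_norm ?exprn_ge0 ?exprn_ile1 ?subr_ge0 ?exprn_ile1 ?gerBl ?exprn_ge0.
have ff x : f_ n x @[n --> \oo] --> (\1_[set x | c < `|x|] x : R).
  rewrite indicE (_ : (_ \in _) = (e l x < 2^-1)); last first.
    by rewrite E; apply/idP/idP; rewrite inE.
  by apply: threshold_cvg; apply: e01; exact: ltW.
have K (m : {measure set R -> \bar R}) : (m setT < +oo)%E ->
    (\int[m]_x (f_ n x)%:E @[n --> \oo] --> m [set x : R | (c < `|x|)%R])%E.
  move=> moo; rewrite -[[set x | _]]setIT -integral_indic//.
  apply: bounded_convergence => //.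
  by apply: aeW => x; exact: ff.
apply: (@cvg_unique _ (@ereal_hausdorff R) _ _ _ _ (K m1 m1oo)).
rewrite (_ : (fun n => _) = (fun n => \int[m2]_x (f_ n x)%:E)%E); first exact: K.
apply/funext => n; have := @polyE l 0 n (n * 2 ^ n) (ltW l0).
under eq_integral do rewrite expr0 mul1r.
by under [in RHS]eq_integral do rewrite expr0 mul1r.
Qed.

Let total : m1 setT = m2 setT.
Proof.
have := lapE (lexx 0).
under eq_integral do rewrite oppr0 mul0r expR0.
under [in RHS]eq_integral do rewrite oppr0 mul0r expR0.
by rewrite !integral_cst// !mul1e.
Qed.

Let null_sub (m : {measure set R -> \bar R}) (A : set R) : m `]-oo, 0[%classic = 0%E ->
  measurable A -> A `<=` `]-oo, 0[%classic -> m A = 0%E.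
Proof. by move=> m0 mA Am; apply: (subset_measure0 mA (measurable_itv `]-oo, 0[)). Qed.

Let ray_pos (c : R) : 0 < c -> m1 `]c, +oo[%classic = m2 `]c, +oo[%classic.
Proof.
move=> c0.
have E (m : {measure set R -> \bar R}) : m `]-oo, 0[%classic = 0%E ->
    m [set x | c < `|x|] = m `]c, +oo[%classic.
  move=> m0.
  rewrite (_ : [set x : R | c < `|x|] = `]c, +oo[%classic `|` `]-oo, (- c)[%classic).
    rewrite measureU//.
      rewrite -[RHS]adde0; congr (_ + _)%E; apply: null_sub => //.
      by move=> x /=; rewrite !in_itv/= => xc; rewrite (lt_trans xc)// oppr_lt0.
    rewrite -subset0 => x /= [].
    rewrite !in_itv/= andbT => cx xc.
    by have : c < - c := lt_trans cx xc; lra.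
  by apply/seteqP; split => x /=; rewrite !in_itv/= andbT lter_normr ltrNr => /orP.
by rewrite -E// -[RHS]E// ray_abs.
Qed.

(** The rate ln 2 / c excludes c = 0; this ray is reached by continuity from below along c = 1/(n +
    1). *)
Let ray_0 : m1 `]0, +oo[%classic = m2 `]0, +oo[%classic.
Proof.
rewrite (_ : `]0, +oo[%classic = \bigcup_n `]n.+1%:R^-1, +oo[%classic); last first.
  apply/seteqP; split => x /=.
    rewrite in_itv/= andbT => x0.
    exists (Num.truncn x^-1) => //=; rewrite in_itv/= andbT.
    by rewrite -[ltRHS]invrK ltf_pV2 ?posrE ?invr_gt0// truncnS_gt.
  by move=> [n _] /=; rewrite !in_itv/= !andbT; apply: lt_trans; rewrite invr_gt0.
have nd : {homo (fun n => `]n.+1%:R^-1, +oo[%classic : set R) : n m / (n <= m)%N >-> (n <= m)%O}.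
  move=> a b ab; apply/subsetPset => x; rewrite /= !in_itv/= !andbT.
  by apply: le_lt_trans; rewrite lef_pV2 ?posrE// ler_nat ltnS.
have K (m : {measure set R -> \bar R}) := @nondecreasing_cvg_mu _ _ _ m
  (fun n => `]n.+1%:R^-1, +oo[%classic) (fun=> measurable_itv _) (bigcup_measurable (fun n _ => measurable_itv _)) nd.
apply: (@cvg_unique _ (@ereal_hausdorff R) _ _ _ _ (K m1)).
rewrite (_ : _ \o _ = m2 \o (fun n => `]n.+1%:R^-1, +oo[%classic)); first exact: K.
by apply/funext => n /=; rewrite ray_pos// invr_gt0.
Qed.

(** Open rays form a generating pi-system. For c < 0 a ray carries the whole mass, which is the
    transform at 0. *)
Lemma laplace_unique A : measurable A -> m1 A = m2 A.
Proof.
have GI : setI_closed (@RGenOInfty.G R).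
  move=> _ _ [x ->] [y ->]; exists (Num.max x y).
  by apply/seteqP; split => z /=; rewrite !in_itv/= !andbT gt_max => /andP.
pose g n : set R := `](- n%:R), +oo[%classic.
have Gg n : @RGenOInfty.G R (g n) by exists (- n%:R).
have gT : \bigcup_n g n = setT.
  apply/seteqP; split => // x _; exists (Num.truncn `|x|).+1 => //=.
  rewrite /g/= in_itv/= andbT ltrNl (le_lt_trans _ (truncnS_gt _))//.
  by rewrite -normrN ler_norm.
have E B : @RGenOInfty.G R B -> m1 B = m2 B.
  move=> [c ->].
  have [c0|c0|<-] := ltgtP 0 c; [exact: ray_pos| |exact: ray_0].
  have E (m : {measure set R -> \bar R}) : m `]-oo, 0[%classic = 0%E ->
      m `]c, +oo[%classic = m setT.
    move=> m0; rewrite -(setUv `]c, +oo[%classic) measureU ?setICr//; last first.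
      by apply: measurableC; exact: measurable_itv.
    rewrite -[LHS]adde0; congr (_ + _)%E; apply/esym.
    apply: null_sub => //; first by apply: measurableC; exact: measurable_itv.
    by rewrite setCitvr => x /=; rewrite !in_itv/= => xc; rewrite (le_lt_trans xc).
  by rewrite E// [RHS]E// total.
have goo n : (m1 (g n) < +oo)%E.
  by apply: le_lt_trans m1oo; apply: le_measure; rewrite ?inE//; exact: measurable_itv.
exact: (@measure_unique _ R R (@RGenOInfty.G R) g (@RGenOInfty.measurableE R) GI Gg gT m1 m2 E goo).
Qed.

End laplace_uniqueness.

(** * The Gaussian primitive and the explicit integrals built on it *)

Section gaussian_integrals.
Context {R : realType}.
Let mu := @lebesgue_measure R.

Definition gauss_cdf (x : R) : R := (\int[mu]_(t in `]-oo, x]) gauss_fun t)%R.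

Lemma is_derive_gauss_cdf (x : R) : is_derive x 1 gauss_cdf (gauss_fun x).
Proof.
have ig : mu.-integrable `]-oo, x + 1] (EFin \o @gauss_fun R).
  apply: (@integrableS _ (measurableTypeR R) R mu setT) => //.
  exact: integrableT_gauss.
have x1 : x < x + 1 by rewrite ltrDl.
have [d dE] := @continuous_FTC1 R (@gauss_fun R) -oo%O x (x + 1) x1 ig (ltNyr x)
  (@continuous_gauss_fun R x).
apply: DeriveDef; first exact: d.
by rewrite -derive1E; exact: dE.
Qed.

(** One dominated convergence serves both ends: [A] is [setT] for the limit at +oo and [set0] for
    the limit at -oo. *)
Lemma cvg_gauss_cdf_seq (u : R^nat) (A : set R) :
  measurable A ->
  (forall x, ((x <= u n)%R%:R : R) @[n --> \oo] --> (\1_A x : R)) ->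
  gauss_cdf (u n) @[n --> \oo] --> (\int[mu]_(t in A) gauss_fun t)%R.
Proof.
move=> mA uA.
have mg := @measurable_gauss_fun R.
have [] // := @dominated_convergence _ (measurableTypeR R) R mu setT measurableT
  (fun n x => ((x <= u n)%R%:R * gauss_fun x)%:E)
  (fun x => (\1_A x * gauss_fun x)%:E) (EFin \o @gauss_fun R).
- move=> n; apply/measurable_EFinP; apply: measurable_funM => //.
  rewrite (_ : (fun x => _) = \1_(`]-oo, u n]%classic)).
    by apply: measurable_indic; exact: measurable_itv.
  apply/funext => x; rewrite indicE; congr (nat_of_bool _)%:R.
  by apply/idP/idP; rewrite inE/= in_itv.
- by apply/measurable_EFinP; apply: measurable_funM => //; exact: measurable_indic.
- apply: aeW => x _; apply: cvg_EFin; first exact: nearW.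
  by apply: cvgM; [exact: uA|exact: cvg_cst].
- exact: integrableT_gauss.
- apply: aeW => x n _ /=; rewrite lee_fin normrM ger0_norm// [X in _ * X]ger0_norm ?gauss_fun_ge0//.
  by case: (x <= u n); rewrite ?mul1r ?mul0r ?gauss_fun_ge0.
move=> _ _ h.
have E B : measurable B -> (\int[mu]_x ((\1_B x)%R * gauss_fun x)%:E = \int[mu]_(x in B) (gauss_fun x)%:E)%E.
  move=> mB; rewrite [RHS]integral_mkcond; apply: eq_integral => x _.
  by rewrite patchE indicE; case: (x \in B); rewrite ?mul1r ?mul0r.
have fin B : measurable B -> (\int[mu]_(x in B) (gauss_fun x)%:E)%E \is a fin_num.
  move=> mB; apply: integrable_fin_num => //.
  by apply: (@integrableS _ (measurableTypeR R) R mu setT) => //; exact: integrableT_gauss.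
apply: (fine_cvg (f := fun n => \int[mu]_(t in `]-oo, u n]) (gauss_fun t)%:E)%E).
rewrite fineK ?fin// -E//.
move: h; apply: cvg_trans; apply: near_eq_cvg; near=> n => /=.
rewrite -E; last exact: measurable_itv.
apply: eq_integral => x _; rewrite indicE; congr (_ * _)%:E.
congr (nat_of_bool _)%:R.
by apply/idP/idP; rewrite inE/= in_itv.
Unshelve. all: by end_near. Qed.

Lemma cvg_gauss_cdfy : gauss_cdf x @[x --> +oo] --> Num.sqrt pi.
Proof.
apply/cvg_pinftyP => u uy.
rewrite (_ : Num.sqrt pi = (\int[mu]_(t in setT) gauss_fun t)%R); last first.
  by rewrite /Rintegral integralT_gauss.
apply: cvg_gauss_cdf_seq => // x; rewrite indicT.
apply: cvg_near_cst; near=> n.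
by rewrite (_ : x <= u n)//; near: n; move/cvgryPge : uy; apply.
Unshelve. all: by end_near. Qed.

Lemma cvg_gauss_cdfNy : gauss_cdf x @[x --> -oo] --> (0 : R).
Proof.
apply/cvg_ninftyP => u uy.
rewrite -(@Rintegral_set0 _ (measurableTypeR R) R mu (@gauss_fun R)).
apply: cvg_gauss_cdf_seq => // x; rewrite indic0.
apply: cvg_near_cst; near=> n.
suff : u n < x by rewrite ltNge => /negbTE ->.
by near: n; move/cvgrNyPlt : uy; apply.
Unshelve. all: by end_near. Qed.

Lemma continuous_gauss_cdf : continuous gauss_cdf.
Proof.
move=> x; have [d _] := is_derive_gauss_cdf x.
by move/derivable1_diffP/differentiable_continuous : d.
Qed.

End gaussian_integrals.

Section explicit_integrals.
Context {R : realType}.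
Let mu := @lebesgue_measure R.

Lemma sqrt_cvgy : Num.sqrt t @[t --> +oo] --> (+oo : set_system R).
Proof.
apply/cvgryPge => A; near=> t.
apply: le_trans (ler_norm A) _; rewrite -sqrtr_sqr; apply: ler_wsqrtr.
by near: t; apply: nbhs_pinfty_ge; rewrite num_real.
Unshelve. all: by end_near. Qed.

Lemma invsqrt_cvgy : (Num.sqrt t)^-1 @[t --> 0^'+] --> (+oo : set_system R).
Proof.
apply/cvgryPge => A; near=> t.
have t0 : 0 < t by near: t; exact: nbhs_right_gt.
have A0 : 0 < `|A| + 1 by rewrite ltr_wpDl.
rewrite (@le_trans _ _ (`|A| + 1))//.
  by rewrite (le_trans (ler_norm A))// lerDl.
rewrite -[leLHS]invrK lef_pV2 ?posrE ?sqrtr_gt0 ?invr_gt0//.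
rewrite -[leRHS]ger0_norm ?invr_ge0 ?(ltW A0)// -sqrtr_sqr.
apply: ler_wsqrtr; near: t; apply: nbhs_right_le; rewrite exprn_gt0// invr_gt0//.
Unshelve. all: by end_near. Qed.

Lemma ig_arg_cvgy (c g k : R) : 0 < c -> 0 <= g -> 0 < k ->
  (c * Num.sqrt t - g * (Num.sqrt t)^-1) * k @[t --> +oo] --> (+oo : set_system R).
Proof.
move=> c0 g0 k0; apply/cvgryPge => A; near=> t.
have t1 : 1 <= Num.sqrt t by near: t; move/cvgryPge : sqrt_cvgy; exact.
have tA : (A / k + g) / c <= Num.sqrt t by near: t; move/cvgryPge : sqrt_cvgy; exact.
rewrite -ler_pdivrMr// lerBrDr.
rewrite ler_pdivrMr// [leRHS]mulrC in tA; apply: (le_trans _ tA).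
rewrite lerD2l -[leRHS]mulr1 ler_wpM2l// invf_le1//.
exact: lt_le_trans t1.
Unshelve. all: by end_near. Qed.

Lemma ig_arg_cvgNy (c g k : R) : 0 <= c -> 0 < g -> 0 < k ->
  (c * Num.sqrt t - g * (Num.sqrt t)^-1) * k @[t --> 0^'+] --> (-oo : set_system R).
Proof.
move=> c0 g0 k0; apply/cvgrNyPle => A; near=> t.
have t0 : 0 < t by near: t; exact: nbhs_right_gt.
have t1 : t <= 1 by near: t; apply: nbhs_right_le.
have tA : (c - A / k) / g <= (Num.sqrt t)^-1 by near: t; move/cvgryPge : invsqrt_cvgy; exact.
rewrite -ler_pdivlMr// lerBlDr -lerBlDl.
rewrite ler_pdivrMr// [leRHS]mulrC in tA; apply: (le_trans _ tA).
rewrite lerD2r -[leRHS]mulr1; apply: ler_wpM2l => //.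
by rewrite -sqrtr1; exact: ler_wsqrtr.
Unshelve. all: by end_near. Qed.

Lemma integral_ig (g c : R) : 0 < g -> 0 < c ->
  (\int[mu]_(t in `]0%R, +oo[)
     (g * (t * Num.sqrt t)^-1 * expR (- (g ^+ 2 / t + c ^+ 2 * t) / 2))%:E =
   (Num.sqrt (2 * pi) * expR (- (g * c)))%:E)%E.
Proof.
move=> g0 c0.
(* [gauss_fun] is exp(- x^2) and not exp(- x^2 / 2), hence the rescaling of its argument. *)
pose k : R := (Num.sqrt 2)^-1.
have k0 : 0 < k by rewrite invr_gt0 sqrtr_gt0.
have k2 : k ^+ 2 = 2^-1 by rewrite exprVn sqr_sqrtr.
pose p1 t := (c * Num.sqrt t - g * (Num.sqrt t)^-1) * k.
pose p2 t := (- c * Num.sqrt t - g * (Num.sqrt t)^-1) * k.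
(* The classical closed form of the inverse-Gaussian distribution function, up to a constant factor.
   Both Gaussian arguments tend to -oo at 0; at +oo the first tends to +oo and the second to -oo. *)
pose F t := Num.sqrt 2 * (expR (- (g * c)) * gauss_cdf (p1 t) + expR (g * c) * gauss_cdf (p2 t)).
pose f t := g * (t * Num.sqrt t)^-1 * expR (- (g ^+ 2 / t + c ^+ 2 * t) / 2).
suff: (\int[mu]_(t in `]0%R, +oo[) (f t)%:E = (Num.sqrt (2 * pi) * expR (- (g * c)) - 0)%:E)%E.
  by rewrite subr0.
apply: (@ge0_FTC_open R f F 0 0 (Num.sqrt (2 * pi) * expR (- (g * c)))).
- by move=> t t0; rewrite mulr_ge0 ?expR_ge0// mulr_ge0 ?invr_ge0 ?mulr_ge0 ?sqrtr_ge0 ?ltW.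
- move=> t t0.
  have ct : {for t, continuous (@Num.sqrt R)} by exact: sqrt_continuous.
  have st : t * Num.sqrt t != 0 by rewrite mulf_neq0// gt_eqF// sqrtr_gt0.
  apply: cvgM.
    apply: cvgM; first exact: cvg_cst.
    by apply: cvgV => //; apply: cvgM => //; exact: cvg_id.
  apply: continuous_comp; last exact: continuous_expR.
  apply: cvgM; last exact: cvg_cst.
  apply: cvgN; apply: cvgD.
    apply: cvgM; first exact: cvg_cst.
    by apply: cvgV; [rewrite gt_eqF|exact: cvg_id].
  by apply: cvgM; [exact: cvg_cst|exact: cvg_id].
- move=> t t0.
  have s0 : 0 < Num.sqrt t by rewrite sqrtr_gt0.
  have sn0 : Num.sqrt t != 0 by rewrite gt_eqF.
  have ds : is_derive t 1 Num.sqrt (2 * Num.sqrt t)^-1 := is_derive1_sqrt t0.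
  have dsv := is_deriveV sn0 ds.
  pose s := Num.sqrt t.
  have tE : t = s ^+ 2 by rewrite sqr_sqrtr// ltW.
  have dp (b : R) : is_derive t 1 (fun t => (b * Num.sqrt t - g * (Num.sqrt t)^-1) * k)
    ((b / (2 * Num.sqrt t) + g * (2 * t * Num.sqrt t)^-1) * k).
    apply: is_derive_eq; rewrite /GRing.scale/= -/s tE.
    by rewrite -/s in sn0; field.
  have dg (b : R) := @is_derive1_comp R gauss_cdf
    (fun t => (b * Num.sqrt t - g * (Num.sqrt t)^-1) * k) t _ _ (is_derive_gauss_cdf _) (dp b).
  have gE (b : R) : gauss_fun ((b * Num.sqrt t - g * (Num.sqrt t)^-1) * k) =
     expR (g * b) * expR (- (g ^+ 2 / t + b ^+ 2 * t) / 2).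
    rewrite /gauss_fun -expRD; congr expR.
    rewrite exprMn k2 -/s tE.
    by rewrite -/s in sn0; field.
  have d1 := dg c; have d2 := dg (- c).
  rewrite /F.
  apply: is_derive_eq; rewrite /GRing.scale/= !gE sqrrN mulrN.
  set e := expR (- (g ^+ 2 / t + c ^+ 2 * t) / 2).
  have eN : expR (- (g * c)) * expR (g * c) = 1 by rewrite -expRD addNr expR0.
  have h2 : Num.sqrt 2 * k = 1 by rewrite mulfV// gt_eqF// sqrtr_gt0.
  rewrite mulr1; set X := _ + _ / _; set Y := - c / _ + _.
  (* The prefactors e^{-gc} and e^{gc} reduce both Gaussian terms to the same [e]. In [X + Y] the
     derivatives of c sqrt t and - c sqrt t cancel, which leaves g t^{-3/2}. *)
  transitivity ((Num.sqrt 2 * k) * (expR (- (g * c)) * expR (g * c)) * e * (X + Y)).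
    by rewrite /X /Y; ring.
  rewrite h2 eN !mul1r mulrC /f -/e; congr (_ * _).
  by rewrite /X /Y; field; rewrite sn0 gt_eqF.
- rewrite -[X in _ --> X](mulr0 (Num.sqrt 2)); apply: cvgM; first exact: cvg_cst.
  rewrite -[X in _ --> X](addr0 0); apply: cvgD.
    rewrite -[X in _ --> X](mulr0 (expR (- (g * c)))); apply: cvgM; first exact: cvg_cst.
    exact: (cvg_comp _ _ (ig_arg_cvgNy (ltW c0) g0 k0) cvg_gauss_cdfNy).
  rewrite -[X in _ --> X](mulr0 (expR (g * c))); apply: cvgM; first exact: cvg_cst.
  apply: (cvg_comp _ _ _ cvg_gauss_cdfNy).
  apply: ler_cvgNy (ig_arg_cvgNy (lexx 0) g0 k0); near=> t.
  rewrite ler_wpM2r ?(ltW k0)// lerD2r mul0r mulNr oppr_le0.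
  by rewrite mulr_ge0 ?sqrtr_ge0 ?ltW.
- rewrite sqrtrM// -mulrA; apply: cvgM; first exact: cvg_cst.
  rewrite -[X in _ --> X]addr0; apply: cvgD.
    rewrite [X in _ --> X]mulrC; apply: cvgM; first exact: cvg_cst.
    exact: (cvg_comp _ _ (ig_arg_cvgy c0 (ltW g0) k0) cvg_gauss_cdfy).
  rewrite -[X in _ --> X](mulr0 (expR (g * c))); apply: cvgM; first exact: cvg_cst.
  apply: (cvg_comp _ _ _ cvg_gauss_cdfNy).
  apply/cvgNry; apply: ger_cvgy (ig_arg_cvgy c0 (lexx 0) k0); near=> t.
  have -> : (- p2) t = (c * Num.sqrt t + g * (Num.sqrt t)^-1) * k.
    by rewrite -[LHS]/(- p2 t) /p2; ring.
  rewrite ler_wpM2r ?(ltW k0)// mul0r subr0.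
  by rewrite lerDl mulr_ge0 ?invr_ge0 ?sqrtr_ge0 ?ltW.
Unshelve. all: by end_near.
Qed.

(** A Gamma(1/2) integral: the substitution x = sqrt(c t) makes it Gaussian, so the antiderivative
    is an error function. *)
Lemma integral_half_gamma (c : R) : 0 < c ->
  (\int[mu]_(t in `]0%R, +oo[) ((Num.sqrt t)^-1 * expR (- (c * t)))%:E =
   (Num.sqrt pi / Num.sqrt c)%:E)%E.
Proof.
move=> c0.
have sc0 : 0 < Num.sqrt c by rewrite sqrtr_gt0.
pose F t := (Num.sqrt c)^-1 * (gauss_cdf (Num.sqrt c * Num.sqrt t) - gauss_cdf (- Num.sqrt c * Num.sqrt t)).
pose f t := (Num.sqrt t)^-1 * expR (- (c * t)).
suff: (\int[mu]_(t in `]0%R, +oo[) (f t)%:E = (Num.sqrt pi / Num.sqrt c - 0)%:E)%E.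
  by rewrite subr0.
apply: (@ge0_FTC_open R f F 0 0 (Num.sqrt pi / Num.sqrt c)).
- by move=> t t0; rewrite mulr_ge0 ?expR_ge0// invr_ge0 sqrtr_ge0.
- move=> t t0; apply: cvgM.
    apply: cvgV; last exact: sqrt_continuous.
    by rewrite gt_eqF// sqrtr_gt0.
  apply: continuous_comp; last exact: continuous_expR.
  by apply: cvgN; apply: cvgM; [exact: cvg_cst|exact: cvg_id].
- move=> t t0.
  have sn0 : Num.sqrt t != 0 by rewrite gt_eqF// sqrtr_gt0.
  have ds : is_derive t 1 Num.sqrt (2 * Num.sqrt t)^-1 := is_derive1_sqrt t0.
  have dp (b : R) : is_derive t 1 (fun t => b * Num.sqrt t) (b / (2 * Num.sqrt t)).
    exact: is_derive_eq.
  have dg (b : R) := @is_derive1_comp R gauss_cdf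
    (fun t => b * Num.sqrt t) t _ _ (is_derive_gauss_cdf _) (dp b).
  have gE (b : R) : b ^+ 2 = c -> gauss_fun (b * Num.sqrt t) = expR (- (c * t)).
    by move=> bc; rewrite /gauss_fun exprMn bc sqr_sqrtr// ltW.
  have d1 := dg (Num.sqrt c); have d2 := dg (- Num.sqrt c).
  rewrite /F; apply: is_derive_eq.
  rewrite /GRing.scale/= !gE ?sqrrN ?sqr_sqrtr ?ltW//.
  rewrite /f [RHS]mulrC.
  set e := expR _; set sc := Num.sqrt c in sc0 *; set st := Num.sqrt t in sn0 *.
  by field; rewrite sn0 gt_eqF.
- have ct (b : R) : b * Num.sqrt t @[t --> 0^'+] --> b * Num.sqrt 0.
    apply: cvg_at_right_filter; apply: cvgM; first exact: cvg_cst.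
    exact: sqrt_continuous.
  rewrite sqrtr0 in ct.
  have cg (b : R) : gauss_cdf (b * Num.sqrt t) @[t --> 0^'+] --> gauss_cdf 0.
    rewrite -[X in _ --> gauss_cdf X](mulr0 b).
    by apply: continuous_cvg (ct b); exact: continuous_gauss_cdf.
  rewrite -[X in _ --> X](mulr0 (Num.sqrt c)^-1); apply: cvgM; first exact: cvg_cst.
  rewrite -[X in _ --> X](subrr (gauss_cdf 0)).
  by apply: cvgB; exact: cg.
- rewrite [X in _ --> X]mulrC; apply: cvgM; first exact: cvg_cst.
  rewrite -[X in _ --> X]subr0.
  have cy : Num.sqrt c * Num.sqrt t @[t --> +oo] --> (+oo : set_system R).
    exact: gt0_cvgMry sqrt_cvgy.
  apply: cvgB; first exact: (cvg_comp _ _ cy cvg_gauss_cdfy).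
  apply: (cvg_comp _ _ _ cvg_gauss_cdfNy).
  apply/cvgNry; apply: cvg_trans cy; apply: near_eq_cvg; near=> t.
  by rewrite -[RHS]/(- (- Num.sqrt c * Num.sqrt t)) mulNr opprK.
Unshelve. all: by end_near. Qed.
End explicit_integrals.

(** * The Lévy and inverse-Gaussian densities; elementary integrals *)

Section levy_and_ig_densities.
Context {R : realType}.
Let mu := @lebesgue_measure R.

Lemma measurable_invr : measurable_fun [set: R] (fun x => x^-1).
Proof.
rewrite -(setvU [set 0]); apply/measurable_funU => //; first exact: measurableC.
split; last exact: measurable_fun_set1.
apply: open_continuous_measurable_fun.
  by apply: closed_openC; exact: closed_eq.
move=> x; rewrite inE/= => /eqP x0; exact: inv_continuous.
Qed.

Lemma powRN32 (t : R) : 0 < t -> t `^ (- (3 / 2)) = (t * Num.sqrt t)^-1.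
Proof.
move=> t0; rewrite powRN; congr (_^-1).
rewrite (_ : 3 / 2 = 1 + 2^-1); last by field.
rewrite powRD; last by rewrite (gt_eqF t0) implybT.
by rewrite powRr1 ?powR12_sqrt ?ltW.
Qed.

Definition levy_pdf (a t : R) : R :=
  a / Num.sqrt (2 * pi) * (expR (- t / 2) * t `^ (- (3 / 2))).

Lemma levy_pdf_ge0 a t : 0 <= a -> 0 <= levy_pdf a t.
Proof. by move=> a0; rewrite !mulr_ge0 ?invr_ge0 ?sqrtr_ge0 ?expR_ge0 ?powR_ge0. Qed.

Lemma ig_pdf_ge0 (g t : R) : 0 <= g -> 0 <= ig_pdf g t.
Proof. by move=> a0; rewrite !mulr_ge0 ?invr_ge0 ?sqrtr_ge0 ?expR_ge0 ?powR_ge0. Qed.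

Lemma measurable_levy_pdf a : measurable_fun setT (levy_pdf a).
Proof.
apply: measurable_funM => //; apply: measurable_funM; last exact: measurable_powR.
by apply: measurableT_comp => //; apply: measurable_funM.
Qed.

Lemma measurable_ig_pdf (g : R) : measurable_fun setT (ig_pdf g).
Proof.
apply: measurable_funM.
  by apply: measurable_funM => //; exact: measurable_powR.
apply: measurableT_comp => //; apply: measurable_funD => //.
apply: measurable_funM => //; apply: measurableT_comp => //.
by apply: measurable_funD => //; apply: measurable_funM => //; exact: measurable_invr.
Qed.

(** Exponential tilting: the factor e^{-lt} replaces t by (1 + 2l) t in the exponent, so this is
    [integral_ig] with [c] equal to sqrt(1 + 2l). *)
Lemma ig_laplace (g l : R) : 0 < g -> 0 <= l ->
  (\int[mu]_(t in `]0%R, +oo[) (ig_pdf g t * expR (- (l * t)))%:E =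
   (expR (- (g * (Num.sqrt (1 + 2 * l) - 1))))%:E)%E.
Proof.
move=> g0 l0; pose c := Num.sqrt (1 + 2 * l).
have l1 : 0 < 1 + 2 * l by rewrite ltr_wpDr ?mulr_ge0.
have c0 : 0 < c by rewrite sqrtr_gt0.
have c2 : c ^+ 2 = 1 + 2 * l by rewrite sqr_sqrtr// ltW.
have s0 : 0 < Num.sqrt (2 * pi) :> R by rewrite sqrtr_gt0 mulr_gt0// pi_gt0.
transitivity (\int[mu]_(t in `]0%R, +oo[) ((expR g / Num.sqrt (2 * pi))%:E *
     (g * (t * Num.sqrt t)^-1 * expR (- (g ^+ 2 / t + c ^+ 2 * t) / 2))%:E))%E.
  apply: eq_integral => t; rewrite inE/= in_itv/= andbT => t0.
  rewrite -EFinM; congr EFin; rewrite /ig_pdf powRN32// c2.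
  have -> : expR (- (g ^+ 2 / t + (1 + 2 * l) * t) / 2) =
     expR (- (g ^+ 2 / t + t) / 2) * expR (- (l * t)).
    by rewrite -expRD; congr expR; field; rewrite gt_eqF.
  by rewrite expRD; field; rewrite !gt_eqF// sqrtr_gt0.
rewrite ge0_integralZl//.
- rewrite integral_ig// -EFinM; congr EFin.
  rewrite mulrBr mulr1 opprB addrC expRD -/c.
  by field; rewrite gt_eqF.
- apply/measurable_EFinP; apply: measurable_funTS.
  have ms : measurable_fun setT (@Num.sqrt R).
    exact: continuous_measurable_fun (@sqrt_continuous R).
  apply: measurable_funM.
    apply: measurable_funM => //.
    by apply: (measurableT_comp measurable_invr); exact: measurable_funM.
  apply: measurableT_comp => //; apply: measurable_funM => //; apply: measurableT_comp => //.
  apply: measurable_funD => //; apply: measurable_funM => //; exact: measurable_invr.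
- move=> t; rewrite /= in_itv/= andbT => t0; rewrite lee_fin.
  by rewrite mulr_ge0 ?expR_ge0// mulr_ge0 ?invr_ge0 ?mulr_ge0 ?sqrtr_ge0 ?ltW.
Qed.

Lemma ig_pdf_int1 (g : R) : 0 < g -> (\int[mu]_(t in `]0%R, +oo[) (ig_pdf g t)%:E = 1)%E.
Proof.
move=> g0; have := ig_laplace g0 (lexx 0).
under eq_integral do rewrite mul0r oppr0 expR0 mulr1.
by rewrite mulr0 addr0 sqrtr1 subrr mulr0 oppr0 expR0.
Qed.

Lemma integral_expR_0c (l y : R) : 0 <= l -> 0 < y ->
  (\int[mu]_(x in `]0%R, y[) (l * expR (- (l * x)))%:E = (1 - expR (- (l * y)))%:E)%E.
Proof.
move=> l0 y0.
have cf : continuous (fun x : R => l * expR (- (l * x))).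
  move=> x; apply: cvgM; first exact: cvg_cst.
  apply: continuous_comp; last exact: continuous_expR.
  by apply: cvgN; apply: cvgM; [exact: cvg_cst|exact: cvg_id].
have dF (x : R) : is_derive x 1 (fun x => - expR (- (l * x))) (l * expR (- (l * x))).
  have d1 : is_derive x 1 (fun x : R => - (l * x)) (- l).
    by apply: is_derive_eq; rewrite /GRing.scale/=; ring.
  have d2 := @is_derive1_comp R expR (fun x => - (l * x)) x _ _ (is_derive_expR _) d1.
  by apply: is_derive_eq; rewrite /GRing.scale/=; ring.
have cF : continuous (fun x : R => - expR (- (l * x))).
  move=> x; have [d _] := dF x.
  by move/derivable1_diffP/differentiable_continuous : d.
rewrite -(@integral_itv_bndoo _ _ _ _ true false); last first.
  by apply/measurable_EFinP/measurable_funTS; exact: continuous_measurable_fun.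
rewrite (@continuous_FTC2 _ _ (fun x => - expR (- (l * x))))//.
- by rewrite mulr0 oppr0 expR0 -EFinB; congr EFin; ring.
- exact: continuous_subspaceT.
- split.
  + by move=> x _; have [] := dF x.
  + by apply: cvg_at_right_filter; exact: cF.
  + by apply: cvg_at_left_filter; exact: cF.
- by move=> x _; have ? := dF x; rewrite derive1E derive_val.
Qed.

Lemma integral_inv_sqrt (l : R) : 0 < l ->
  (\int[mu]_(x in `]0%R, l[) ((Num.sqrt (1 + 2 * x))^-1)%:E = (Num.sqrt (1 + 2 * l) - 1)%:E)%E.
Proof.
move=> l0.
(* Working on ]-1/2, +oo[ keeps the end point 0 in the interior of the domain of
   differentiability. *)
have p1 (x : R) : - 2^-1 < x -> 0 < 1 + 2 * x by move=> ?; lra.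
have dF (x : R) : - 2^-1 < x ->
    is_derive x 1 (fun x => Num.sqrt (1 + 2 * x)) (Num.sqrt (1 + 2 * x))^-1.
  move=> x0; have d1 : is_derive x 1 (fun x : R => 1 + 2 * x) 2.
    by apply: is_derive_eq; rewrite /GRing.scale/=; ring.
  have d2 := @is_derive1_comp R Num.sqrt (fun x => 1 + 2 * x) x _ _ (is_derive1_sqrt (p1 x x0)) d1.
  apply: (is_derive_eq d2); field; by rewrite gt_eqF// sqrtr_gt0 p1.
have cf (x : R) : - 2^-1 < x -> {for x, continuous (fun x : R => (Num.sqrt (1 + 2 * x))^-1)}.
  move=> x0; apply: cvgV; first by rewrite gt_eqF// sqrtr_gt0 p1.
  by have [d _] := dF x x0; move/derivable1_diffP/differentiable_continuous : d.
have cs (x : R) : - 2^-1 < x -> {for x, continuous (fun x : R => Num.sqrt (1 + 2 * x))}.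
  by move=> x0; have [d _] := dF x x0; move/derivable1_diffP/differentiable_continuous : d.
rewrite -(@integral_itv_bndoo _ _ _ _ true false); last first.
  apply/measurable_EFinP; apply: open_continuous_measurable_fun => // x.
  by rewrite inE/= in_itv/= => /andP[x0 _]; apply: cf; lra.
rewrite (@continuous_FTC2 _ _ (fun x => Num.sqrt (1 + 2 * x)))//.
- by rewrite mulr0 addr0 sqrtr1.
- apply: continuous_in_subspaceT => x; rewrite inE/= in_itv/= => /andP[x0 _].
  by apply: cf; lra.
- split.
  + by move=> x; rewrite in_itv/= => /andP[x0 _]; have [] // := dF x; lra.
  + by apply: cvg_at_right_filter; apply: cs; lra.
  + by apply: cvg_at_left_filter; apply: cs; lra.
- move=> x; rewrite in_itv/= => /andP[x0 _].
  have ? := dF x ltac:(lra).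
  by rewrite derive1E derive_val.
Qed.

End levy_and_ig_densities.

Lemma pinv_out (T U : Type) (dflt : U -> T) (A : set T) (f : T -> U) y :
  ~ (f @` A) y -> 'pinv_dflt A f y = dflt y.
Proof. by move=> fAy; rewrite /pinv_ splitV oinv_surj; case: pselect. Qed.

(** * Tails of positive continuous densities and their inverses, for L and G_n alike *)

Section tail_integrals.
Context {R : realType}.
Let mu := @lebesgue_measure R.
Variables (f T : R -> R).
Hypothesis f_gt0 : forall x : R, 0 < x -> 0 < f x.
Hypothesis mf : measurable_fun setT f.
Hypothesis cf : forall x : R, 0 < x -> {for x, continuous f}.
Hypothesis TE : forall x : R, 0 < x -> (\int[mu]_(t in `]x, +oo[) (f t)%:E = (T x)%:E)%E.

Let within_cf (x y : R) : 0 < x -> {within `[x, y], continuous f}.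
Proof.
move=> x0; apply: continuous_in_subspaceT => z; rewrite inE/= in_itv/= => /andP[xz _].
by apply: cf; exact: lt_le_trans xz.
Qed.

Lemma tail_split x y : 0 < x -> x < y ->
  (T x)%:E = (\int[mu]_(t in `]x, y]) (f t)%:E + (T y)%:E)%E.
Proof.
move=> x0 xy; have y0 := lt_trans x0 xy.
rewrite -TE// -TE// -ge0_integral_setU//=.
- by congr (\int[mu]_(t in _) _)%E; rewrite -itv_bndbnd_setU// bnd_simp ltW.
- by apply/measurable_EFinP; exact: measurable_funTS.
- move=> t [|]; rewrite in_itv/= ?andbT.
    by move=> /andP[xt _]; rewrite lee_fin ltW// f_gt0// (lt_trans x0).
  by move=> yt; rewrite lee_fin ltW// f_gt0// (lt_trans y0).
- apply/disj_setPS => t /=; rewrite !in_itv/= andbT => -[/andP[_ ty] yt].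
  by move: (lt_le_trans yt ty); rewrite ltxx.
Qed.

Lemma tail_diff_le x y M : 0 < x -> x < y ->
  (forall t, x < t -> t <= y -> f t <= M) -> T x - T y <= M * (y - x).
Proof.
move=> x0 xy fM; rewrite lerBlDr -lee_fin (tail_split x0 xy) EFinD leeD2r//.
have := @ge0_le_integral _ (measurableTypeR R) R mu `]x, y]%classic (measurable_itv _)
  (EFin \o f) (cst M%:E).
rewrite integral_cst//= /mu lebesgue_measure_itv/= lte_fin xy -EFinD -EFinM.
apply.
- move=> t; rewrite /= in_itv/= => /andP[xt _]; rewrite lee_fin ltW// f_gt0//.
  exact: lt_trans xt.
- by apply/measurable_EFinP; exact: measurable_funTS.
- by [].
- by move=> t; rewrite /= in_itv/= => /andP[xt ty]; rewrite lee_fin fM.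
Qed.

Lemma tail_diff_ge x y m : 0 < x -> x < y -> 0 <= m ->
  (forall t, x < t -> t <= y -> m <= f t) -> m * (y - x) <= T x - T y.
Proof.
move=> x0 xy m0 fM; rewrite lerBrDr -lee_fin (tail_split x0 xy) EFinD leeD2r//.
have := @ge0_le_integral _ (measurableTypeR R) R mu `]x, y]%classic (measurable_itv _)
  (cst m%:E) (EFin \o f).
rewrite integral_cst//= /mu lebesgue_measure_itv/= lte_fin xy -EFinD -EFinM.
apply.
- by move=> t _; rewrite lee_fin.
- by [].
- by apply/measurable_EFinP; exact: measurable_funTS.
- by move=> t; rewrite /= in_itv/= => /andP[xt ty]; rewrite lee_fin fM.
Qed.

Lemma tail_lt x y : 0 < x -> x < y -> T y < T x.
Proof.
move=> x0 xy; have [c + cP] := EVT_min (ltW xy) (within_cf (y := y) x0).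
rewrite in_itv/= => /andP[xc _].
have fc : 0 < f c by apply: f_gt0; exact: lt_le_trans xc.
rewrite -subr_gt0; apply: lt_le_trans (tail_diff_ge x0 xy (ltW fc) _).
  by rewrite mulr_gt0// subr_gt0.
by move=> t xt ty; apply: cP; rewrite in_itv/= (ltW xt).
Qed.

Lemma tail_ge0 x : 0 < x -> 0 <= T x.
Proof.
move=> x0; rewrite -lee_fin -TE//; apply: integral_ge0 => t /=.
by rewrite in_itv/= andbT => xt; rewrite lee_fin ltW// f_gt0// (lt_trans x0).
Qed.

Lemma tail_gt0 x : 0 < x -> 0 < T x.
Proof.
move=> x0; apply: le_lt_trans (tail_lt x0 (_ : x < x + 1)); last by rewrite ltrDl.
by apply: tail_ge0; rewrite addr_gt0.
Qed.

Lemma tail_inj : {in `]0, +oo[ &, injective T}.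
Proof.
move=> x y; rewrite !in_itv/= !andbT => x0 y0 Txy.
case: (ltgtP x y) => // h.
  by have := tail_lt x0 h; rewrite Txy ltxx.
by have := tail_lt y0 h; rewrite Txy ltxx.
Qed.

(** Near x the tail is Lipschitz, with constant the maximum of [f] on [x/2, 2x]; this interval stays
    away from 0, where [f] may be unbounded. *)
Lemma tail_continuous x : 0 < x -> {for x, continuous T}.
Proof.
move=> x0; pose x1 := x / 2; pose x2 := x * 2.
have x10 : 0 < x1 by rewrite divr_gt0.
have x1x : x1 < x by rewrite /x1; lra.
have xx2 : x < x2 by rewrite /x2; lra.
have [c + cP] := EVT_max (ltW (lt_trans x1x xx2)) (within_cf (y := x2) x10).
rewrite in_itv/= => /andP[xc _].
have fc : 0 < f c by apply: f_gt0; exact: lt_le_trans xc.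
have B u v : x1 < u -> u <= v -> v < x2 -> `|T u - T v| <= f c * (v - u).
  move=> xu; rewrite le_eqVlt => /predU1P[->|uv vx]; first by rewrite !subrr normr0 mulr0.
  have u0 := lt_trans x10 xu.
  rewrite ger0_norm ?subr_ge0 ?(ltW (tail_lt u0 uv))//; apply: tail_diff_le => // t ut tv.
  by apply: cP; rewrite in_itv/= (ltW (lt_trans xu ut)) (le_trans tv)// ltW.
have B' u : x1 < u -> u < x2 -> `|T x - T u| <= f c * `|x - u|.
  move=> xu ux; have [h|h] := leP x u.
    have -> : `|x - u| = u - x by rewrite distrC ger0_norm// subr_ge0.
    exact: B.
  have -> : `|x - u| = x - u by rewrite gtr0_norm// subr_gt0.
  by rewrite distrC; apply: B => //; exact: ltW.
apply/cvgrPdist_le => e e0; near=> u.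
apply: (le_trans (B' u _ _)).
- by near: u; exact: lt_nbhsr.
- by near: u; exact: lt_nbhsl.
rewrite mulrC -ler_pdivlMr//.
near: u; apply: (@cvgr_dist_le _ _ _ _ _ id x) => //.
by rewrite divr_gt0.
Unshelve. all: by end_near. Qed.

Lemma tail_ivt x1 x2 y : 0 < x1 -> x1 <= x2 -> T x2 <= y -> y <= T x1 ->
  exists2 x, x1 <= x <= x2 & T x = y.
Proof.
move=> x10 x12 T2 T1.
have [|| c] := @IVT _ T x1 x2 y x12.
- apply: continuous_in_subspaceT => z; rewrite inE/= in_itv/= => /andP[xz _].
  by apply: tail_continuous; exact: lt_le_trans xz.
- by rewrite ge_min le_max T2 T1 orbT.
by rewrite in_itv/=; exists c.
Qed.

Let Tinv := 'pinv_(fun=> 0) `]0, +oo[ T.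

Lemma tail_invK x : 0 < x -> Tinv (T x) = x.
Proof.
by move=> x0; rewrite /Tinv pinvKV//; [move=> ? ?; rewrite !inE/=; exact: tail_inj|rewrite inE/= in_itv/= x0].
Qed.

(** Outside the range of [T] the pseudo-inverse is 0, which no point of []0, +oo[] equals. The
    dichotomy allows upper bounds on the inverse without knowing its range. *)
Lemma tail_invP y : Tinv y = 0 \/ (0 < Tinv y /\ T (Tinv y) = y).
Proof.
have [[x /=]|h] := pselect ((T @` `]0, +oo[) y); last by left; rewrite /Tinv pinv_out.
by rewrite in_itv/= andbT => x0 <-; right; rewrite tail_invK.
Qed.

Lemma tail_inv_le0 y : y <= 0 -> Tinv y = 0.
Proof.
by move=> y0; have [//|[h e]] := tail_invP y; move: y0; rewrite -e leNgt tail_gt0.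
Qed.

End tail_integrals.

(** * The function L and its inverse J *)

Section levy_tail_theory.
Context {R : realType}.
Let mu := @lebesgue_measure R.

Lemma continuous_powR_gt0 (p x : R) : 0 < x -> {for x, continuous (fun t : R => t `^ p)}.
Proof.
move=> x0; have [d _] := is_derive1_powR p x0.
by move/derivable1_diffP/differentiable_continuous : d.
Qed.

Lemma integral_pow32_tail (x : R) : 0 < x ->
  (\int[mu]_(t in `]x, +oo[) (t `^ (- (3 / 2)))%:E = (2 / Num.sqrt x)%:E)%E.
Proof.
move=> x0.
pose F (t : R) := - (2 / Num.sqrt t).
pose f (t : R) := t `^ (- (3 / 2)).
suff: (\int[mu]_(t in `]x, +oo[) (f t)%:E = (0 - F x)%:E)%E by rewrite sub0r opprK.
have dF t : x < t -> is_derive t 1 F (f t).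
  move=> xt; have t0 := lt_trans x0 xt.
  have sn0 : Num.sqrt t != 0 by rewrite gt_eqF// sqrtr_gt0.
  have ds : is_derive t 1 Num.sqrt (2 * Num.sqrt t)^-1 := is_derive1_sqrt t0.
  have dsv := is_deriveV sn0 ds.
  rewrite /F; apply: is_derive_eq; rewrite /GRing.scale/= /f powRN32//.
  rewrite -[in RHS](sqr_sqrtr (ltW t0)) sqrtr_sqr ger0_norm ?sqrtr_ge0//.
  by set s := Num.sqrt t in sn0 *; field.
apply: (@ge0_FTC_open R f F x (F x) 0) => //.
- by move=> t _; exact: powR_ge0.
- by move=> t xt; apply: continuous_powR_gt0; exact: lt_trans xt.
- apply: cvg_at_right_filter; apply: cvgN; apply: cvgM; first exact: cvg_cst.
  by apply: cvgV; [rewrite gt_eqF// sqrtr_gt0|exact: sqrt_continuous].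
- rewrite -oppr0 -[X in _ --> - X](mulr0 2); apply: cvgN; apply: cvgM; first exact: cvg_cst.
  apply/gtr0_cvgV0; last exact: sqrt_cvgy.
  by near=> t; rewrite sqrtr_gt0; near: t; exact: nbhs_pinfty_gt.
Unshelve. all: by end_near. Qed.

Variable a : R.
Hypothesis a_gt0 : 0 < a.
Local Notation k := (a / Num.sqrt (2 * pi)).
Local Notation K := (2 * k).

Let k_gt0 : 0 < k :> R.
Proof. by rewrite divr_gt0// sqrtr_gt0 mulr_gt0// pi_gt0. Qed.

Lemma levy_pdf_gt0 t : 0 < t -> 0 < levy_pdf a t.
Proof. by move=> t0; rewrite mulr_gt0// mulr_gt0 ?expR_gt0 ?powR_gt0. Qed.

Lemma continuous_levy_pdf t : 0 < t -> {for t, continuous (levy_pdf a)}.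
Proof.
move=> t0; apply: cvgM; first exact: cvg_cst.
apply: cvgM; last exact: continuous_powR_gt0.
apply: continuous_comp; last exact: continuous_expR.
by apply: cvgM; [apply: cvgN; exact: cvg_id|exact: cvg_cst].
Qed.

Let int_levy_le x : 0 < x ->
  (\int[mu]_(t in `]x, +oo[) (expR (- t / 2) * t `^ (- (3 / 2)))%:E <= (2 / Num.sqrt x)%:E)%E.
Proof.
move=> x0; rewrite -integral_pow32_tail//; apply: ge0_le_integral => //.
- by move=> t _; rewrite lee_fin mulr_ge0 ?expR_ge0 ?powR_ge0.
- apply/measurable_EFinP; apply: measurable_funTS; apply: measurable_funM; last exact: measurable_powR.
  by apply: measurableT_comp => //; apply: measurable_funM.
- by apply/measurable_EFinP; apply: measurable_funTS; exact: measurable_powR.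
- move=> t; rewrite /= in_itv/= andbT => xt.
  rewrite lee_fin ler_piMl ?powR_ge0// -expR0 ler_expR.
  by rewrite mulNr oppr_le0 divr_ge0// ltW// (lt_trans x0).
Qed.

Lemma levy_tailE x : 0 < x ->
  (\int[mu]_(t in `]x, +oo[) (levy_pdf a t)%:E = (levy_tail a x)%:E)%E.
Proof.
move=> x0; rewrite /levy_tail /Rintegral EFinM fineK; last first.
  rewrite ge0_fin_numE; first exact: le_lt_trans (int_levy_le x0) (ltry _).
  by apply: integral_ge0 => t _; rewrite lee_fin mulr_ge0 ?expR_ge0 ?powR_ge0.
rewrite -ge0_integralZl//.
- apply/measurable_EFinP; apply: measurable_funTS; apply: measurable_funM; last exact: measurable_powR.
  by apply: measurableT_comp => //; apply: measurable_funM.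
- by move=> t _; rewrite lee_fin mulr_ge0 ?expR_ge0 ?powR_ge0.
- by rewrite lee_fin ltW.
Qed.

(** Dropping e^{-t/2} leaves a power integral. Inverted, this bound is the decay O(1/y^2) of J on
    which every summability argument rests. *)
Lemma levy_tail_le x : 0 < x -> levy_tail a x <= K / Num.sqrt x.
Proof.
move=> x0; rewrite [leRHS](_ : _ = k * (2 / Num.sqrt x)); last by ring.
rewrite /levy_tail /Rintegral ler_wpM2l ?(ltW k_gt0)//.
rewrite -lee_fin fineK ?int_levy_le//.
rewrite ge0_fin_numE; first exact: le_lt_trans (int_levy_le x0) (ltry _).
by apply: integral_ge0 => t _; rewrite lee_fin mulr_ge0 ?expR_ge0 ?powR_ge0.
Qed.

Definition levy_tail_lt := @tail_lt R (levy_pdf a) (levy_tail a)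
  levy_pdf_gt0 (measurable_levy_pdf a) continuous_levy_pdf levy_tailE.
Definition levy_tail_gt0 := @tail_gt0 R (levy_pdf a) (levy_tail a)
  levy_pdf_gt0 (measurable_levy_pdf a) continuous_levy_pdf levy_tailE.

Lemma levy_tail_unbounded M : exists2 x, 0 < x & M < levy_tail a x.
Proof.
near (0 : R)^'+ => x.
have x0 : 0 < x by near: x; exact: nbhs_right_gt.
have x1 : x <= 1 by near: x; apply: nbhs_right_le.
have s0 : 0 < Num.sqrt x by rewrite sqrtr_gt0.
(* The tail at x is at least the integral over ]x, 2x], hence at least x times the density at 2x.
   For x <= 1 one has e^{-x} >= e^{-1}, and this product is at least the present constant divided by
   sqrt x. *)
have C0 : 0 < k * expR (- 1) / (2 * Num.sqrt 2).
  by apply: divr_gt0; apply: mulr_gt0; rewrite ?k_gt0 ?expR_gt0 ?sqrtr_gt0.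
have sx : (`|M| + 1) / (k * expR (- 1) / (2 * Num.sqrt 2)) <= (Num.sqrt x)^-1.
  by near: x; move/cvgryPge : (@invsqrt_cvgy R); exact.
exists x => //; rewrite ler_pdivrMr// in sx.
apply: (@lt_le_trans _ _ (`|M| + 1)); first by rewrite (le_lt_trans (ler_norm M))// ltrDl.
apply: le_trans sx _.
have xx : x < 2 * x by lra.
have m0 : 0 <= levy_pdf a (2 * x) by rewrite ltW// levy_pdf_gt0// mulr_gt0.
have dec t : x < t -> t <= 2 * x -> levy_pdf a (2 * x) <= levy_pdf a t.
  move=> xt t2; have t0 := lt_trans x0 xt.
  rewrite ler_wpM2l ?(ltW k_gt0)// ler_pM ?expR_ge0 ?powR_ge0//.
    by rewrite ler_expR; lra.
  rewrite !powRN lef_pV2 ?posrE ?powR_gt0 ?mulr_gt0//.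
  by apply: ge0_ler_powR => //; rewrite nnegrE; apply: ltW => //; exact: lt_trans xx.
have := @tail_diff_ge R _ _ levy_pdf_gt0 (measurable_levy_pdf a) levy_tailE _ _ _ x0 xx m0 dec.
have L2 := levy_tail_gt0 (lt_trans x0 xx).
move=> h; apply: le_trans (_ : levy_tail a x - levy_tail a (2 * x) <= _); last first.
  by rewrite gerBl ltW.
apply: le_trans h.
rewrite (_ : 2 * x - x = x); last by ring.
have s2x : Num.sqrt (2 * x) = Num.sqrt 2 * Num.sqrt x by rewrite sqrtrM.
rewrite /levy_pdf powRN32 ?mulr_gt0// s2x.
have -> : (Num.sqrt x)^-1 * (k * expR (-1) / (2 * Num.sqrt 2)) =
   k * (expR (- 1) * (2 * x * (Num.sqrt 2 * Num.sqrt x))^-1) * x.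
  have r2 : Num.sqrt 2 != 0 :> R by rewrite gt_eqF// sqrtr_gt0.
  have rp : Num.sqrt (2 * pi) != 0 :> R by rewrite gt_eqF// sqrtr_gt0 mulr_gt0// pi_gt0.
  by field; rewrite rp r2 !gt_eqF.
rewrite ler_wpM2r ?(ltW x0)// ler_wpM2l ?(ltW k_gt0)// ler_wpM2r ?invr_ge0 ?mulr_ge0 ?sqrtr_ge0 ?(ltW x0)//.
by rewrite ler_expR; lra.
Unshelve. all: by end_near. Qed.

Local Notation J := (levy_tail_inv a).

Lemma levy_tail_invK y : 0 < y -> 0 < J y /\ levy_tail a (J y) = y.
Proof.
move=> y0; have [x1 x10 yx1] := levy_tail_unbounded y.
(* By [levy_tail_le] the value of L at (K/y)^2 is at most y; the maximum keeps [x2] to the right of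
   [x1]. *)
pose x2 := Num.max x1 ((K / y) ^+ 2).
have x20 : 0 < x2 by rewrite lt_max x10.
have T2 : levy_tail a x2 <= y.
  apply: le_trans (levy_tail_le x20) _.
  rewrite ler_pdivrMr ?sqrtr_gt0// -ler_pdivrMl// [leLHS]mulrC.
  apply: le_trans (_ : Num.sqrt ((K / y) ^+ 2) <= _).
    by rewrite sqrtr_sqr ler_norm.
  by apply: ler_wsqrtr; rewrite le_max lexx orbT.
have [|x /andP[x1x _] <-] := @tail_ivt R _ _ levy_pdf_gt0 (measurable_levy_pdf a)
  continuous_levy_pdf levy_tailE x1 x2 y x10 _ T2 (ltW yx1).
  by rewrite le_max lexx.
have x0 := lt_le_trans x10 x1x.
by rewrite /levy_tail_inv (@tail_invK R (levy_pdf a) (levy_tail a) levy_pdf_gt0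
  (measurable_levy_pdf a) continuous_levy_pdf levy_tailE x x0).
Qed.

Lemma levy_inv_gt0 y : 0 < y -> 0 < J y.
Proof. by move=> /levy_tail_invK[]. Qed.

Lemma levy_inv_le0 y : y <= 0 -> J y = 0.
Proof.
exact: (@tail_inv_le0 R (levy_pdf a) (levy_tail a) levy_pdf_gt0
  (measurable_levy_pdf a) continuous_levy_pdf levy_tailE).
Qed.

Lemma levy_inv_ge0 y : 0 <= J y.
Proof. by have [/levy_inv_le0->//|/levy_inv_gt0/ltW] := leP y 0. Qed.

(** The form in which the inverse enters Tonelli's theorem: the regions under J and under L are
    reflections of each other. *)
Lemma lt_levy_inv x y : 0 < x -> 0 < y -> (x < J y) = (y < levy_tail a x).
Proof.
move=> x0 y0; have [J0 JE] := levy_tail_invK y0.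
rewrite -[in RHS]JE; apply/idP/idP => [|h]; first exact: levy_tail_lt.
rewrite ltNge; apply/negP => Jx; move: h; rewrite ltNge.
by move: Jx; rewrite le_eqVlt => /predU1P[->|/(levy_tail_lt J0)/ltW ->//]; rewrite lexx.
Qed.

Lemma levy_inv_lt x y : 0 < x -> 0 < y -> (J y < x) = (levy_tail a x < y).
Proof.
move=> x0 y0; have [J0 JE] := levy_tail_invK y0.
rewrite -[in RHS]JE; apply/idP/idP => [|h]; first exact: levy_tail_lt.
rewrite ltNge; apply/negP => Jx; move: h; rewrite ltNge.
by move: Jx; rewrite le_eqVlt => /predU1P[->|/(levy_tail_lt x0)/ltW ->//]; rewrite lexx.
Qed.

Lemma levy_inv_le y : 0 < y -> J y <= (K / y) ^+ 2.
Proof.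
move=> y0; have [J0 JE] := levy_tail_invK y0.
rewrite -[leLHS](sqr_sqrtr (ltW J0)) lerXn2r ?nnegrE ?sqrtr_ge0//.
  by rewrite divr_ge0 ?mulr_ge0 ?(ltW k_gt0)// ltW.
rewrite ler_pdivlMr// mulrC -ler_pdivlMr ?sqrtr_gt0// -[leLHS]JE.
exact: levy_tail_le.
Qed.

Lemma continuous_levy_inv y : 0 < y -> {for y, continuous J}.
Proof.
move=> y0; have [J0 JE] := levy_tail_invK y0.
apply/cvgrPdist_lt => e e0.
(* The maximum with half of [J y] keeps the left bound positive, where L is controlled. *)
pose x1 := Num.max (J y - e) (J y / 2).
have x1J : x1 < J y by rewrite gt_max; apply/andP; split; lra.
have x10 : 0 < x1 by rewrite lt_max; apply/orP; right; lra.
have yx1 : y < levy_tail a x1 by rewrite -[ltLHS]JE; exact: levy_tail_lt.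
have Je : levy_tail a (J y + e) < y.
  by rewrite -[ltRHS]JE; apply: levy_tail_lt => //; rewrite ltrDl.
near=> z.
have z0 : 0 < z by near: z; exact: lt_nbhsr.
have h1 : x1 < J z by rewrite lt_levy_inv//; near: z; exact: lt_nbhsl.
have h2 : J z < J y + e.
  by rewrite levy_inv_lt ?addr_gt0//; near: z; exact: lt_nbhsr.
rewrite ltr_distlC h2 andbT; apply: le_lt_trans h1.
by rewrite le_max lexx.
Unshelve. all: by end_near. Qed.

Lemma measurable_levy_inv : measurable_fun setT J.
Proof.
rewrite (_ : J = J \_ `]0, +oo[).
  apply/(measurable_restrictT _ (measurable_itv _)).
  apply: open_continuous_measurable_fun => // x.
  by rewrite inE/= in_itv/= andbT => x0; exact: continuous_levy_inv.
apply/funext => x; rewrite patchE; case: ifPn => //.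
rewrite notin_setE/= in_itv/= andbT => /negP; rewrite -leNgt; exact: levy_inv_le0.
Qed.

End levy_tail_theory.

(** * Inverse-Gaussian tails: comparison with L, and convergence of the inverses *)

Section ig_tail_theory.
Context {R : realType}.
Let mu := @lebesgue_measure R.

Lemma ig_pdf_gt0 (g t : R) : 0 < g -> 0 < t -> 0 < ig_pdf g t.
Proof.
move=> g0 t0; rewrite /ig_pdf mulr_gt0 ?expR_gt0// mulr_gt0 ?powR_gt0//.
by rewrite divr_gt0// sqrtr_gt0 mulr_gt0// pi_gt0.
Qed.

Lemma continuous_ig_pdf (g t : R) : 0 < t -> {for t, continuous (ig_pdf g)}.
Proof.
move=> t0; apply: cvgM.
  by apply: cvgM; [exact: cvg_cst|exact: continuous_powR_gt0].
apply: continuous_comp; last exact: continuous_expR.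
apply: cvgD; last exact: cvg_cst.
apply: cvgM; last exact: cvg_cst; apply: cvgN.
apply: cvgD; last exact: cvg_id.
apply: cvgM; first exact: cvg_cst.
by apply: cvgV; [rewrite gt_eqF|exact: cvg_id].
Qed.

Variables (a : R) (a_gt0 : 0 < a).

Let an_gt0 n : 0 < a / n.+1%:R. Proof. by rewrite divr_gt0. Qed.

Lemma ig_tailE n x : 0 < x ->
  (\int[mu]_(t in `]x, +oo[) (ig_pdf (a / n.+1%:R) t)%:E = (ig_tail a n.+1 x)%:E)%E.
Proof.
move=> x0; rewrite /ig_tail /Rintegral fineK// ge0_fin_numE; last first.
  by apply: integral_ge0 => t _; rewrite lee_fin ig_pdf_ge0// ltW.
apply: (@le_lt_trans _ _ 1%E); last exact: ltry.
rewrite -(ig_pdf_int1 (an_gt0 n)); apply: ge0_subset_integral => //.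
- by apply/measurable_EFinP; apply: measurable_funTS; exact: measurable_ig_pdf.
- by move=> t _; rewrite lee_fin ig_pdf_ge0// ltW.
- by move=> t /=; rewrite !in_itv/= !andbT; exact: lt_trans.
Qed.

(** The ratio of the densities of n G_n and L is explicit, e^{a/n} e^{-a^2/(2 n^2 t)} with [n.+1]
    for n; both comparisons of the tails come from bounding it. *)
Lemma ig_levy_pdf n t : 0 < t ->
  n.+1%:R * ig_pdf (a / n.+1%:R) t =
  expR (a / n.+1%:R) * expR (- ((a / n.+1%:R) ^+ 2 / t / 2)) * levy_pdf a t.
Proof.
move=> t0; rewrite /ig_pdf /levy_pdf.
set b := a / n.+1%:R.
rewrite (_ : expR (- (b ^+ 2 / t + t) / 2 + b) =
  expR b * expR (- (b ^+ 2 / t / 2)) * expR (- t / 2)); last first.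
  rewrite -!expRD; congr expR; by field; rewrite gt_eqF.
rewrite (_ : a = n.+1%:R * b); last by rewrite /b; field; rewrite gt_eqF.
by ring.
Qed.

Let Zl (c : R) (f : R -> R) (x : R) : 0 <= c -> measurable_fun setT f -> (forall t, 0 <= f t) ->
  (c%:E * \int[mu]_(t in `]x, +oo[) (f t)%:E = \int[mu]_(t in `]x, +oo[) (c * f t)%:E)%E.
Proof.
move=> c0 mf f0; under [RHS]eq_integral do rewrite EFinM.
rewrite ge0_integralZl//.
- by apply/measurable_EFinP; exact: measurable_funTS.
- by move=> t _; rewrite lee_fin.
Qed.

Lemma ig_tail_le n x : 0 < x ->
  n.+1%:R * ig_tail a n.+1 x <= expR (a / n.+1%:R) * levy_tail a x.
Proof.
move=> x0; rewrite -lee_fin [leLHS]EFinM [leRHS]EFinM -ig_tailE// -levy_tailE//.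
rewrite !Zl ?expR_ge0//; last 4 first.
- exact: measurable_levy_pdf.
- by move=> t; rewrite levy_pdf_ge0// ltW.
- exact: measurable_ig_pdf.
- by move=> t; rewrite ig_pdf_ge0// ltW.
apply: ge0_le_integral => //.
- by move=> t _; rewrite lee_fin mulr_ge0// ig_pdf_ge0// ltW.
- apply/measurable_EFinP; apply: measurable_funTS; apply: measurable_funM => //; exact: measurable_ig_pdf.
- apply/measurable_EFinP; apply: measurable_funTS; apply: measurable_funM => //; exact: measurable_levy_pdf.
- move=> t; rewrite /= in_itv/= andbT => xt; have t0 := lt_trans x0 xt.
  rewrite lee_fin ig_levy_pdf// ler_wpM2r ?levy_pdf_ge0 ?(ltW a_gt0)//.
  rewrite ler_piMr ?expR_ge0// -expR0 ler_expR oppr_le0.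
  by rewrite !divr_ge0 ?sqr_ge0// ltW.
Qed.

(** For t > x the factor e^{-a^2/(2 n^2 t)} is at least its value at x, and e^{a/n} >= 1. *)
Lemma ig_tail_ge n x : 0 < x ->
  expR (- ((a / n.+1%:R) ^+ 2 / x / 2)) * levy_tail a x <= n.+1%:R * ig_tail a n.+1 x.
Proof.
move=> x0; rewrite -lee_fin [leLHS]EFinM [leRHS]EFinM -ig_tailE// -levy_tailE//.
rewrite !Zl ?expR_ge0//; last 4 first.
- exact: measurable_ig_pdf.
- by move=> t; rewrite ig_pdf_ge0// ltW.
- exact: measurable_levy_pdf.
- by move=> t; rewrite levy_pdf_ge0// ltW.
apply: ge0_le_integral => //.
- by move=> t _; rewrite lee_fin mulr_ge0 ?expR_ge0// levy_pdf_ge0// ltW.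
- apply/measurable_EFinP; apply: measurable_funTS; apply: measurable_funM => //; exact: measurable_levy_pdf.
- apply/measurable_EFinP; apply: measurable_funTS; apply: measurable_funM => //; exact: measurable_ig_pdf.
- move=> t; rewrite /= in_itv/= andbT => xt; have t0 := lt_trans x0 xt.
  rewrite lee_fin ig_levy_pdf// ler_wpM2r ?levy_pdf_ge0 ?(ltW a_gt0)//.
  apply: (@le_trans _ _ (expR (- ((a / n.+1%:R) ^+ 2 / t / 2)))).
    rewrite ler_expR lerN2 ler_wpM2r// ler_wpM2l ?sqr_ge0//.
    by rewrite lef_pV2 ?posrE// ltW.
  rewrite ler_peMl ?expR_ge0//; apply: le_trans (expR_ge1Dx _).
  by rewrite lerDl ltW.
Qed.

Lemma cvg_ig_tail x : 0 < x ->
  n.+1%:R * ig_tail a n.+1 x @[n --> \oo] --> levy_tail a x.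
Proof.
move=> x0.
have an : a / n.+1%:R @[n --> \oo] --> (0 : R).
  rewrite -[X in _ --> X](mulr0 a); apply: cvgM; first exact: cvg_cst.
  exact: cvg_harmonic.
apply: (@squeeze_cvgr _ _ _ _
  (fun n => expR (- ((a / n.+1%:R) ^+ 2 / x / 2)) * levy_tail a x)
  (fun n => expR (a / n.+1%:R) * levy_tail a x)).
- by near=> n; rewrite ig_tail_le// ig_tail_ge.
- have h : expR (- ((a / n.+1%:R) ^+ 2 / x / 2)) @[n --> \oo] --> expR (- (0 ^+ 2 / x / 2)).
    apply: continuous_cvg; first exact: continuous_expR.
    apply: cvgN; apply: cvgM; last exact: cvg_cst.
    by apply: cvgM; last exact: cvg_cst; apply: cvgM.
  have z : expR (- (0 ^+ 2 / x / 2)) = 1 :> R by rewrite expr2 !mul0r oppr0 expR0.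
  rewrite z in h; rewrite -[X in _ --> X]mul1r; apply: cvgM; [exact: h|exact: cvg_cst].
- have h : expR (a / n.+1%:R) @[n --> \oo] --> expR 0.
    by apply: continuous_cvg an; exact: continuous_expR.
  rewrite expR0 in h; rewrite -[X in _ --> X]mul1r.
  by apply: cvgM; [exact: h|exact: cvg_cst].
Unshelve. all: by end_near. Qed.

Local Notation K := (2 * (a / Num.sqrt (2 * pi))).

Let K_gt0 : 0 < K :> R.
Proof. by rewrite mulr_gt0// divr_gt0// sqrtr_gt0 mulr_gt0// pi_gt0. Qed.

Let ig_hyp n := @tail_invP R _ (ig_tail a n.+1) (fun t => ig_pdf_gt0 (an_gt0 n))
  (measurable_ig_pdf _) (@continuous_ig_pdf _) (ig_tailE n).

Lemma ig_inv_ge0 n u : 0 <= ig_tail_inv a n.+1 u.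
Proof. by have [|[/ltW]] := ig_hyp n u; rewrite /ig_tail_inv => // ->. Qed.

(** Outside the range of the tail the inverse is 0 and the bound is trivial; inside, [ig_tail_le]
    and [levy_tail_le] are inverted together. The factor e^a majorizes all e^{a/n}, which makes the
    bound uniform. *)
Lemma ig_inv_le n u : 0 < u ->
  ig_tail_inv a n.+1 u <= (expR a * K / (n.+1%:R * u)) ^+ 2.
Proof.
move=> u0; have [E|[x0 xE]] := ig_hyp n u; first by rewrite /ig_tail_inv E sqr_ge0.
rewrite /ig_tail_inv; set x := 'pinv_ _ _ _ _ in x0 xE *.
rewrite -[leLHS](sqr_sqrtr (ltW x0)) lerXn2r ?nnegrE ?sqrtr_ge0//.
  by rewrite divr_ge0 ?mulr_ge0 ?expR_ge0 ?(ltW K_gt0)// ltW.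
rewrite ler_pdivlMr ?mulr_gt0// mulrC -ler_pdivlMr ?sqrtr_gt0// -[X in _ * X <= _]xE.
apply: le_trans (ig_tail_le n x0) _; rewrite -mulrA; apply: ler_pM.
- exact: expR_ge0.
- by rewrite ltW// levy_tail_gt0.
- by rewrite ler_expR ler_pdivrMr// ler_peMr ?ler1n// ltW.
- exact: levy_tail_le.
Qed.

(** Pointwise convergence of n G_n to L is used at [x1] and [J + e] only. There the limits lie
    strictly on either side of v, so for large n the value u_n is bracketed and the intermediate
    value theorem yields a preimage between the two points; u_n is thus in the range and the default
    value does not occur. The midpoints [m1] and [m2] leave room for both n G_n and n u_n to
    move. *)
Lemma cvg_ig_inv (u : nat -> R) (v : R) : 0 < v ->
  n.+1%:R * u n @[n --> \oo] --> v ->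
  ig_tail_inv a n.+1 (u n) @[n --> \oo] --> levy_tail_inv a v.
Proof.
move=> v0 uv; have [J0 JE] := levy_tail_invK a_gt0 v0.
set J := levy_tail_inv a v in J0 JE *.
apply/cvgrPdist_le => e e0.
pose x1 := Num.max (J - e) (J / 2).
have x1J : x1 < J by rewrite gt_max; apply/andP; split; lra.
have x10 : 0 < x1 by rewrite lt_max; apply/orP; right; lra.
have yx1 : v < levy_tail a x1 by rewrite -[ltLHS]JE; exact: levy_tail_lt.
have Je : levy_tail a (J + e) < v.
  by rewrite -[ltRHS]JE; apply: levy_tail_lt => //; rewrite ltrDl.
pose m1 := (v + levy_tail a x1) / 2; pose m2 := (v + levy_tail a (J + e)) / 2.
near=> n.
have h1 : m1 < n.+1%:R * ig_tail a n.+1 x1.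
  near: n; apply: (cvgr_gt _ (cvg_ig_tail x10)); rewrite /m1; lra.
have h2 : n.+1%:R * ig_tail a n.+1 (J + e) < m2.
  near: n; apply: (cvgr_lt _ (cvg_ig_tail (addr_gt0 J0 e0))); rewrite /m2; lra.
have h3 : n.+1%:R * u n < m1 by near: n; apply: (cvgr_lt _ uv); rewrite /m1; lra.
have h4 : m2 < n.+1%:R * u n by near: n; apply: (cvgr_gt _ uv); rewrite /m2; lra.
have g1 : u n <= ig_tail a n.+1 x1.
  by rewrite ltW// -(@ltr_pM2l _ n.+1%:R)// (lt_trans h3).
have g2 : ig_tail a n.+1 (J + e) <= u n.
  by rewrite ltW// -(@ltr_pM2l _ n.+1%:R)// (lt_trans h2).
have xJ : x1 <= J + e by rewrite ltW// (lt_trans x1J)// ltrDl.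
have [x /andP[xx1 xx2] xE] := @tail_ivt R _ (ig_tail a n.+1) (fun t => ig_pdf_gt0 (an_gt0 n))
  (measurable_ig_pdf _) (@continuous_ig_pdf _) (ig_tailE n) _ _ _ x10 xJ g2 g1.
have x0 : 0 < x by exact: lt_le_trans xx1.
rewrite -xE /ig_tail_inv (@tail_invK R _ (ig_tail a n.+1) (fun t => ig_pdf_gt0 (an_gt0 n))
  (measurable_ig_pdf _) (@continuous_ig_pdf _) (ig_tailE n))//.
by rewrite ler_distlC xx2 andbT; apply: le_trans xx1; rewrite le_max lexx.
Unshelve. all: by end_near. Qed.

End ig_tail_theory.

(** * The Laplace exponent of the jumps, by Tonelli *)

Section tonelli_sections.
Context {R : realType}.
Let mu := @lebesgue_measure R.

Lemma measurable_lt_set d (T : measurableType d) (f g : T -> R) :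
  measurable_fun setT f -> measurable_fun setT g -> measurable [set x | f x < g x].
Proof.
move=> mf mg; rewrite (_ : [set x | _] = (fun x => f x < g x) @^-1` [set true]).
  by rewrite -[X in measurable X]setTI; exact: measurable_fun_ltr.
by apply/seteqP; split.
Qed.

Lemma tonelli_sections (S : set (R * R)) (f : R * R -> \bar R) :
  measurable S -> measurable_fun setT f -> (forall z, (0 <= f z)%E) ->
  (\int[mu]_u \int[mu]_(x in xsection S u) f (u, x) =
   \int[mu]_x \int[mu]_(u in ysection S x) f (u, x))%E.
Proof.
move=> mS mf f0.
have mfS : measurable_fun setT (f \_ S).
  by apply/(measurable_restrictT _ mS); exact: measurable_funTS.
have fS0 z : (0 <= (f \_ S) z)%E by rewrite patchE; case: ifP.
have := @fubini_tonelli _ _ _ _ R (@lebesgue_measure R) (@lebesgue_measure R) _ mfS fS0.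
rewrite /fubini_F /fubini_G => h.
transitivity (\int[mu]_x \int[mu]_y (f \_ S) (x, y))%E.
  apply: eq_integral => u _; rewrite integral_mkcond; apply: eq_integral => x _.
  by rewrite !patchE mem_xsection.
rewrite h; apply: eq_integral => x _; rewrite [RHS]integral_mkcond; apply: eq_integral => u _.
by rewrite !patchE mem_ysection.
Qed.

End tonelli_sections.

Section levy_exponent.
Context {R : realType}.
Let mu := @lebesgue_measure R.
Variable a : R.
Hypothesis a_gt0 : 0 < a.
Local Notation J := (levy_tail_inv a).
Local Notation L := (levy_tail a).

Let m1 : measurable_fun [set: R * R] (fun z => z.1). Proof. exact: measurable_fst. Qed.
Let m2 : measurable_fun [set: R * R] (fun z => z.2). Proof. exact: measurable_snd. Qed.

(** Layer cake: the region 0 < x < J(u) is also 0 < u < L(x), whose section at x has length L(x). *)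
Lemma integral_levy_inv (psi : R -> R) : measurable_fun setT psi -> (forall x, 0 <= psi x) ->
  (\int[mu]_(u in `]0%R, +oo[) \int[mu]_(x in `]0%R, J u[) (psi x)%:E =
   \int[mu]_(x in `]0%R, +oo[) (psi x * L x)%:E)%E.
Proof.
move=> mpsi psi0.
pose S := [set z : R * R | 0 < z.1] `&` [set z | 0 < z.2] `&` [set z | z.2 < J z.1].
have mS : measurable S.
  apply: measurableI; first by apply: measurableI; exact: measurable_lt_set.
  by apply: measurable_lt_set => //; apply: measurableT_comp => //; exact: measurable_levy_inv.
have := @tonelli_sections R S (fun z => (psi z.2)%:E) mS.
move=> /(_ _ _)/wrap[||h].
- by apply/measurable_EFinP; exact: measurableT_comp.
- by move=> z; rewrite lee_fin.
transitivity (\int[mu]_u \int[mu]_(x in xsection S u) (psi x)%:E)%E.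
  rewrite [LHS]integral_mkcond; apply: eq_integral => u _; rewrite patchE.
  case: ifPn; rewrite ?inE ?notin_setE/= in_itv/= andbT => u0.
    congr (\int[mu]_(x in _) _)%E; apply/seteqP; split => x; rewrite /xsection/= inE/= in_itv/=.
      by move=> /andP[x0 xJ]; split => //; split.
    by move=> [[_ ->]].
  rewrite (_ : xsection S u = set0) ?integral_set0//.
  by rewrite -subset0 => x; rewrite /xsection/= inE/= => -[[? _] _].
rewrite h [RHS]integral_mkcond; apply: eq_integral => x _; rewrite patchE.
case: ifPn; rewrite ?inE ?notin_setE/= in_itv/= andbT => x0; last first.
  rewrite (_ : ysection S x = set0) ?integral_set0//.
  by rewrite -subset0 => u; rewrite /ysection/= inE/= => -[[_ ?] _].
rewrite (_ : ysection S x = `]0, L x[%classic); last first.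
  apply/seteqP; split => u; rewrite /ysection/= inE/= in_itv/=.
    by move=> [[u0 _]] xJ; rewrite u0 -lt_levy_inv.
  by move=> /andP[u0 uL]; split => //=; rewrite lt_levy_inv.
rewrite integral_cst//= /mu lebesgue_measure_itv/= lte_fin levy_tail_gt0//.
by rewrite EFinM -EFinD subr0.
Qed.

(** With [integral_levy_inv] this amounts to the change of variables u = L(t), obtained without
    differentiating J. *)
Lemma integral_levy_tail (psi : R -> R) : measurable_fun setT psi -> (forall x, 0 <= psi x) ->
  (\int[mu]_(x in `]0%R, +oo[) (psi x * L x)%:E =
   \int[mu]_(t in `]0%R, +oo[) ((levy_pdf a t)%:E * \int[mu]_(x in `]0%R, t[) (psi x)%:E))%E.
Proof.
move=> mpsi psi0.
have l0 t : 0 <= levy_pdf a t by rewrite levy_pdf_ge0// ltW.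
pose S := [set z : R * R | 0 < z.2] `&` [set z | z.2 < z.1].
have mS : measurable S by apply: measurableI; exact: measurable_lt_set.
have := @tonelli_sections R S (fun z => (levy_pdf a z.1 * psi z.2)%:E) mS.
move=> /(_ _ _)/wrap[||h].
- apply/measurable_EFinP; apply: measurable_funM; apply: measurableT_comp => //.
  exact: measurable_levy_pdf.
- by move=> z; rewrite lee_fin mulr_ge0.
transitivity (\int[mu]_t \int[mu]_(x in xsection S t) (levy_pdf a t * psi x)%:E)%E; last first.
  rewrite [RHS]integral_mkcond; apply: eq_integral => t _; rewrite patchE.
  case: ifPn; rewrite ?inE ?notin_setE/= in_itv/= andbT => t0.
    rewrite (_ : xsection S t = `]0, t[%classic); last first.
      by apply/seteqP; split => x; rewrite /xsection/= inE/= in_itv/= => /andP.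
    under eq_integral do rewrite EFinM.
    rewrite ge0_integralZl//.
    - by apply/measurable_EFinP; exact: measurable_funTS.
    - by move=> x _; rewrite lee_fin.
    - by rewrite lee_fin.
  rewrite (_ : xsection S t = set0) ?integral_set0//.
  rewrite -subset0 => x; rewrite /xsection/= inE/= => -[x0 xt]; apply: t0; exact: lt_trans xt.
rewrite h [LHS]integral_mkcond; apply: eq_integral => x _; rewrite patchE.
case: ifPn; rewrite ?inE ?notin_setE/= in_itv/= andbT => x0; last first.
  rewrite (_ : ysection S x = set0) ?integral_set0//.
  by rewrite -subset0 => t; rewrite /ysection/= inE/= => -[? _].
rewrite (_ : ysection S x = `]x, +oo[%classic); last first.
  by apply/seteqP; split => t; rewrite /ysection/= inE/= in_itv/= andbT => // -[].
rewrite EFinM -levy_tailE// -ge0_integralZl//.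
- by apply: eq_integral => t _; rewrite EFinM muleC.
- by apply/measurable_EFinP; apply: measurable_funTS; exact: measurable_levy_pdf.
- by move=> t _; rewrite lee_fin.
- by rewrite lee_fin.
Qed.

(** [|t|] equals t on the domain and makes the integrand nonnegative on the whole plane, as
    [tonelli_sections] requires. *)
Let levy_pdf_expR_int (l t : R) : 0 < l -> 0 < t ->
  ((levy_pdf a t * (1 - expR (- (l * t))))%:E =
   \int[mu]_(x in `]0%R, l[) (`|t| * levy_pdf a t * expR (- (t * x)))%:E)%E.
Proof.
move=> l0 t0; have p0 : 0 <= levy_pdf a t by rewrite levy_pdf_ge0// ltW.
transitivity ((levy_pdf a t)%:E * \int[mu]_(x in `]0%R, l[) (t * expR (- (t * x)))%:E)%E.
  by rewrite integral_expR_0c ?(ltW t0)// -EFinM [t * l]mulrC.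
rewrite -ge0_integralZl//.
- apply: eq_integral => x _; rewrite gtr0_norm// -EFinM; congr EFin.
  by rewrite mulrA [_ * t]mulrC.
- apply/measurable_EFinP; apply: measurable_funTS; apply: measurable_funM => //.
  by apply: measurableT_comp => //; apply: measurableT_comp => //; exact: measurable_funM.
- by move=> x _; rewrite lee_fin mulr_ge0 ?expR_ge0// ltW.
Qed.

Let levy_pdf_expR_int_dual (m : R) : 0 < m ->
  (\int[mu]_(t in `]0%R, +oo[) (`|t| * levy_pdf a t * expR (- (t * m)))%:E =
   a%:E * ((Num.sqrt (1 + 2 * m))^-1)%:E)%E.
Proof.
move=> m0; have k0 : 0 < Num.sqrt (2 * pi) :> R by rewrite sqrtr_gt0 mulr_gt0// pi_gt0.
have mc : 0 < m + 2^-1 by rewrite addr_gt0.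
transitivity (\int[mu]_(t in `]0%R, +oo[) ((a / Num.sqrt (2 * pi))%:E * ((Num.sqrt t)^-1 * expR (- ((m + 2^-1) * t)))%:E))%E.
  apply: eq_integral => t; rewrite inE/= in_itv/= andbT => t0.
  rewrite -EFinM; congr EFin; rewrite gtr0_norm// /levy_pdf powRN32//.
  rewrite (_ : expR (- ((m + 2^-1) * t)) = expR (- t / 2) * expR (- (t * m))); last first.
    by rewrite -expRD; congr expR; field.
  by field; rewrite !gt_eqF// sqrtr_gt0.
rewrite ge0_integralZl//.
- rewrite integral_half_gamma// -!EFinM; congr EFin.
  rewrite (_ : 1 + 2 * m = 2 * (m + 2^-1)); last by field.
  rewrite !sqrtrM//.
  by field; rewrite !gt_eqF ?sqrtr_gt0 ?pi_gt0.
- apply/measurable_EFinP; apply: measurable_funTS; apply: measurable_funM.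
    apply: (measurableT_comp measurable_invr).
    exact: continuous_measurable_fun (@sqrt_continuous R).
  by apply: measurableT_comp => //; apply: measurableT_comp => //; exact: measurable_funM.
- by rewrite lee_fin divr_ge0 ?(ltW a_gt0)// ltW.
Qed.

Let integral_inv_sqrtZ (l : R) : 0 < l ->
  (\int[mu]_(m in `]0%R, l[) (a%:E * ((Num.sqrt (1 + 2 * m))^-1)%:E) =
   (a * (Num.sqrt (1 + 2 * l) - 1))%:E)%E.
Proof.
move=> l0; rewrite ge0_integralZl//.
- by rewrite integral_inv_sqrt// EFinM.
- apply/measurable_EFinP; apply: measurable_funTS; apply: measurableT_comp; first exact: measurable_invr.
  apply: measurableT_comp; first exact: continuous_measurable_fun (@sqrt_continuous R).
  by apply: measurable_funD => //; exact: measurable_funM.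
- by rewrite lee_fin ltW.
Qed.

(** 1 - e^{-lt} is the integral of t e^{-tx} over 0 < x < l. After the exchange the t-integral is of
    Gamma(1/2) type and equals a / sqrt(1 + 2x), a derivative of a sqrt(1 + 2x). *)
Lemma levy_exponent_density (l : R) : 0 <= l ->
  (\int[mu]_(t in `]0%R, +oo[) (levy_pdf a t * (1 - expR (- (l * t))))%:E =
   (a * (Num.sqrt (1 + 2 * l) - 1))%:E)%E.
Proof.
rewrite le_eqVlt => /predU1P[<-|l0].
  rewrite mulr0 addr0 sqrtr1 subrr mulr0 integral0_eq// => t _.
  by rewrite mul0r oppr0 expR0 subrr mulr0.
have k0 : 0 < Num.sqrt (2 * pi) :> R by rewrite sqrtr_gt0 mulr_gt0// pi_gt0.
have p0 t : 0 <= levy_pdf a t by rewrite levy_pdf_ge0// ltW.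
pose S := [set z : R * R | 0 < z.1] `&` ([set z | 0 < z.2] `&` [set z | z.2 < l]).
have mS : measurable S.
  apply: measurableI; first exact: measurable_lt_set.
  by apply: measurableI; exact: measurable_lt_set.
have me : measurable_fun [set: R * R] (fun z => expR (- (z.1 * z.2))).
  by apply: measurableT_comp => //; apply: measurableT_comp => //; exact: measurable_funM.
have := @tonelli_sections R S (fun z => (`|z.1| * levy_pdf a z.1 * expR (- (z.1 * z.2)))%:E) mS.
move=> /(_ _ _)/wrap[||h].
- apply/measurable_EFinP; apply: measurable_funM => //; apply: measurable_funM.
    by apply: measurableT_comp => //; exact: normr_measurable.
  by apply: measurableT_comp => //; exact: measurable_levy_pdf.
- by move=> z; rewrite lee_fin; apply: mulr_ge0; rewrite ?expR_ge0//; apply: mulr_ge0.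
transitivity (\int[mu]_t \int[mu]_(x in xsection S t) (`|t| * levy_pdf a t * expR (- (t * x)))%:E)%E.
  rewrite [LHS]integral_mkcond; apply: eq_integral => t _; rewrite patchE.
  case: ifPn; rewrite ?inE ?notin_setE/= in_itv/= andbT => t0; last first.
    have -> : xsection S t = set0.
      by rewrite -subset0 => x; rewrite /xsection/= inE/= => -[z1 _]; exact: (t0 z1).
    by rewrite integral_set0.
  rewrite (_ : xsection S t = `]0, l[%classic); last first.
    apply/seteqP; split => x; rewrite /xsection/= inE/= in_itv/=.
      by move=> [_ [-> ->]].
    by move=> /andP[x0 xl]; exact: (conj t0 (conj x0 xl)).
  exact: levy_pdf_expR_int.
rewrite h.
transitivity (\int[mu]_(m in `]0%R, l[) (a%:E * ((Num.sqrt (1 + 2 * m))^-1)%:E))%E; last first.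
  exact: integral_inv_sqrtZ.
rewrite [RHS]integral_mkcond; apply: eq_integral => m _; rewrite patchE.
case: ifPn; rewrite ?inE ?notin_setE/= in_itv/= => ml; last first.
  have -> : ysection S m = set0.
    rewrite -subset0 => t; rewrite /ysection/= inE/= => -[_ [m0 m1']].
    by case: (ml (introT andP (conj m0 m1'))).
  by rewrite integral_set0.
have /andP[m0 _] := ml.
have -> : ysection S m = `]0, +oo[%classic.
  apply/seteqP; split => t; rewrite /ysection/= inE/= in_itv/= andbT; first by case.
  by move=> t0; exact: (conj t0 (andP ml)).
exact: (levy_pdf_expR_int_dual m0).
Qed.

Lemma levy_exponent (l : R) : 0 <= l ->
  (\int[mu]_(u in `]0%R, +oo[) (1 - expR (- (l * J u)))%:E =
   (a * (Num.sqrt (1 + 2 * l) - 1))%:E)%E.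
Proof.
move=> l0; rewrite -levy_exponent_density//.
pose psi x := l * expR (- (l * x)).
have mpsi : measurable_fun setT psi.
  apply: measurable_funM => //.
  by apply: measurableT_comp => //; apply: measurableT_comp => //; exact: measurable_funM.
have psi0 x : 0 <= psi x by rewrite mulr_ge0 ?expR_ge0.
transitivity (\int[mu]_(u in `]0%R, +oo[) \int[mu]_(x in `]0%R, J u[) (psi x)%:E)%E.
  apply: eq_integral => u; rewrite inE/= in_itv/= andbT => u0.
  by rewrite integral_expR_0c// levy_inv_gt0.
rewrite integral_levy_inv// integral_levy_tail//.
apply: eq_integral => t; rewrite inE/= in_itv/= andbT => t0.
by rewrite integral_expR_0c.
Qed.

End levy_exponent.

(** * Exponential waiting times: joint law, Chernoff bounds, law of large numbers *)

Lemma iid_rect {R : realType} d (Omega : measurableType d) (P : probability Omega R)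
    d' (T : measurableType d') (Y : nat -> {RV P >-> T}) (mu : set T -> \bar R) n
    (B : nat -> set T) : iid_seq Y mu -> (forall i, measurable (B i)) ->
  P [set w | forall i : 'I_n, B i (Y i w)] = (\prod_(i < n) mu (B i))%E.
Proof.
move=> [Ymu Yind] mB; have := Yind [fset i in iota 0 n]%fset B mB.
rewrite (_ : \bigcap_(_ in _) _ = [set w | forall i : 'I_n, B i (Y i w)]); last first.
  apply/seteqP; split => w /= h.
    by move=> i; apply: (h i) => /=; rewrite !inE/= mem_iota add0n ltn_ord.
  move=> i /=; rewrite !inE/= mem_iota add0n => /= im.
  exact: (h (Ordinal im)).
move=> ->; rewrite (perm_big (index_iota 0 n))/=; last first.
  apply: uniq_perm; rewrite ?fset_uniq ?iota_uniq// => i.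
  by rewrite !inE mem_index_iota mem_iota add0n.
by rewrite big_mkord; apply: eq_bigr => i _; exact: (Ymu i _ (mB i)).
Qed.

Lemma measurable_ge_set {R : realType} d (T : measurableType d) (f : T -> R) (b : R) :
  measurable_fun setT f -> measurable [set x | b <= f x].
Proof.
move=> mf; rewrite (_ : [set x | _] = f @^-1` `[b, +oo[%classic).
  by rewrite -[X in measurable X]setTI; exact: mf.
by apply/seteqP; split => x /=; rewrite in_itv/= andbT.
Qed.

Section exponential_law.
Context {R : realType} d (Omega : measurableType d) (P : probability Omega R).
Variable E : nat -> {RV P >-> R}.
Hypothesis E_iid : iid_seq E (exponential_prob 1).

Definition exp_vec n (w : Omega) : n.-tuple R := [tuple E i w | i < n].

Lemma measurable_exp_vec n : measurable_fun setT (exp_vec n).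
Proof.
apply/measurable_fun_tnthP => i.
by rewrite (_ : _ \o _ = E i)//; apply/funext => w /=; rewrite tnth_mktuple.
Qed.

Lemma exp_pdf_law A : measurable A ->
  distribution P (E 0%N) A = (\int[lebesgue_measure]_(x in A) (exponential_pdf 1 x)%:E)%E.
Proof. by move=> mA; rewrite (E_iid.1 0%N A mA). Qed.

Lemma exp_vec_rect n (B : nat -> set R) : (forall i, measurable (B i)) ->
  P [set w | forall i : 'I_n, B i (E i w)] = (\prod_(i < n) distribution P (E 0%N) (B i))%E.
Proof.
by move=> mB; rewrite (iid_rect _ E_iid)//; apply: eq_bigr => i _; rewrite E_iid.1.
Qed.

(** [A] will be an event of the marks. Restricted to it, [P] has mass [P A] and the waiting times
    keep their product law, which is [pm_law] with [c] equal to that mass. *)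
Lemma exp_vec_law (A : set Omega) (mA : measurable A) n :
  (forall B : nat -> set R, (forall i, measurable (B i)) ->
    P (A `&` [set w | forall i : 'I_n, B i (E i w)]) =
    (P A * P [set w | forall i : 'I_n, B i (E i w)])%E) ->
  forall F : n.-tuple R -> \bar R, measurable_fun setT F ->
    (forall t, (0 <= F t)%E) ->
  (\int[P]_w (F (exp_vec n w) * (\1_A w)%:E) =
   P A * \int[pm (fun=> distribution P (E 0%N)) n]_t F t)%E.
Proof.
move=> hA F mF F0.
have mFV : measurable_fun setT (F \o exp_vec n).
  by apply: measurableT_comp => //; exact: measurable_exp_vec.
have := @ge0_integral_density _ _ _ P (mrestr P mA) (\1_A) _ _ _ (F \o exp_vec n) mFV.
move=> /(_ _ _ _ _)/wrap[||||<-].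
- exact: measurable_indic.
- by move=> x; rewrite /indic.
- move=> B mB; rewrite integral_indic// /mrestr setIC//.
- by move=> w; exact: F0.
have := @pm_law _ _ _ (mrestr P mA) (fun=> distribution P (E 0%N)) n (fine (P A)) (exp_vec n).
move=> /(_ _ _ _ F mF F0)/wrap[|||].
- exact: fine_ge0.
- exact: measurable_exp_vec.
- move=> B mB; rewrite fineK ?fin_num_measure//.
  rewrite -exp_vec_rect// -hA// /mrestr/= setIC; congr (P (_ `&` _)).
  by apply/seteqP; split => w /= h i; have := h i; rewrite tnth_mktuple.
by rewrite fineK ?fin_num_measure.
Qed.

Lemma exp_mgf (s : R) : s < 1 ->
  (\int[distribution P (E 0%N)]_x (expR (s * x))%:E = ((1 - s)^-1)%:E)%E.
Proof.
move=> s1; have s0 : 0 < 1 - s by rewrite subr_gt0.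
rewrite (@ge0_integral_density_R _ _ (exponential_pdf 1)).
- transitivity (\int[lebesgue_measure]_x (((1 - s)^-1)%:E * (exponential_pdf (1 - s) x)%:E))%E.
    apply: eq_integral => x _; rewrite -!EFinM; congr EFin.
    have [x0|x0] := ltP x 0.
      by rewrite !lt0_exponential_pdf// !mulr0.
    rewrite !exponential_pdfE// mul1r mulrA mulVf ?gt_eqF// mul1r -expRD.
    by congr expR; ring.
  rewrite ge0_integralZl//.
  + by rewrite integral_exponential_pdf// mule1.
  + by apply/measurable_EFinP; exact: measurable_exponential_pdf.
  + by move=> x _; rewrite lee_fin exponential_pdf_ge0// ltW.
  + by rewrite lee_fin invr_ge0 ltW.
- exact: measurable_exponential_pdf.
- by move=> x; rewrite exponential_pdf_ge0.
- exact: exp_pdf_law.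
- apply/measurable_EFinP; apply: measurableT_comp => //; exact: measurable_funM.
- by move=> x; rewrite lee_fin expR_ge0.
Qed.

Lemma pm_exp_mgf (s : R) n : s < 1 ->
  (\int[pm (fun=> distribution P (E 0%N)) n]_t (expR (s * \sum_(i < n) tnth t i))%:E =
   ((1 - s)^-1 ^+ n)%:E)%E.
Proof.
move=> s1.
have m_ n' : measurable_fun [set: n'.-tuple R]
    (fun t => (expR (s * \sum_(i < n') tnth t i))%:E).
  apply/measurable_EFinP; apply: measurableT_comp => //; apply: measurable_funM => //.
  by apply: measurable_sum => i; exact: measurable_tnth.
elim: n => [|n IH].
  by rewrite integral_pm0// ?big_ord0 ?mulr0 ?expR0// => t; rewrite lee_fin expR_ge0.
rewrite integral_pmS//.
transitivity (\int[distribution P (E 0%N)]_x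
   (((1 - s)^-1 ^+ n)%:E * (expR (s * x))%:E))%E.
  apply: eq_integral => x _.
  transitivity (\int[pm (fun=> distribution P (E 0%N)) n]_t
     ((expR (s * x))%:E * (expR (s * \sum_(i < n) tnth t i))%:E))%E.
    apply: eq_integral => t _; rewrite -EFinM -expRD -mulrDr big_ord_recl tnth0.
    by congr (expR (s * (_ + _)))%:E; apply: eq_bigr => i _; rewrite tnthS.
  rewrite ge0_integralZl ?IH//; first by rewrite muleC.
  exact: m_.
rewrite ge0_integralZl//.
- by rewrite exp_mgf// -EFinM exprSr.
- by apply/measurable_EFinP; apply: measurableT_comp => //; exact: measurable_funM.
- by rewrite lee_fin exprn_ge0// invr_ge0 subr_ge0 ltW.
Qed.

Lemma measurable_arrival n : measurable_fun setT (arrival E n).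
Proof. by apply: measurable_sum => i. Qed.

Lemma arrival_mgf (s : R) n : s < 1 ->
  (\int[P]_w (expR (s * arrival E n w))%:E = ((1 - s)^-1 ^+ n)%:E)%E.
Proof.
move=> s1; rewrite -pm_exp_mgf//.
have := @exp_vec_law setT measurableT n _ (fun t => (expR (s * \sum_(i < n) tnth t i))%:E).
move=> /(_ _ _ _)/wrap[|||].
- by move=> B mB; rewrite probability_setT mul1e setTI.
- apply/measurable_EFinP; apply: measurableT_comp => //; apply: measurable_funM => //.
  by apply: measurable_sum => i; exact: measurable_tnth.
- by move=> t; rewrite lee_fin expR_ge0.
rewrite probability_setT mul1e => <-; apply: eq_integral => w _.
rewrite indicT/= mule1; congr (expR (s * _))%:E.
by apply: eq_bigr => i _; rewrite tnth_mktuple.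
Qed.

(** Markov's inequality for e^{s Gamma_n}. The sign of [s] is free, so upper and lower deviations
    are treated together. *)
Lemma arrival_chernoff (s b : R) n : s < 1 ->
  (P [set w | (b <= s * arrival E n w)%R] <= (expR (- b) * (1 - s)^-1 ^+ n)%:E)%E.
Proof.
move=> s1; rewrite EFinM -arrival_mgf//.
have mS : measurable_fun [set: Omega] (fun w => s * arrival E n w).
  by apply: measurable_funM => //; exact: measurable_arrival.
have mA : measurable [set w | b <= s * arrival E n w] by exact: measurable_ge_set.
have me : measurable_fun [set: Omega] (fun w => (expR (s * arrival E n w))%:E).
  by apply/measurable_EFinP; exact: measurableT_comp.
rewrite -ge0_integralZl//.
rewrite -[X in P X]setIT -integral_indic//; apply: ge0_le_integral => //.
- by apply/measurable_EFinP; exact: measurable_indic.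
- by apply: emeasurable_funM.
- move=> w _; rewrite -EFinM lee_fin indicE -expRD.
  case: (boolP (w \in _)) => [/set_mem/= h|_]; last exact: expR_ge0.
  by rewrite -[leLHS]expR0 ler_expR addrC subr_ge0.
Qed.

(** The rate s = e/(1 + e) is optimal for the threshold n (1 + e): then (1 - s)^{-1} = 1 + e and the
    bound is the n-th power of (1 + e) e^{-e}, which is below 1 for e other than 0. Borel-Cantelli
    concludes. A negative e gives the lower deviations. *)
Lemma arrival_dev (e : R) : -1 < e -> e != 0 ->
  {ae P, forall w, \forall n \near \oo, e / (1 + e) * arrival E n w < n%:R * e}.
Proof.
move=> e1 e0; have e1' : 0 < 1 + e by rewrite -ltrBlDl sub0r.
set s := e / (1 + e).
have s1 : s < 1 by rewrite ltr_pdivrMr// mul1r ltrDr.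
have sE : (1 - s)^-1 = 1 + e by rewrite /s; field; rewrite gt_eqF//= /=; lra.
pose r := expR (- e) * (1 + e).
have r0 : 0 <= r by rewrite mulr_ge0 ?expR_ge0// ltW.
have r1 : r < 1 by rewrite /r expRN mulrC ltr_pdivrMr ?expR_gt0// mul1r expR_gt1Dx.
pose F n := [set w | (n%:R * e <= s * arrival E n w)%R].
have mF n : measurable (F n).
  by apply: measurable_ge_set; apply: measurable_funM => //; exact: measurable_arrival.
have PF n : (P (F n) <= (r ^+ n)%:E)%E.
  apply: (le_trans (arrival_chernoff _ _ s1)); rewrite sE lee_fin /r exprMn -expRM_natl.
  by rewrite mulrN.
have := @lim_sup_set_cvg0 _ _ _ P F mF; move=> /(_ _)/wrap[|PF0].
  apply: (@le_lt_trans _ _ (\sum_(0 <= n <oo) (r ^+ n)%:E)%E).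
    by apply: lee_nneseries => // n _; exact: PF.
  have h : (\sum_(0 <= n < k) (r ^+ n)%:E @[k --> \oo] --> ((1 - r)^-1)%:E)%E.
    have : series (geometric 1 r) k @[k --> \oo] --> (1 * (1 - r)^-1 : R).
      by apply: cvg_geometric_series; rewrite ger0_norm.
    rewrite mul1r (_ : (fun k => (\sum_(0 <= n < k) (r ^+ n)%:E)%E) =
      EFin \o series (geometric 1 r)); last first.
      apply/funext => k /=; rewrite /series/= -sumEFin; apply: eq_bigr => i _.
      by rewrite /geometric/= mul1r.
    by move=> h; apply: cvg_EFin => //; exact: nearW.
  by rewrite (cvg_lim _ h)// ltry.
exists (lim_sup_set F); split => //.
  by apply: bigcap_measurable => // k _; apply: bigcup_measurable.
move=> w /= h n _; apply: contrapT => hn; apply: h.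
exists n => // k /= nk; rewrite ltNge; apply/negP => hk; apply: hn.
by exists k.
Unshelve. all: end_near. Qed.

Lemma exp_gt0 : {ae P, forall w, forall i, 0 < E i w}.
Proof.
apply: ae_foralln => i.
have mA : measurable [set w | E i w <= 0].
  rewrite (_ : [set w | _] = E i @^-1` `]-oo, 0]%classic).
    by rewrite -[X in measurable X]setTI; exact: measurable_funPT.
  by apply/seteqP; split => w /=; rewrite in_itv.
exists [set w | E i w <= 0]; split => //; last first.
  by move=> w /= /negP; rewrite -leNgt.
transitivity (P [set w | E 0%N w <= 0]).
  have h j : [set w | E j w <= 0] = E j @^-1` `]-oo, 0]%classic.
    by apply/seteqP; split => w /=; rewrite in_itv.
  rewrite !h; transitivity (distribution P (E i) `]-oo, 0]%classic) => //.
  by rewrite E_iid.1// -(E_iid.1 0%N).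
apply/eqP; rewrite eq_le measure_ge0 andbT.
apply/lee_addgt0Pr => e e0; rewrite add0e.
(* The Chernoff bound at rate -1/e and threshold 0 is 1/(1 + 1/e), which is below e. *)
have s1 : - e^-1 < 1 by rewrite (lt_trans _ ltr01)// oppr_lt0 invr_gt0.
apply: (@le_trans _ _ (P [set w | 0 <= - e^-1 * arrival E 1 w])).
  apply: le_measure; rewrite ?inE.
  - rewrite (_ : [set w | _] = E 0%N @^-1` `]-oo, 0]%classic).
      by rewrite -[X in measurable X]setTI; exact: measurable_funPT.
    by apply/seteqP; split => w /=; rewrite in_itv.
  - by apply: measurable_ge_set; apply: measurable_funM => //; exact: measurable_arrival.
  - move=> w /= w0; rewrite /arrival big_ord1 mulNr -mulrN mulr_ge0// ?oppr_ge0//.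
    by rewrite invr_ge0 ltW.
apply: (le_trans (arrival_chernoff _ _ s1)); rewrite oppr0 expR0 mul1r expr1 lee_fin opprK.
rewrite -[leRHS]invrK lef_pV2 ?posrE ?invr_gt0 ?addr_gt0 ?invr_gt0// lerDr//.
Qed.

Lemma arrival_slln : {ae P, forall w, arrival E n w / n%:R @[n --> \oo] --> (1 : R)}.
Proof.
(* Countably many deviations suffice; starting at 1/2 keeps the negative ones above -1. *)
have h1 m : {ae P, forall w, \forall n \near \oo,
    m.+2%:R^-1 / (1 + m.+2%:R^-1) * arrival E n w < n%:R * m.+2%:R^-1}.
  by apply: arrival_dev; rewrite ?gt_eqF// (lt_trans (ltrN10 _)).
have h2 m : {ae P, forall w, \forall n \near \oo,
    - m.+2%:R^-1 / (1 + - m.+2%:R^-1) * arrival E n w < n%:R * - m.+2%:R^-1}.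
  apply: arrival_dev; last by rewrite oppr_eq0 gt_eqF.
  by rewrite ltrN2 invf_lt1// ltr1n.
apply: filterS2 (ae_foralln h1) (ae_foralln h2) => w {}h1 {}h2.
apply/cvgrPdist_lt => e e0.
pose m := Num.truncn e^-1.
have me : m.+2%:R^-1 < e.
  rewrite invf_plt ?posrE//; apply: (@lt_trans _ _ m.+1%:R); last by rewrite ltr_nat.
  exact: truncnS_gt.
pose q : R := m.+2%:R^-1.
have q0 : 0 < q by rewrite invr_gt0 ltr0n.
have q1 : q < 1 by rewrite invf_lt1// ltr1n.
have {}me : q < e := me.
near=> n; have n0 : 0 < n%:R :> R by rewrite ltr0n; near: n; exact: nbhs_infty_gt.
have /= k1 : q / (1 + q) * arrival E n w < n%:R * q by near: n; exact: (h1 m).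
have /= k2 : - q / (1 + - q) * arrival E n w < n%:R * - q by near: n; exact: (h2 m).
have k1' : arrival E n w < (1 + q) * n%:R.
  have e1 : 0 < q / (1 + q) by rewrite divr_gt0// addr_gt0.
  rewrite -(ltr_pM2l e1); apply: (lt_le_trans k1).
  by rewrite mulrA divfK ?gt_eqF ?addr_gt0// mulrC.
have k2' : (1 - q) * n%:R < arrival E n w.
  have e1 : 0 < q / (1 - q) by rewrite divr_gt0// subr_gt0.
  rewrite -(ltr_pM2l e1) mulrA divfK ?gt_eqF ?subr_gt0//.
  by rewrite mulrN ltrNr !mulNr opprK mulrC in k2.
apply: (lt_trans _ me); rewrite ltr_distl.
by rewrite ltrBlDr ltr_pdivrMr// k1'/= -ltrBlDr ltr_pdivlMr.
Unshelve. all: end_near. Qed.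

End exponential_law.

(** * The renewal equation, on the line and on tuples of waiting times *)

Section poisson_renewal.
Context {R : realType}.
Let mu := @lebesgue_measure R.
Variables (p : R -> R) (c : R).
Hypothesis mp : measurable_fun setT p.
Hypothesis p0 : forall x : R, 0 <= p x.
Hypothesis p1 : forall x : R, p x <= 1.
Hypothesis p_neg : forall x : R, x <= 0 -> p x = 0.
Hypothesis cp : forall x : R, 0 < x -> {for x, continuous p}.
Hypothesis pc : (\int[mu]_(x in `]0%R, +oo[) (p x)%:E = c%:E)%E.

Definition renewal_cumul (x : R) : R := (\int[mu]_(t in `]-oo, x]) p t)%R.
Local Notation F := renewal_cumul.
(** [c - F x] is the integral of [p] over ]x, +oo[, so this is the expected product of 1 - p over
    the points beyond x of a unit-rate Poisson process. *)
Definition renewal_fun (x : R) : R := expR (- (c - F x)).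
Local Notation Phi := renewal_fun.

Let mpE : measurable_fun setT (EFin \o p).
Proof. exact/measurable_EFinP. Qed.

Let p_tot : (\int[mu]_x (p x)%:E = c%:E)%E.
Proof.
rewrite -pc [RHS]integral_mkcond; apply: eq_integral => x _; rewrite patchE.
by case: ifPn; rewrite ?notin_setE//= in_itv/= andbT => /negP; rewrite -leNgt => /p_neg ->.
Qed.

Let int_p (A : set R) : measurable A -> mu.-integrable A (EFin \o p).
Proof.
move=> mA; apply: (@integrableS _ _ _ mu setT) => //.
apply/integrableP; split => //.
under eq_integral do rewrite /= ger0_norm//.
by rewrite p_tot ltry.
Qed.

Let FE x : ((F x)%:E = \int[mu]_(t in `]-oo, x]) (p t)%:E)%E.
Proof.
by rewrite /F /Rintegral fineK// integral_fune_fin_num//; exact: int_p.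
Qed.

Let F_ge0 x : 0 <= F x.
Proof. by rewrite -lee_fin FE; apply: integral_ge0 => t _; rewrite lee_fin. Qed.

Let F_le x : F x <= c.
Proof.
rewrite -lee_fin FE -p_tot; apply: ge0_subset_integral => //.
by move=> t _; rewrite lee_fin.
Qed.

Let F_diff x y : x < y -> F x <= F y <= F x + (y - x).
Proof.
move=> xy; rewrite -!lee_fin EFinD !FE.
have -> : `]-oo, y]%classic = `]-oo, x] `|` `]x, y] :> set R.
  by rewrite -itv_bndbnd_setU// bnd_simp ltW.
rewrite ge0_integral_setU//=.
- rewrite leeDl ?integral_ge0//=; last by move=> t _; rewrite lee_fin.
  rewrite leeD2l//.
  have := @ge0_le_integral _ (measurableTypeR R) R mu `]x, y]%classic (measurable_itv _)
    (EFin \o p) (cst 1%:E).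
  rewrite integral_cst//= /mu lebesgue_measure_itv/= lte_fin xy -EFinD mul1e.
  apply => //.
  + by move=> t _; rewrite /= lee_fin.
  + exact: measurable_funTS.
  + by move=> t _; rewrite /= lee_fin.
- exact: measurable_funTS.
- by move=> t _; rewrite lee_fin.
- apply/disj_setPS => t /=; rewrite !in_itv/= => -[tx /andP[xt _]].
  by move: (lt_le_trans xt tx); rewrite ltxx.
Qed.

Let F_lip x y : `|F x - F y| <= `|x - y|.
Proof.
wlog xy : x y / x <= y => [h|].
  by have [/h//|/ltW/h] := leP x y; rewrite distrC [leRHS]distrC.
move: xy; rewrite le_eqVlt => /predU1P[->|xy]; first by rewrite !subrr normr0.
have /andP[h1 h2] := F_diff xy.
by rewrite !ler0_norm ?subr_le0// ?(ltW xy)//; lra.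
Qed.

Let F_continuous : continuous F.
Proof.
move=> x; apply/cvgrPdist_lt => e e0; near=> y.
apply: (le_lt_trans (F_lip _ _)).
by near: y; exact: (@cvgr_dist_lt _ _ _ (nbhs x) _ id).
Unshelve. all: end_near. Qed.

Let F0 : F 0 = 0.
Proof.
apply/EFin_inj; rewrite FE integral0_eq// => t.
by rewrite /= in_itv/= => t0; rewrite p_neg.
Qed.

Let is_derive_F (x : R) : 0 < x -> is_derive x 1 F (p x).
Proof.
move=> x0; have [] := @continuous_FTC1 R p -oo%O x (x + 1) _ _ _ (cp x0).
- by rewrite ltrDl.
- exact: int_p.
- by rewrite /= ltNyr.
by move=> dF <-; rewrite derive1E; exact: derivableP.
Qed.

Let F_cvg : F x @[x --> +oo] --> c.
Proof.
have h : F n%:R @[n --> \oo] --> c.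
  have := @ge0_nondecreasing_set_cvg_integral _ (measurableTypeR R) R
    (fun n => `]-oo, n%:R]%classic) (EFin \o p) mu.
  move=> /(_ _ _ _ _)/wrap[||||].
  - move=> m n mn; apply/subsetPset => t /=; rewrite !in_itv/= => /le_trans; apply.
    by rewrite ler_nat.
  - by move=> i; exact: measurable_itv.
  - by move=> i; exact: measurable_funTS.
  - by move=> i t _; rewrite /= lee_fin.
  rewrite (_ : \bigcup_i _ = setT); last first.
    rewrite -subTset => t _; exists (Num.truncn `|t|).+1 => //=; rewrite in_itv/=.
    by rewrite (le_trans (ler_norm t))// ltW// truncnS_gt.
  by rewrite p_tot => h; exact: (fine_cvg h).
apply/cvgrPdist_lt => e e0.
have [N _ hN] : \forall n \near \oo, c - F n%:R < e.
  move/cvgrPdist_lt : h => /(_ e e0); apply: filterS => n.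
  by rewrite ger0_norm// subr_ge0.
near=> x; rewrite ger0_norm ?subr_ge0//; apply: le_lt_trans (hN N (leqnn _)).
rewrite lerB//; have Nx : N%:R < x by near: x; exact: nbhs_pinfty_gt.
by have /andP[] := F_diff Nx.
Unshelve. all: end_near. Qed.

Lemma renewal_fun_gt0 x : 0 < Phi x. Proof. exact: expR_gt0. Qed.

Lemma renewal_fun_le1 x : Phi x <= 1.
Proof. by rewrite -[leRHS]expR0 ler_expR oppr_le0 subr_ge0. Qed.

Lemma renewal_fun0 : Phi 0 = expR (- c).
Proof. by rewrite /Phi F0 subr0. Qed.

Lemma continuous_renewal_fun : continuous Phi.
Proof.
move=> x; apply: continuous_comp; last exact: continuous_expR.
by apply: cvgN; apply: cvgB; [exact: cvg_cst|exact: F_continuous].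
Qed.

Lemma cvg_renewal_fun : Phi x @[x --> +oo] --> (1 : R).
Proof.
have h : - (c - F x) @[x --> +oo] --> (0 : R).
  by rewrite -oppr0; apply: cvgN; rewrite -(subrr c); apply: cvgB; [exact: cvg_cst|exact: F_cvg].
rewrite -expR0; exact: (cvg_comp _ _ h (@continuous_expR R 0)).
Qed.

(** This conditions on the first arrival after x. Since Phi' = p Phi on ]0, +oo[, the function [G]
    is an antiderivative; it vanishes at +oo because Phi <= 1. *)
Lemma renewal_eq (x : R) : 0 <= x ->
  (\int[mu]_(y in `]0%R, +oo[) (expR (- y) * ((1 - p (x + y)) * Phi (x + y)))%:E = (Phi x)%:E)%E.
Proof.
move=> x0.
pose f y := expR (- y) * ((1 - p (x + y)) * Phi (x + y)).
pose G y := - expR (- y) * Phi (x + y).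
suff -> : (\int[mu]_(y in `]0%R, +oo[) (f y)%:E = (0 - (- Phi x))%:E)%E by rewrite sub0r opprK.
have xy_gt0 y : 0 < y -> 0 < x + y by move=> y0; rewrite ltr_wpDl.
have cxy (y : R) : {for y, continuous (fun y => x + y)}.
  by apply: cvgD; [exact: cvg_cst|exact: cvg_id].
have cPhi (y : R) : {for y, continuous (fun y => Phi (x + y))}.
  by apply: continuous_comp; [exact: cxy|exact: continuous_renewal_fun].
have cexp (y : R) : {for y, continuous (fun y => expR (- y))}.
  by apply: continuous_comp; [exact: continuousN|exact: continuous_expR].
apply: (@ge0_FTC_open R f G 0 (- Phi x) 0).
- by move=> y y0; rewrite /f !mulr_ge0 ?expR_ge0 ?subr_ge0.
- move=> y y0; apply: cvgM; first exact: cexp.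
  apply: cvgM; last exact: cPhi.
  apply: cvgB; first exact: cvg_cst.
  by apply: continuous_comp; [exact: cxy|apply: cp; exact: xy_gt0].
- move=> y y0.
  have dF : is_derive y 1 (fun y => F (x + y)) (p (x + y)).
    have dxy : is_derive y 1 (fun y : R => x + y) 1.
      have := @is_deriveD R R R (cst x) id y 1 0 1 (is_derive_cst _ _ _) (is_derive_id _ _).
      by rewrite add0r.
    have := @is_derive1_comp R F (fun y => x + y) y _ _ (is_derive_F (xy_gt0 _ y0)) dxy.
    by rewrite mulr1.
  have dP : is_derive y 1 (fun y => Phi (x + y)) (Phi (x + y) * p (x + y)).
    have h : is_derive y 1 (fun y => - (c - F (x + y))) (p (x + y)).
      have := @is_deriveN R R R _ y 1 _ (@is_deriveB R R R (cst c) (fun y => F (x + y)) y 1 _ _ (is_derive_cst _ _ _) dF).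
      by rewrite sub0r opprK.
    exact: (@is_derive1_comp R expR (fun y => - (c - F (x + y))) y _ _ (is_derive_expR _) h).
  have dN : is_derive y 1 (fun y : R => - y) (- 1) by apply: is_derive_eq.
  have dE : is_derive y 1 (fun y : R => expR (- y)) (- expR (- y)).
    by have := @is_derive1_comp R expR (fun y => - y) y _ _ (is_derive_expR _) dN; rewrite mulrN1.
  by apply: is_derive_eq; rewrite /GRing.scale/= /f; ring.
- have : G y @[y --> 0] --> G 0 by apply: cvgM; [apply: cvgN; exact: cexp|exact: cPhi].
  by rewrite {2}/G oppr0 expR0 addr0 mulN1r => h; exact: cvg_at_right_filter.
- apply/cvgr0Pnorm_lt => e e0.
  near=> y; rewrite /G mulNr normrN normrM (ger0_norm (expR_ge0 _)) (ger0_norm (ltW (renewal_fun_gt0 _))).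
  apply: (@le_lt_trans _ _ (expR (- y))).
    by rewrite ler_piMr ?expR_ge0// renewal_fun_le1.
  rewrite expRN invf_plt ?posrE ?expR_gt0//.
  apply: (lt_le_trans _ (expR_ge1Dx _)); rewrite -ltrBlDl.
  by near: y; apply: nbhs_pinfty_gt; exact: num_real.
Unshelve. all: end_near. Qed.

End poisson_renewal.

Section partial_sums.
Context {R : realType}.

(** The coordinate of index [i] is included, so on the vector of waiting times this is [arrival] at
    [i.+1]. *)
Definition psum n (t : n.-tuple R) (i : nat) : R := \sum_(k < n | (k <= i)%N) tnth t k.

Lemma psum_cons0 n y (t : n.-tuple R) : psum (cons_tuple y t) 0 = y.
Proof.
by rewrite /psum big_mkcond big_ord_recl /= tnth0 big1 ?addr0// => i _; rewrite ifF.
Qed.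

Lemma psum_consS n y (t : n.-tuple R) i : psum (cons_tuple y t) i.+1 = y + psum t i.
Proof.
rewrite /psum big_mkcond big_ord_recl /= tnth0 [in RHS]big_mkcond/=; congr (_ + _).
by apply: eq_bigr => k _; rewrite tnthS.
Qed.

Lemma measurable_psum n i : measurable_fun [set: n.-tuple R] (fun t => psum t i).
Proof.
pose h (k : 'I_n) (t : n.-tuple R) := if (k <= i)%N then tnth t k else 0.
rewrite (_ : (fun t => _) = fun t => \sum_(k < n) h k t); last first.
  by apply/funext => t; rewrite /psum big_mkcond.
by apply: measurable_sum => k; rewrite /h; case: (k <= i)%N => //; exact: measurable_tnth.
Qed.

Lemma measurable_pm_section (mu : nat -> probability R R) n (F : n.+1.-tuple R -> \bar R) :
  measurable_fun setT F -> (forall t, (0 <= F t)%E) ->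
  measurable_fun [set: R] (fun x => \int[pm mu n]_t F (cons_tuple x t))%E.
Proof.
move=> mF F0; apply: (@measurable_fun_fubini_tonelli_F _ _ _ _ _ _ (fun z => F (consp z))) => //.
by apply: measurableT_comp => //; exact: measurable_consp.
Qed.

End partial_sums.

Section renewal_on_tuples.
Context {R : realType}.
Let mu := @lebesgue_measure R.
Variable mu0 : probability R R.
Hypothesis mu0E : forall A, measurable A ->
  mu0 A = (\int[mu]_(x in A) (exponential_pdf 1 x)%:E)%E.

Lemma exp_integral (G : R -> \bar R) : measurable_fun setT G -> (forall x, (0 <= G x)%E) ->
  (\int[mu0]_x G x = \int[mu]_(x in `]0%R, +oo[) (G x * (expR (- x))%:E))%E.
Proof.
move=> mG G0; rewrite (@ge0_integral_density_R _ _ (exponential_pdf 1))//; last 2 first.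
- exact: measurable_exponential_pdf.
- by move=> x; rewrite exponential_pdf_ge0.
have -> : (\int[lebesgue_measure]_x (G x * (exponential_pdf 1 x)%:E) =
  \int[lebesgue_measure]_(x in `[0%R, +oo[) (G x * (expR (- x))%:E))%E.
  rewrite [RHS]integral_mkcond; apply: eq_integral => x _; rewrite patchE.
  case: ifPn => [/set_mem/=|/negP h]; rewrite ?in_itv/= ?andbT.
    by move=> x0; rewrite exponential_pdfE// mulN1r mul1r.
  rewrite lt0_exponential_pdf ?mule0// ltNge; apply/negP => x0; apply: h.
  by rewrite inE/= in_itv/= andbT.
rewrite integral_itv_obnd_cbnd//; apply: measurable_funTS; apply: emeasurable_funM => //.
by apply/measurable_EFinP; apply: measurableT_comp.
Qed.

Variables (p : R -> R) (c : R).
Hypothesis mp : measurable_fun setT p.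
Hypothesis p0 : forall x : R, 0 <= p x.
Hypothesis p1 : forall x : R, p x <= 1.
Hypothesis p_neg : forall x : R, x <= 0 -> p x = 0.
Hypothesis cp : forall x : R, 0 < x -> {for x, continuous p}.
Hypothesis pc : (\int[mu]_(x in `]0%R, +oo[) (p x)%:E = c%:E)%E.

Lemma measurable_renewal_fun : measurable_fun setT (renewal_fun p c).
Proof. apply: continuous_measurable_fun; apply: continuous_renewal_fun; eassumption. Qed.

(** The starting point is generalized for the induction: peeling off the first waiting time y gives
    the same statement from x + y, and [renewal_eq] integrates over y. *)
Lemma renewal_pm n (x : R) : 0 <= x ->
  (\int[pm (fun=> mu0) n]_t ((\prod_(i < n) (1 - p (x + psum t i))) *
     renewal_fun p c (x + \sum_(i < n) tnth t i))%:E = (renewal_fun p c x)%:E)%E.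
Proof.
pose F n x (t : n.-tuple R) := ((\prod_(i < n) (1 - p (x + psum t i))) *
     renewal_fun p c (x + \sum_(i < n) tnth t i))%:E.
have F0 n' x' (t : n'.-tuple R) : (0 <= F n' x' t)%E.
  rewrite lee_fin; apply: mulr_ge0; last exact/ltW/renewal_fun_gt0.
  by apply: prodr_ge0 => i _; rewrite subr_ge0.
have mF n' x' : measurable_fun setT (F n' x').
  apply/measurable_EFinP; apply: measurable_funM.
    apply: measurable_prod => i _; apply: measurable_funB => //.
    apply: measurableT_comp => //; apply: measurable_funD => //; exact: measurable_psum.
  apply: measurableT_comp; first exact: measurable_renewal_fun.
  by apply: measurable_funD => //; apply: measurable_sum => i; exact: measurable_tnth.
elim: n x => [|n IH] x x0.
  by rewrite integral_pm0//; [rewrite !big_ord0 mul1r addr0|exact: mF|exact: F0].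
rewrite integral_pmS; [|exact: mF|exact: F0].
rewrite exp_integral; last 2 first.
- exact: (@measurable_pm_section R (fun=> mu0) n _ (mF n.+1 x) (F0 n.+1 x)).
- by move=> y; apply: integral_ge0 => t _; exact: (F0 n.+1 x).
rewrite -(renewal_eq mp p0 p1 p_neg cp pc x0).
apply: eq_integral => y; rewrite inE/= in_itv/= andbT => y0.
transitivity ((\int[pm (fun=> mu0) n]_t ((1 - p (x + y)%R)%:E * F n (x + y)%R t)) * (expR (- y))%:E)%E.
  congr (_ * _)%E; apply: eq_integral => t _; rewrite /F -EFinM mulrA; congr (_ * _)%:E.
    rewrite big_ord_recl psum_cons0; congr (_ * _); apply: eq_bigr => i _.
    by rewrite psum_consS addrA.
  rewrite big_ord_recl tnth0 addrA; congr (renewal_fun p c (_ + _)).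
  by apply: eq_bigr => i _; rewrite tnthS.
rewrite ge0_integralZl//; last by rewrite lee_fin subr_ge0.
by rewrite IH ?addr_ge0 ?(ltW y0)// muleC -!EFinM.
exact: mF.
Qed.

End renewal_on_tuples.

(** * From joint Laplace transforms to joint laws *)

Section laplace_vector.
Context {R : realType} d (Omega : measurableType d) (P : probability Omega R).
Variables (n : nat) (V : nat -> Omega -> R) (nu : nat -> probability R R).
Hypothesis mV : forall i, measurable_fun setT (V i).
Hypothesis V0 : forall i w, 0 <= V i w.
Hypothesis nu_neg : forall i, nu i `]-oo, 0[%classic = 0%E.

Let lap i (l : R) : R := fine (\int[nu i]_x (expR (- l * `|x|))%:E)%E.

Hypothesis lapV : forall l : nat -> R, (forall i, 0 <= l i) ->
  (\int[P]_w (expR (- \sum_(i < n) l i * V i w))%:E =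
   \prod_(i < n) \int[nu i]_x (expR (- l i * `|x|))%:E)%E.

Let mexp (l : R) : measurable_fun [set: R] (fun x => (expR (- l * `|x|))%:E).
Proof.
apply/measurable_EFinP; apply: measurableT_comp => //; exact: measurable_funM.
Qed.

Let lapE i (l : R) : 0 <= l -> (\int[nu i]_x (expR (- l * `|x|))%:E = (lap i l)%:E)%E.
Proof.
move=> l0; rewrite fineK// ge0_fin_numE; last first.
  by apply: integral_ge0 => x _; rewrite lee_fin expR_ge0.
apply: (@le_lt_trans _ _ (\int[nu i]_x (cst 1%:E) x)%E); last first.
  by rewrite integral_cst//= probability_setT mul1e ltry.
apply: ge0_le_integral => //.
by move=> x _; rewrite lee_fin -[leRHS]expR0 ler_expR mulNr oppr_le0 mulr_ge0.
Qed.

(** Hybrid argument: exponentials are traded for indicators one coordinate at a time, and each trade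
    is an instance of one-dimensional uniqueness. *)
Lemma laplace_vector (B : nat -> set R) : (forall i, measurable (B i)) ->
  P [set w | forall i : 'I_n, B i (V i w)] = (\prod_(i < n) nu i (B i))%E.
Proof.
move=> mB.
pose h (l : nat -> R) q (i : 'I_n) w : R :=
  if (i < q)%N then \1_(B i) (V i w) else expR (- (l i * V i w)).
pose k (l : nat -> R) q (i : 'I_n) : R :=
  if (i < q)%N then fine (nu i (B i)) else lap i (l i).
have mh l q i : measurable_fun setT (h l q i).
  rewrite /h; case: (i < q)%N.
    by apply: measurableT_comp => //; exact: measurable_indic.
  by apply: measurableT_comp => //; apply: measurableT_comp => //; exact: measurable_funM.
have h0 l q i w : 0 <= h l q i w by rewrite /h; case: ifP => _; [rewrite indicE|rewrite expR_ge0].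
have k0 l q i : 0 <= k l q i.
  rewrite /k; case: ifP => _; rewrite fine_ge0//.
  by apply: integral_ge0 => x _; rewrite lee_fin expR_ge0.
(* The rates are quantified after [q]: the trade at coordinate q needs the induction hypothesis at
   every rate of that coordinate. *)
have key q : (q <= n)%N -> forall l, (forall i, 0 <= l i) ->
    (\int[P]_w (\prod_(i < n) h l q i w)%:E = (\prod_(i < n) k l q i)%:E)%E.
  elim: q => [_ l l0|q IH qn l l0].
    rewrite -prodEFin; transitivity (\int[P]_w (expR (- \sum_(i < n) l i * V i w))%:E)%E.
      apply: eq_integral => w _; congr EFin.
      by rewrite -sumrN expR_sum.
    by rewrite lapV//; apply: eq_bigr => i _; rewrite lapE.
  pose iq : 'I_n := Ordinal qn.
  pose rest w := \prod_(i < n | i != iq) h l q i w.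
  pose C := \prod_(i < n | i != iq) k l q i.
  have mrest : measurable_fun setT rest.
    rewrite /rest; under eq_fun do rewrite big_mkcond/=.
    by apply: measurable_prod => i _; case: (i != iq).
  have rest0 w : 0 <= rest w by apply: prodr_ge0.
  have C0 : 0 <= C by apply: prodr_ge0.
  have E w : \prod_(i < n) h l q.+1 i w = rest w * \1_(B q) (V q w).
    rewrite (bigD1 iq)//= mulrC; congr (_ * _); last by rewrite /h ltnSn.
    apply: eq_bigr => i iiq; rewrite /h ltnS leq_eqVlt.
    by rewrite (_ : (i == q :> nat) = false)//; apply: contraNF iiq.
  have Ek : \prod_(i < n) k l q.+1 i = C * fine (nu q (B q)).
    rewrite (bigD1 iq)//= mulrC; congr (_ * _); last by rewrite /k ltnSn.
    apply: eq_bigr => i iiq; rewrite /k ltnS leq_eqVlt.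
    by rewrite (_ : (i == q :> nat) = false)//; apply: contraNF iiq.
  pose m0 := density_measure P mrest rest0.
  (* [m1 A] is the expectation of the other factors on the event that V_q is in A. The induction
     hypothesis, with the rate at q varied, says that it has the same Laplace transform as [C] times
     [nu q]. *)
  pose m1 : {measure set R -> \bar R} :=
    measure_function_pushforward__canonical__measure_function_Measure m0 (mV q).
  pose m2 : {measure set R -> \bar R} := mscale (NngNum C0) (nu q).
  have m2E A : m2 A = (C%:E * nu q A)%E by [].
  have int1 (f : R -> R) : measurable_fun setT f -> (forall x, 0 <= f x) ->
      (\int[m1]_x (f x)%:E = \int[P]_w (rest w * f (V q w))%:E)%E.
    move=> mf f0.
    have mfE : measurable_fun setT (EFin \o f) by exact/measurable_EFinP.
    have mfV : measurable_fun [set: Omega] (fun w => (f (V q w))%:E).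
      by apply/measurable_EFinP; exact: measurableT_comp.
    transitivity (\int[m0]_w (f (V q w))%:E)%E.
      by rewrite [LHS]ge0_integral_pushforward// => x _; rewrite /= lee_fin.
    rewrite (@ge0_integral_density _ _ _ P m0 rest mrest rest0)//.
      by apply: eq_integral => w _; rewrite -EFinM mulrC.
    by move=> w; rewrite lee_fin.
  have m1E A : measurable A -> m1 A = (\int[P]_w (rest w * \1_A (V q w))%:E)%E.
    move=> mA; rewrite -int1//; first by rewrite integral_indic// setIT.
  have m12 A : measurable A -> m1 A = m2 A.
    apply: laplace_unique.
    - rewrite m1E//; apply: (@le_lt_trans _ _ (\int[P]_w (cst 1%:E) w)%E); last first.
        by rewrite integral_cst//= probability_setT mul1e ltry.
      apply: ge0_le_integral => //.
      + by move=> w _; rewrite lee_fin mulr_ge0.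
      + apply/measurable_EFinP; apply: measurable_funM => //.
        by apply: measurableT_comp => //; exact: measurable_indic.
      + move=> w _; rewrite lee_fin indicT mulr1; apply: prodr_ile1 => i _.
        rewrite h0/= /h; case: ifP => _; first by rewrite indicE; case: (_ \in _).
        by rewrite -[leRHS]expR0 ler_expR oppr_le0 mulr_ge0.
    - by rewrite m2E probability_setT mule1 ltry.
    - rewrite m1E// integral0_eq// => w _.
      rewrite indicE memNset ?mulr0//= in_itv/=; apply/negP; rewrite -leNgt; exact: V0.
    - by rewrite m2E nu_neg mule0.
    - move=> x x0; rewrite int1//; last first.
        by apply: measurableT_comp => //; exact: measurable_funM.
      rewrite ge0_integral_mscale//= lapE// -EFinM.
      pose l' i := if i == q then x else l i.
      have l'0 i : 0 <= l' i by rewrite /l'; case: ifP.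
      have := IH (ltnW qn) l' l'0.
      rewrite (_ : \prod_(i < n) k l' q i = C * lap q x); last first.
        have kq : k l' q iq = lap q x by rewrite /k /l' /= ltnn eqxx.
        have Cq : \prod_(i < n | i != iq) k l' q i = C.
          apply: eq_bigr => i iiq; rewrite /k /l'.
          by rewrite (_ : (i == q :> nat) = false)//; apply: contraNF iiq.
        by rewrite (bigD1 iq) //= kq Cq mulrC.
      move=> <-; apply: eq_integral => w _; congr EFin.
      rewrite [RHS](bigD1 iq)//= [RHS]mulrC; congr (_ * _); last first.
        by rewrite /h/= ltnn /l' eqxx ger0_norm// mulNr.
      apply: eq_bigr => i iiq; rewrite /h /l'.
      by rewrite (_ : (i == q :> nat) = false)//; apply: contraNF iiq.
  rewrite Ek EFinM fineK ?fin_num_measure//.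
  transitivity (m1 (B q)); last by rewrite m12// m2E.
  by rewrite m1E//; apply: eq_integral => w _; rewrite E.
have := key n (leqnn n) (fun=> 0) (fun=> lexx 0).
rewrite (_ : (\prod_(i < n) k _ _ i)%:E = \prod_(i < n) nu i (B i))%E; last first.
  by rewrite -prodEFin; apply: eq_bigr => i _; rewrite /k ltn_ord fineK ?fin_num_measure.
move=> <-; set A := [set w | _].
have mA : measurable A.
  rewrite (_ : A = \bigcap_(i in `I_n) V i @^-1` B i).
    apply: fin_bigcap_measurable => // i _.
    by rewrite -[X in measurable X]setTI; exact: mV.
  apply/seteqP; split => w /= Aw i; first by move=> im; exact: (Aw (Ordinal im)).
  exact: (Aw i (ltn_ord i)).
rewrite -[A in LHS]setIT -integral_indic//; apply: eq_integral => w _; congr EFin.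
rewrite indicE; case: (boolP (w \in A)) => [/set_mem/= Aw|/negP Aw].
  by rewrite big1// => i _; rewrite /h ltn_ord indicE mem_set.
apply/esym/eqP; rewrite prodf_seq_eq0; apply/hasP.
have [i Bi] : exists i : 'I_n, ~ B i (V i w).
  by apply/existsNP => h'; apply: Aw; rewrite inE.
by exists i; rewrite ?mem_index_enum//= /h ltn_ord indicE memNset.
Qed.

End laplace_vector.

(** * Averaging over the marks *)

Section marked_arrivals.
Context {R : realType} d (Omega : measurableType d) (P : probability Omega R).
Context d' (X : measurableType d') (H : probability X R).
Variables (theta : nat -> {RV P >-> X}) (E : nat -> {RV P >-> R}).
Hypothesis theta_iid : iid_seq theta H.
Hypothesis E_iid : iid_seq E (exponential_prob 1).
Hypothesis theta_Gamma_indep : indep_seqs P theta (fun i => arrival E i.+1).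

Lemma psum_exp_vec n (w : Omega) (i : 'I_n) : psum (exp_vec E n w) i = arrival E i.+1 w.
Proof.
rewrite /psum /arrival (big_ord_widen_cond n predT (fun k => E k w))//.
by apply: eq_bigr => k _; rewrite tnth_mktuple.
Qed.

Lemma sum_exp_vec n (w : Omega) : \sum_(i < n) tnth (exp_vec E n w) i = arrival E n w.
Proof. by apply: eq_bigr => k _; rewrite tnth_mktuple. Qed.

Let finite_rect d1 (T1 : measurableType d1) d2 (T2 : measurableType d2) n
    (Y : nat -> T1 -> T2) (B : nat -> set T2) :
  (forall i, measurable_fun setT (Y i)) -> (forall i, measurable (B i)) ->
  measurable [set w | forall i : 'I_n, B i (Y i w)].
Proof.
move=> mY mB; rewrite (_ : [set w | _] = \bigcap_(i in `I_n) Y i @^-1` B i).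
  apply: fin_bigcap_measurable => // i _.
  by rewrite -[X in measurable X]setTI; exact: mY.
apply/seteqP; split => w /= h i; first by move=> im; exact: (h (Ordinal im)).
exact: (h i (ltn_ord i)).
Qed.

(** The independence hypothesis concerns the arrival times; waiting times are their differences,
    hence measurable for the sigma-algebra they generate. *)
Lemma theta_exp_indep n (A : nat -> set X) (B : nat -> set R) :
  (forall i, measurable (A i)) -> (forall i, measurable (B i)) ->
  P ([set w | forall i : 'I_n, A i (theta i w)] `&` [set w | forall i : 'I_n, B i (E i w)]) =
  (P [set w | forall i : 'I_n, A i (theta i w)] * P [set w | forall i : 'I_n, B i (E i w)])%E.
Proof.
move=> mA mB; apply: theta_Gamma_indep.
  pose G := \bigcup_i preimage_set_system setT (theta i) measurable.
  apply: (@finite_rect _ (g_sigma_algebraType G) _ X n (fun i w => theta i w) A) => // i _ Y mY.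
  by apply: sub_sigma_algebra; exists i => //; exists Y.
pose G := \bigcup_i preimage_set_system setT (arrival E i.+1) measurable.
have mar i : measurable_fun [set: g_sigma_algebraType G] (fun w => arrival E i w).
  (* The generating sequence starts at [arrival] 1; the arrival of index 0 is a constant. *)
  case: i => [|i].
    by rewrite (_ : (fun w => _) = cst 0)//; apply/funext => w; rewrite /arrival big_ord0.
  by move=> _ Y mY; apply: sub_sigma_algebra; exists i => //; exists Y.
apply: (@finite_rect _ (g_sigma_algebraType G) _ R n (fun i w => E i w) B) => // i.
rewrite (_ : (fun w => E i w) = (fun w => arrival E i.+1 w - arrival E i w)).
  exact: measurable_funB.
by apply/funext => w; rewrite /arrival big_ord_recr/= addrAC subrr add0r.
Qed.

Variables (m : nat) (A : 'I_m -> set X) (f : 'I_m -> R -> R) (c : R).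
Hypothesis mA : forall j, measurable (A j).
Hypothesis A_triv : trivIset setT A.
Hypothesis A_cover : \bigcup_j A j = setT.
Hypothesis mf : forall j, measurable_fun setT (f j).
Hypothesis f01 : forall j u, 0 <= f j u <= 1.
Hypothesis f_neg : forall j u, u <= 0 -> f j u = 1.
Hypothesis cf : forall j (u : R), 0 < u -> {for u, continuous (f j)}.

Definition block_mass j : R := fine (H (A j)).
Local Notation h := block_mass.

Lemma block_mass_ge0 j : 0 <= h j. Proof. exact: fine_ge0. Qed.

Lemma sum_block_mass : \sum_j h j = 1.
Proof.
apply: EFin_inj; rewrite -sumEFin.
transitivity (\sum_j H (A j))%E.
  by apply: eq_bigr => j _; rewrite fineK// fin_num_measure.
rewrite -measure_bigsetU_ord//; transitivity (H setT); last exact: probability_setT.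
congr (H _); rewrite -A_cover -bigcup_pred; apply: eq_bigcupl.
by split => i _; rewrite /= ?inE.
Qed.

(** One minus the factor averaged over the mark: this takes the place of [p] in the renewal
    equation. *)
Definition mark_defect (u : R) : R := 1 - \sum_j h j * f j u.
Local Notation p := mark_defect.

Let sum01 u : 0 <= \sum_j h j * f j u <= 1.
Proof.
apply/andP; split.
  by apply: sumr_ge0 => j _; have /andP[? _] := f01 j u; rewrite mulr_ge0// block_mass_ge0.
rewrite -sum_block_mass; apply: ler_sum => j _; have /andP[_ ?] := f01 j u.
by rewrite ler_piMr// block_mass_ge0.
Qed.

Lemma measurable_mark_defect : measurable_fun setT p.
Proof.
by apply: measurable_funB => //; apply: measurable_sum => j; exact: measurable_funM.
Qed.

Lemma mark_defect_ge0 u : 0 <= p u.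
Proof. by rewrite subr_ge0; have /andP[] := sum01 u. Qed.

Lemma mark_defect_le1 u : p u <= 1.
Proof. by rewrite gerBl; have /andP[] := sum01 u. Qed.

Lemma mark_defect_neg u : u <= 0 -> p u = 0.
Proof.
move=> u0; rewrite /p -[X in X - _]sum_block_mass -sumrB big1// => j _.
by rewrite f_neg// mulr1 subrr.
Qed.

Lemma continuous_mark_defect (u : R) : 0 < u -> {for u, continuous p}.
Proof.
move=> u0; apply: cvgB; first exact: cvg_cst.
apply: cvg_big => [|j _]; first exact: add_continuous.
apply: cvgM; first exact: cvg_cst.
exact: cf.
Qed.

Hypothesis pc : (\int[lebesgue_measure]_(u in `]0%R, +oo[) (p u)%:E = c%:E)%E.
Local Notation Phi := (renewal_fun p c).

(** The product of sums is expanded over the assignments phi of blocks to the first n marks. For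
    each phi the mark event splits off by independence, with probability the product of the block
    masses; resummation replaces every factor by its average, and [renewal_pm] from 0 applies. *)
Lemma marked_laplace n :
  (\int[P]_w ((\prod_(i < n) \sum_j \1_(A j) (theta i w) * f j (arrival E i.+1 w)) *
     Phi (arrival E n w))%:E = (Phi 0)%:E)%E.
Proof.
have Phi0 u : 0 <= Phi u by exact/ltW/renewal_fun_gt0.
have f0 j u : 0 <= f j u by have /andP[] := f01 j u.
have mPhi : measurable_fun setT Phi.
  apply: measurable_renewal_fun pc; [exact: measurable_mark_defect|exact: mark_defect_ge0|
    exact: mark_defect_le1|exact: mark_defect_neg].
pose S (phi : {ffun 'I_n -> 'I_m}) := [set w | forall i : 'I_n, A (phi i) (theta i w)].
pose F (phi : {ffun 'I_n -> 'I_m}) (t : n.-tuple R) :=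
  ((\prod_(i < n) f (phi i) (psum t i)) * Phi (\sum_(i < n) tnth t i))%:E.
have F0 phi t : (0 <= F phi t)%E by rewrite lee_fin mulr_ge0// prodr_ge0.
have mF phi : measurable_fun setT (F phi).
  apply/measurable_EFinP; apply: measurable_funM.
    by apply: measurable_prod => i _; apply: measurableT_comp => //; exact: measurable_psum.
  apply: measurableT_comp => //; apply: measurable_sum => i; exact: measurable_tnth.
(* Masses adding up to 1 exclude m = 0; the block [j0] then serves to extend an assignment to a
   sequence of sets. *)
have [m0|m_gt0] := posnP m.
  have := sum_block_mass; rewrite big1 => [/esym/eqP|j _]; first by rewrite oner_eq0.
  by have := leq_ltn_trans (leq0n _) (ltn_ord j); rewrite [X in (_ < X)%N]m0.
pose j0 : 'I_m := Ordinal m_gt0.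
pose ext (phi : {ffun 'I_n -> 'I_m}) (i : nat) : set X :=
  if insub i is Some k then A (phi k) else A j0.
have mext phi i : measurable (ext phi i) by rewrite /ext; case: insubP.
have extE phi (i : 'I_n) : ext phi i = A (phi i) by rewrite /ext valK.
have SE phi : S phi = [set w | forall i : 'I_n, ext phi i (theta i w)].
  by apply/seteqP; split => w /= h i; have := h i; rewrite extE.
have mS phi : measurable (S phi).
  by rewrite SE; apply: (@finite_rect _ Omega _ X n (fun i w => theta i w) (ext phi)) => // i; exact: measurable_funPT.
have PS phi : P (S phi) = (\prod_(i < n) h (phi i))%:E.
  rewrite SE (iid_rect _ theta_iid)// -prodEFin; apply: eq_bigr => i _.
  by rewrite extE fineK// fin_num_measure.
transitivity (\int[P]_w (\sum_(phi : {ffun 'I_n -> 'I_m}) F phi (exp_vec E n w) * (\1_(S phi) w)%:E))%E.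
  apply: eq_integral => w _.
  rewrite bigA_distr_bigA big_distrl/= -sumEFin; apply: eq_bigr => phi _.
  rewrite -EFinM; congr EFin; rewrite big_split/= sum_exp_vec -mulrA mulrC; congr (_ * _).
    by congr (_ * _); apply: eq_bigr => i _; rewrite psum_exp_vec.
  rewrite [RHS]indicE; case: (boolP (w \in S phi)) => [/set_mem/= Sw|/negP Sw].
    by rewrite big1// => i _; rewrite indicE mem_set//; exact: Sw.
  apply/eqP; rewrite prodf_seq_eq0; apply/hasP.
  have [i Bi] : exists i : 'I_n, ~ A (phi i) (theta i w).
    by apply/existsNP => h'; apply: Sw; rewrite inE.
  by exists i; rewrite ?mem_index_enum//= indicE memNset.
rewrite ge0_integral_sum//; last 2 first.
- move=> phi; apply: emeasurable_funM.
    apply: measurableT_comp; [exact: mF|exact: measurable_exp_vec].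
  by apply/measurable_EFinP; exact: measurable_indic.
- by move=> phi w _; rewrite mule_ge0// lee_fin.
transitivity (\sum_(phi : {ffun 'I_n -> 'I_m}) \int[pm (fun=> distribution P (E 0%N)) n]_t
   ((\prod_(i < n) h (phi i))%:E * F phi t))%E.
  apply: eq_bigr => phi _; rewrite (exp_vec_law E_iid (mS phi))//.
    rewrite ge0_integralZl//; first by rewrite PS.
    by rewrite lee_fin; apply: prodr_ge0 => i _; exact: block_mass_ge0.
  by move=> B mB; rewrite SE; exact: theta_exp_indep.
rewrite -ge0_integral_sum//; last 2 first.
- by move=> phi; apply: emeasurable_funM.
- move=> phi t _; rewrite mule_ge0// lee_fin; apply: prodr_ge0 => i _; exact: block_mass_ge0.
rewrite -(@renewal_pm R (distribution P (E 0%N)) (exp_pdf_law E_iid) p c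
  measurable_mark_defect mark_defect_ge0 mark_defect_le1 mark_defect_neg
  continuous_mark_defect pc n 0 (lexx 0)).
apply: eq_integral => t _.
transitivity ((\prod_(i < n) \sum_j h j * f j (psum t i)) * Phi (\sum_(i < n) tnth t i))%:E.
  rewrite bigA_distr_bigA big_distrl/= -sumEFin; apply: eq_bigr => phi _.
  by rewrite -EFinM big_split/= mulrA.
congr EFin; rewrite add0r; congr (_ * _); apply: eq_bigr => i _.
by rewrite add0r /p opprB addrC subrK.
Qed.

End marked_arrivals.

(** * Deterministic bounds along a path of arrivals *)

Section inverse_square_sums.
Context {R : realType}.

Lemma sum_inv_sqr_le n : \sum_(0 <= i < n) (i.+1%:R ^+ 2)^-1 <= 2 :> R.
Proof.
case: n => [|n]; first by rewrite big_geq.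
(* Strengthened so as to telescope: 1/(x + 1)^2 <= 1/x - 1/(x + 1). *)
suff /le_trans -> : \sum_(0 <= i < n.+1) (i.+1%:R ^+ 2)^-1 <= 2 - n.+1%:R^-1 :> R => //.
  by rewrite gerBl.
elim: n => [|n IH]; first by rewrite big_nat1 expr1n invr1; lra.
rewrite big_nat_recr//=; apply: (le_trans (lerD IH (lexx _))).
have n0 : 0 < n.+1%:R :> R by rewrite ltr0n.
rewrite -[n.+2]addn1 natrD; set x := n.+1%:R in n0 *.
rewrite -subr_ge0 (_ : _ - _ = (x * (x + 1) ^+ 2)^-1).
  by rewrite invr_ge0 mulr_ge0 ?sqr_ge0// ltW.
by field; rewrite !gt_eqF// addr_gt0.
Qed.

Lemma series_inv_sqr (K : R) (u : nat -> R) :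
  (forall i, 0 <= u i) -> (forall i, u i <= K / i.+1%:R ^+ 2) ->
  exists S, series u n @[n --> \oo] --> S /\
    (\sum_(0 <= i <oo) (u i)%:E = S%:E)%E.
Proof.
move=> u0 uK.
have K0 : 0 <= K by have := le_trans (u0 0%N) (uK 0%N); rewrite expr1n divr1.
have cu : cvgn (series u).
  apply: nondecreasing_is_cvgn.
    by apply: nondecreasing_series => i _ _; exact: u0.
  exists (K * 2) => _ [n _ <-]; rewrite /series/=.
  apply: (@le_trans _ _ (\sum_(0 <= i < n) K * (i.+1%:R ^+ 2)^-1)).
    by apply: ler_sum => i _; exact: uK.
  by rewrite -mulr_sumr ler_wpM2l// sum_inv_sqr_le.
exists (limn (series u)); split => //.
apply/cvg_lim => //.
rewrite (_ : (fun n => _) = EFin \o series u); first by apply: cvg_EFin => //; exact: nearW.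
by apply/funext => n /=; rewrite /series/= -sumEFin.
Qed.

End inverse_square_sums.

Section arrival_growth.
Context {R : realType} {Omega : Type}.
Variables (E : nat -> Omega -> R) (w : Omega).
Hypothesis E_gt0 : forall i, 0 < E i w.
Hypothesis slln : arrival E n w / n%:R @[n --> \oo] --> (1 : R).

Lemma arrival_nd i j : (i <= j)%N -> arrival E i w <= arrival E j w.
Proof.
move=> ij; rewrite /arrival (big_ord_widen j (fun k => E k w) ij) [leRHS](bigID (fun k : 'I_j => (k < i)%N))/=.
by rewrite lerDl sumr_ge0// => k _; exact/ltW/E_gt0.
Qed.

Lemma arrival_ge_first i : E 0%N w <= arrival E i.+1 w.
Proof.
by apply: le_trans (arrival_nd (ltn0Sn i)); rewrite /arrival big_ord1.
Qed.

Lemma arrival_gt0 i : 0 < arrival E i.+1 w.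
Proof. exact: lt_le_trans (E_gt0 0%N) (arrival_ge_first i). Qed.

(** Beyond some N the ratio Gamma_n / n exceeds 1/2. The finitely many earlier arrivals are at least
    the first waiting time, hence the division of that time by N + 1. *)
Lemma arrival_linear : exists2 c : R, 0 < c & forall i, c * i.+1%:R <= arrival E i.+1 w.
Proof.
have [N _ hN] : \forall n \near \oo, 2^-1 < arrival E n w / n%:R.
  by apply: (cvgr_gt 1 slln); rewrite invf_lt1// ltr1n.
pose c := Num.min (2^-1) (E 0%N w / N.+1%:R).
have c0 : 0 < c by rewrite lt_min invr_gt0 ltr0n/= divr_gt0.
exists c => // i; have [Ni|iN] := leqP N i.+1.
  have := hN i.+1 Ni; rewrite ltr_pdivlMr ?ltr0n// => /ltW; apply: le_trans.
  by rewrite ler_wpM2r// ge_min lexx.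
apply: (le_trans _ (arrival_ge_first i)).
apply: (@le_trans _ _ (E 0%N w / N.+1%:R * i.+1%:R)).
  by rewrite ler_wpM2r// ge_min lexx orbT.
rewrite mulrAC ler_pdivrMr ?ltr0n// ler_wpM2l ?(ltW (E_gt0 _))// ler_nat.
by rewrite ltnW// ltnW.
Qed.

Lemma arrival_cvgy : arrival E n w @[n --> \oo] --> +oo.
Proof.
have [c c0 hc] := arrival_linear; apply/cvgryPge => M; near=> n.
have n0 : (0 < n)%N by near: n; exact: nbhs_infty_gt.
rewrite -(prednK n0); apply: (le_trans _ (hc _)); rewrite prednK//.
rewrite -ler_pdivrMl//; near: n; exact: nbhs_infty_ger.
Unshelve. all: end_near. Qed.

Lemma levy_arrival_le (a : R) : 0 < a ->
  exists C : R, forall i, levy_tail_inv a (arrival E i.+1 w) <= C / i.+1%:R ^+ 2.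
Proof.
move=> a0; have [c c0 hc] := arrival_linear.
pose K := 2 * (a / Num.sqrt (2 * pi)).
exists ((K / c) ^+ 2) => i.
apply: (le_trans (levy_inv_le a0 (arrival_gt0 i))).
rewrite -expr_div_n -/K -[K / c / _]mulrA -invfM; rewrite lerXn2r ?nnegrE//.
- by rewrite divr_ge0 ?(ltW (arrival_gt0 i))// mulr_ge0// divr_ge0 ?sqrtr_ge0// ltW.
- by rewrite divr_ge0 ?mulr_ge0 ?divr_ge0 ?sqrtr_ge0// ltW.
- rewrite ler_wpM2l ?mulr_ge0 ?divr_ge0 ?sqrtr_ge0 ?(ltW a0)//.
  by rewrite lef_pV2 ?posrE ?mulr_gt0 ?ltr0n ?arrival_gt0.
Qed.

End arrival_growth.

(** * The inverse-Gaussian law as a probability measure *)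

Section ig_probability.
Context {R : realType}.
Variable g : R.
Hypothesis g0 : 0 < g.

Definition ig_density : R -> R := ig_pdf g \_ `]0, +oo[.

Lemma ig_density_ge0 t : 0 <= ig_density t.
Proof. by rewrite /ig_density patchE; case: ifP => // _; rewrite ig_pdf_ge0// ltW. Qed.

Lemma measurable_ig_density : measurable_fun setT ig_density.
Proof.
apply/(measurable_restrictT _ (measurable_itv _)).
by apply: measurable_funTS; exact: measurable_ig_pdf.
Qed.

Lemma ig_density_int f : measurable_fun setT f -> (forall x : R, (0 <= f x)%E) ->
  (\int[lebesgue_measure]_t (f t * (ig_density t)%:E) =
   \int[lebesgue_measure]_(t in `]0%R, +oo[) (f t * (ig_pdf g t)%:E))%E.
Proof.
move=> mf f0; rewrite [RHS]integral_mkcond; apply: eq_integral => t _.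
by rewrite /ig_density !patchE; case: ifP => // _; rewrite mule0.
Qed.

Lemma ig_density_int1 : (\int[lebesgue_measure]_t (ig_density t)%:E = 1)%E.
Proof.
transitivity (\int[lebesgue_measure]_t (cst 1 t * (ig_density t)%:E))%E.
  by apply: eq_integral => t _; rewrite mul1e.
rewrite ig_density_int//.
by under eq_integral do rewrite mul1e; rewrite ig_pdf_int1.
Qed.

(** The identity as a map between displays: the law is built over [measurableTypeR R] and pushed
    forward to [R]. *)
Definition of_measurableTypeR (x : measurableTypeR R) : R := x.

Lemma measurable_of_measurableTypeR :
  measurable_fun [set: measurableTypeR R] of_measurableTypeR.
Proof. by move=> _ A mA; rewrite setTI. Qed.

HB.instance Definition _ :=
  isMeasurableFun.Build _ _ (measurableTypeR R) R of_measurableTypeR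
    measurable_of_measurableTypeR.

Definition ig_prob : probability R R :=
  distribution (@density_prob _ (measurableTypeR R) R (@lebesgue_measure R) ig_density
    measurable_ig_density ig_density_ge0 ig_density_int1) of_measurableTypeR.

Lemma ig_probE A : measurable A ->
  ig_prob A = (\int[lebesgue_measure]_(t in A) (ig_density t)%:E)%E.
Proof. by []. Qed.

Lemma ig_prob_neg : ig_prob `]-oo, 0[%classic = 0%E.
Proof.
rewrite ig_probE// integral0_eq// => t; rewrite /= in_itv/= => t0.
rewrite /ig_density patchE ifN// notin_setE/= in_itv/= andbT.
by apply/negP; rewrite -leNgt ltW.
Qed.

Lemma ig_prob_laplace (l : R) : 0 <= l ->
  (\int[ig_prob]_x (expR (- l * `|x|))%:E = (expR (- (g * (Num.sqrt (1 + 2 * l) - 1))))%:E)%E.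
Proof.
move=> l0.
have me : measurable_fun [set: R] (fun x : R => (expR (- l * `|x|))%:E).
  by apply/measurable_EFinP; apply: measurableT_comp => //; exact: measurable_funM.
have e0 (x : R) : (0 <= (expR (- l * `|x|))%:E :> \bar R)%E by rewrite lee_fin expR_ge0.
rewrite (ge0_integral_density_R measurable_ig_density ig_density_ge0 ig_probE me e0).
rewrite ig_density_int// -ig_laplace//; apply: eq_integral => t; rewrite inE/= in_itv/= andbT => t0.
by rewrite -EFinM mulrC gtr0_norm// mulNr.
Qed.

End ig_probability.

Section injective_sums.
Context {R : pzSemiRingType} (k m : nat) (s : 'I_k -> 'I_m).

Lemma sum_inj (F : 'I_m -> R) : injective s ->
  (forall j, (forall i, s i != j) -> F j = 0) -> \sum_j F j = \sum_i F (s i).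
Proof.
move=> s_inj F0; rewrite (bigID (mem [set s i | i in 'I_k]%SET))/= [X in _ + X]big1 ?addr0.
  by rewrite big_imset//= => i j _ _; exact: s_inj.
move=> j /imsetP jI; apply: F0 => i; apply/eqP => sij; apply: jI.
by exists i.
Qed.

End injective_sums.

(** * Joint law of the unnormalized masses of the blocks *)

Section block_sums.
Context {R : realType} d (Omega : measurableType d) (P : probability Omega R).
Context d' (X : measurableType d') (H : probability X R).
Variables (a : R) (theta : nat -> {RV P >-> X}) (E : nat -> {RV P >-> R}).
Hypothesis a_gt0 : 0 < a.
Hypothesis theta_iid : iid_seq theta H.
Hypothesis E_iid : iid_seq E (exponential_prob 1).
Hypothesis theta_Gamma_indep : indep_seqs P theta (fun i => arrival E i.+1).

Definition jump i w : R := levy_tail_inv a (arrival E i.+1 w).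

Lemma jump_ge0 i w : 0 <= jump i w. Proof. exact: levy_inv_ge0. Qed.

Lemma measurable_jump i : measurable_fun setT (jump i).
Proof.
by apply: measurableT_comp; [exact: measurable_levy_inv|exact: measurable_arrival].
Qed.

(** [fine] turns a divergent series into 0; this affects a null set only and keeps the mass real and
    measurable. *)
Definition block_sum (B : set X) w : R :=
  fine (\sum_(0 <= i <oo) (jump i w * \1_B (theta i w))%:E)%E.

Lemma block_sum_ge0 B w : 0 <= block_sum B w.
Proof.
apply: fine_ge0; apply: nneseries_ge0 => i _ _.
by rewrite lee_fin mulr_ge0 ?jump_ge0.
Qed.

Lemma measurable_block_sum B : measurable B -> measurable_fun setT (block_sum B).
Proof.
move=> mB; apply: measurableT_comp; first exact: fine_measurable.
apply: ge0_emeasurable_sum => i *.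
  by rewrite lee_fin mulr_ge0 ?jump_ge0.
apply/measurable_EFinP; apply: measurable_funM; first exact: measurable_jump.
by apply: measurableT_comp => //; exact: measurable_indic.
Qed.

Lemma good_arrivals : {ae P, forall w, (forall i, 0 < E i w) /\
  arrival E n w / n%:R @[n --> \oo] --> (1 : R)}.
Proof. exact: filterS2 (exp_gt0 E_iid) (arrival_slln E_iid) => w. Qed.

Lemma cvg_block_sum B w : (forall i, 0 < E i w) ->
  arrival E n w / n%:R @[n --> \oo] --> (1 : R) ->
  \sum_(i < n) jump i w * \1_B (theta i w) @[n --> \oo] --> block_sum B w.
Proof.
move=> E0 slln; have [C hC] := levy_arrival_le E0 slln a_gt0.
have C0 : 0 <= C by have := le_trans (jump_ge0 0%N w) (hC 0%N); rewrite expr1n divr1.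
have [||S [h1 h2]] := @series_inv_sqr R C (fun i => jump i w * \1_B (theta i w)).
- by move=> i; rewrite mulr_ge0 ?jump_ge0.
- move=> i; apply: le_trans (hC i); apply: ler_piMr; first exact: jump_ge0.
  by rewrite indicE; case: (theta i w \in B).
rewrite /block_sum h2/= (_ : (fun n => _) = series (fun i => jump i w * \1_B (theta i w)))//.
by apply/funext => n; rewrite /series/= big_mkord.
Qed.

Section laplace.
Variables (m : nat) (A : 'I_m -> set X).
Hypothesis mA : forall j, measurable (A j).
Hypothesis A_triv : trivIset setT A.
Hypothesis A_cover : \bigcup_j A j = setT.
Local Notation h := (block_mass H A).

Let pick_block x : exists j, A j x /\ forall F : 'I_m -> R, \sum_k \1_(A k) x * F k = F j.
Proof.
have : (\bigcup_j A j) x by rewrite A_cover.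
case=> j _ Ajx; exists j; split => // F.
rewrite (bigD1 j)//= indicE mem_set// mul1r big1 ?addr0// => k kj.
rewrite indicE memNset ?mul0r// => Akx.
by move/eqP: kj; apply; apply: (A_triv I I); exists x.
Qed.

(** By [marked_laplace] the expectation is Phi(0) for every n. On almost every path Phi(Gamma_n) ->
    1 and the products converge; as everything is bounded by 1, the limit has expectation Phi(0) =
    e^{-c}, with [c] computed by [levy_exponent]. *)
Lemma block_sum_laplace (l : 'I_m -> R) : (forall j, 0 <= l j) ->
  (\int[P]_w (expR (- \sum_j l j * block_sum (A j) w))%:E =
   (expR (- \sum_j h j * (a * (Num.sqrt (1 + 2 * l j) - 1))))%:E)%E.
Proof.
move=> l0.
pose f j u := expR (- (l j * levy_tail_inv a u)).
pose c := \sum_j h j * (a * (Num.sqrt (1 + 2 * l j) - 1)).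
have mJ := measurable_levy_inv a_gt0.
have mf j : measurable_fun setT (f j).
  by apply: measurableT_comp => //; apply: measurableT_comp => //; exact: measurable_funM.
have f01 j u : 0 <= f j u <= 1.
  by rewrite expR_ge0 -[leRHS]expR0 ler_expR oppr_le0 mulr_ge0// levy_inv_ge0.
have f_neg j u : u <= 0 -> f j u = 1.
  by move=> u0; rewrite /f levy_inv_le0// mulr0 oppr0 expR0.
have cf j (u : R) : 0 < u -> {for u, continuous (f j)}.
  move=> u0; apply: continuous_comp; last exact: continuous_expR.
  apply: cvgN; apply: cvgM; first exact: cvg_cst.
  exact: continuous_levy_inv.
have m1f j : measurable_fun [set: R] (fun u => (1 - f j u)%:E).
  by apply/measurable_EFinP; exact: measurable_funB.
have pc : (\int[lebesgue_measure]_(u in `]0%R, +oo[) (mark_defect H A f u)%:E = c%:E)%E.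
  transitivity (\int[lebesgue_measure]_(u in `]0%R, +oo[) \sum_j ((h j)%:E * (1 - f j u)%:E))%E.
    apply: eq_integral => u _; rewrite /mark_defect -[X in X - _](sum_block_mass H mA A_triv A_cover).
    rewrite -sumrB -sumEFin; apply: eq_bigr => j _.
    by rewrite -EFinM mulrBr mulr1.
  rewrite ge0_integral_sum//; last 2 first.
  - move=> j; apply: measurable_funTS; apply: emeasurable_funM => //.
    exact: m1f.
  - move=> j u _; rewrite -EFinM lee_fin mulr_ge0 ?block_mass_ge0// subr_ge0.
    by have /andP[] := f01 j u.
  rewrite /c -sumEFin; apply: eq_bigr => j _.
  rewrite ge0_integralZl//.
  - by rewrite levy_exponent.
  - by apply: measurable_funTS; exact: m1f.
  - by move=> u _; rewrite lee_fin subr_ge0; have /andP[] := f01 j u.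
  - by rewrite lee_fin block_mass_ge0.
have mp := measurable_mark_defect H A mf.
have p0 := mark_defect_ge0 H mA A_triv A_cover f01.
have p1 := mark_defect_le1 H mA A_triv A_cover f01.
have pneg := mark_defect_neg H mA A_triv A_cover f_neg.
have cp (u : R) : 0 < u -> {for u, continuous (mark_defect H A f)} := @continuous_mark_defect R _ X H m A f cf u.
set p := mark_defect H A f in pc mp p0 p1 pneg cp.
pose Phi := renewal_fun p c.
have mPhi : measurable_fun setT Phi by exact: measurable_renewal_fun pc.
have Phi1 u : 0 <= Phi u <= 1.
  by rewrite (ltW (renewal_fun_gt0 _ _ _)) (renewal_fun_le1 mp p0 pneg pc).
pose V n w := (\prod_(i < n) \sum_j \1_(A j) (theta i w) * f j (arrival E i.+1 w)) *
  Phi (arrival E n w).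
have mV n : measurable_fun setT (V n).
  apply: measurable_funM; last by apply: measurableT_comp => //; exact: measurable_arrival.
  apply: measurable_prod => i _; apply: measurable_sum => j; apply: measurable_funM.
    by apply: measurableT_comp => //; exact: measurable_indic.
  by apply: measurableT_comp => //; exact: measurable_arrival.
have V1 n w : `|V n w| <= 1.
  have h1 : 0 <= \prod_(i < n) \sum_j \1_(A j) (theta i w) * f j (arrival E i.+1 w) <= 1.
    have hi (i : 'I_n) : 0 <= \sum_j \1_(A j) (theta i w) * f j (arrival E i.+1 w) <= 1.
      by have [j [_ ->]] := pick_block (theta i w); exact: f01.
    apply/andP; split; first by apply: prodr_ge0 => i _; have /andP[] := hi i.
    by apply: prodr_ile1 => i _; exact: hi.
  have /andP[h2 h3] := h1; have /andP[h4 h5] := Phi1 (arrival E n w).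
  by rewrite ger0_norm ?mulr_ge0// mulr_ile1.
have lim : {ae P, forall w, V n w @[n --> \oo] --> expR (- \sum_j l j * block_sum (A j) w)}.
  apply: filterS good_arrivals => w [E0 slln].
  rewrite -[X in _ --> X]mulr1; apply: cvgM; last first.
    exact: (cvg_comp _ _ (arrival_cvgy E0 slln) (cvg_renewal_fun mp p0 p1 pneg pc)).
  have VE n : \prod_(i < n) \sum_j \1_(A j) (theta i w) * f j (arrival E i.+1 w) =
      expR (- \sum_j l j * \sum_(i < n) jump i w * \1_(A j) (theta i w)).
    (* Each mark lies in exactly one block, so a sum over blocks weighted by indicators commutes
       with the exponential. *)
    transitivity (expR (\sum_(i < n) - (\sum_j \1_(A j) (theta i w) * (l j * jump i w)))).
      rewrite expR_sum; apply: eq_bigr => i _.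
      by have [j [_ hj]] := pick_block (theta i w); rewrite !hj.
    congr expR; rewrite sumrN; congr (- _); rewrite exchange_big/=; apply: eq_bigr => j _.
    by rewrite mulr_sumr; apply: eq_bigr => i _; ring.
  under eq_fun do rewrite VE.
  have cl : - \sum_j l j * \sum_(i < n) jump i w * \1_(A j) (theta i w) @[n --> \oo]
      --> - \sum_j l j * block_sum (A j) w.
    apply: cvgN; apply: cvg_big => [|j _]; first exact: add_continuous.
    by apply: cvgM; [exact: cvg_cst|exact: cvg_block_sum].
  exact: (cvg_comp _ _ cl (@continuous_expR R _)).
have mlim : measurable_fun [set: Omega] (fun w => expR (- \sum_j l j * block_sum (A j) w)).
  apply: measurableT_comp => //; apply: measurableT_comp => //.
  apply: measurable_sum => j; apply: measurable_funM => //; exact: measurable_block_sum.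
have := @bounded_convergence _ _ _ P V _ _ mV mlim lim V1.
have Pfin : (P [set: Omega] < +oo)%E by rewrite probability_setT ltry.
move=> /(_ Pfin) h1.
have VE n : (\int[P]_w (V n w)%:E = (Phi 0)%:E)%E.
  exact: (marked_laplace theta_iid E_iid theta_Gamma_indep mA A_triv A_cover mf f01 f_neg cf pc n).
have {}h1 : ((Phi 0)%:E @[n --> \oo] --> \int[P]_w (expR (- \sum_j l j * block_sum (A j) w))%:E)%E.
  by move: h1; under eq_fun do rewrite VE.
have := cvg_unique _ h1 (cvg_cst _) => ->//.
by rewrite /Phi (renewal_fun0 mp p0 pneg pc).
Qed.

(** Rate 0 on the blocks outside the image of [s] gives the transform of the selected masses; it
    factors, so [laplace_vector] yields independence together with the marginal laws. *)
Lemma block_sum_law (k : nat) (s : 'I_k -> 'I_m) (g : nat -> R) (g0 : forall i, 0 < g i)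
    (B : nat -> set R) : injective s -> (forall i : 'I_k, g i = a * h (s i)) ->
  (forall i, measurable (B i)) ->
  P [set w | forall i : 'I_k, B i (block_sum (A (s i)) w)] =
  (\prod_(i < k) ig_prob (g0 i) (B i))%E.
Proof.
move=> s_inj gE mB.
pose V (i : nat) w := if insub i is Some j then block_sum (A (s j)) w else 0.
have VE (i : 'I_k) w : V i w = block_sum (A (s i)) w by rewrite /V valK.
have -> : [set w | forall i : 'I_k, B i (block_sum (A (s i)) w)] =
    [set w | forall i : 'I_k, B i (V i w)].
  by apply/seteqP; split => w /= hB i; have := hB i; rewrite VE.
apply: (@laplace_vector R _ Omega P k V (fun i => ig_prob (g0 i))) => //.
- move=> i; rewrite /V; case: insubP => [j _ _|_] //; exact: measurable_block_sum.
- by move=> i w; rewrite /V; case: insubP => [j _ _|_] //; exact: block_sum_ge0.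
- by move=> i; exact: ig_prob_neg.
move=> l l0; pose l' (j : 'I_m) : R := \sum_(i < k | s i == j) l i.
have l'0 j : 0 <= l' j by apply: sumr_ge0.
have l's i : l' (s i) = l i.
  rewrite /l' (eq_bigl (fun i' => i' == i)) ?big_pred1_eq// => i'.
  exact: inj_eq.
have l'out j : (forall i, s i != j) -> l' j = 0.
  by move=> hj; rewrite /l' big_pred0// => i; exact/negbTE.
transitivity (\int[P]_w (expR (- \sum_j l' j * block_sum (A j) w))%:E)%E.
  apply: eq_integral => w _; congr (expR (- _))%:E.
  rewrite [RHS](sum_inj s_inj); last by move=> j /l'out ->; rewrite mul0r.
  by apply: eq_bigr => i _; rewrite VE l's.
rewrite block_sum_laplace// (sum_inj s_inj); last first.
  by move=> j /l'out ->; rewrite mulr0 addr0 sqrtr1 subrr !mulr0.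
rewrite -sumrN expR_sum -prodEFin; apply: eq_bigr => i _.
by rewrite ig_prob_laplace// gE l's mulrA [a * _]mulrC.
Qed.

End laplace.

End block_sums.

(** * Integration along rays through the simplex *)

Section rcons_tuples.
Context {R : realType}.

Lemma tnth_rcons_widen k (t : k.-tuple R) (x : R) (i : 'I_k) :
  tnth (rcons_tuple t x) (widen_ord (leqnSn k) i) = tnth t i.
Proof. by rewrite !(tnth_nth 0) /= nth_rcons size_tuple ltn_ord. Qed.

Lemma tnth_rcons_max k (t : k.-tuple R) (x : R) : tnth (rcons_tuple t x) ord_max = x.
Proof. by rewrite (tnth_nth 0) /= nth_rcons size_tuple ltnn eqxx. Qed.

Lemma sum_rcons k (t : k.-tuple R) (x : R) :
  \sum_(i < k.+1) tnth (rcons_tuple t x) i = \sum_(i < k) tnth t i + x.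
Proof.
rewrite big_ord_recr/= tnth_rcons_max; congr (_ + _).
by apply: eq_bigr => i _; rewrite tnth_rcons_widen.
Qed.

Lemma measurable_rcons d (T : measurableType d) k (f : T -> k.-tuple R) (g : T -> R) :
  measurable_fun setT f -> measurable_fun setT g ->
  measurable_fun [set: T] (fun y => rcons_tuple (f y) (g y)).
Proof.
move=> mf mg; apply/measurable_fun_tnthP => i.
have [ik|ki] := ltnP i k.
  rewrite (_ : _ \o _ = fun y => tnth (f y) (Ordinal ik)).
    exact: (measurableT_comp (@measurable_tnth _ R k (Ordinal ik)) mf).
  apply/funext => y /=; rewrite -[RHS](tnth_rcons_widen _ (g y)); congr tnth.
  exact: val_inj.
rewrite (_ : _ \o _ = g)//; apply/funext => y /=.
rewrite (_ : i = ord_max) ?tnth_rcons_max//; apply/val_inj/eqP.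
by rewrite /= eqn_leq ki andbT -ltnS ltn_ord.
Qed.

Lemma measurable_scale_tuple k : measurable_fun [set: R * k.-tuple R]
  (fun z => [tuple z.1 * tnth z.2 i | i < k]).
Proof.
apply/measurable_fun_tnthP => i.
rewrite (_ : _ \o _ = fun z : R * k.-tuple R => z.1 * tnth z.2 i).
  apply: measurable_funM; first exact: measurable_fst.
  by apply: (measurableT_comp (@measurable_tnth _ _ k i)); exact: measurable_snd.
by apply/funext => z /=; rewrite tnth_mktuple.
Qed.

Lemma measurable_sum_tuple k : measurable_fun [set: k.-tuple R] (fun t => \sum_(i < k) tnth t i).
Proof. by apply: measurable_sum => i; exact: measurable_tnth. Qed.

Lemma lebesgue_int_rcons k (Q : k.+1.-tuple R -> \bar R) :
  lebesgue_int Q =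
  lebesgue_int (fun t : k.-tuple R => \int[lebesgue_measure]_x Q (rcons_tuple t x))%E.
Proof.
elim: k Q => [|k IH] Q.
  by rewrite /=; apply: eq_integral => x _; congr Q; apply: val_inj.
transitivity (\int[lebesgue_measure]_y
    lebesgue_int (fun t : k.+1.-tuple R => Q (cons_tuple y t)))%E => //.
apply: eq_integral => y _.
rewrite IH; apply: eq_lebesgue_int => t; apply: eq_integral => x _.
by congr Q; apply: val_inj.
Qed.


Lemma lebesgue_int_eq0 k (f : k.-tuple R -> \bar R) :
  (forall t, f t = 0%E) -> lebesgue_int f = 0%E.
Proof.
elim: k f => [|k IH] f f0 /=; first exact: f0.
by apply: integral0_eq => x _; rewrite IH.
Qed.

Lemma simplex_pointD k (t : k.-tuple R) : \sum_(i < k.+1) tnth (simplex_point t) i = 1.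
Proof. by rewrite sum_rcons addrC subrK. Qed.

Lemma measurable_simplex_point k : measurable_fun setT (@simplex_point R k).
Proof.
apply: measurable_rcons => //; apply: measurable_funB => //; exact: measurable_sum_tuple.
Qed.

(** The last coordinate is replaced by the total s, a translation; then the first k coordinates are
    scaled by s, with Jacobian s^k. As [Q] vanishes when a coordinate is nonpositive, only s > 0
    contributes. *)
Lemma lebesgue_int_polar k (Q : k.+1.-tuple R -> \bar R) :
  measurable_fun setT Q -> (forall t, (0 <= Q t)%E) ->
  (forall t i, tnth t i <= 0 -> Q t = 0%E) ->
  lebesgue_int Q = lebesgue_int (fun t : k.-tuple R =>
    \int[lebesgue_measure]_(s in `]0%R, +oo[)
      ((s ^+ k)%:E * Q [tuple (s * tnth (simplex_point t) i)%R | i < k.+1]))%E.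
Proof.
move=> mQ Q0 Qneg.
have msec (F : R * k.-tuple R -> \bar R) (s : R) : measurable_fun setT F ->
    measurable_fun [set: k.-tuple R] (fun t => F (s, t)).
  move=> mF; apply: (@measurableT_comp _ _ _ _ _ _ F _ (fun t : k.-tuple R => (s, t))) => //.
  exact: measurable_fun_pair.
have mshift : measurable_fun [set: R * k.-tuple R]
    (fun z => Q (rcons_tuple z.2 (z.1 - \sum_(i < k) tnth z.2 i))).
  apply: measurableT_comp => //; apply: measurable_rcons; first exact: measurable_snd.
  apply: measurable_funB; first exact: measurable_fst.
  apply: (@measurableT_comp _ _ _ _ _ _ (fun t : k.-tuple R => \sum_(i < k) tnth t i) _ snd).
    exact: measurable_sum_tuple.
  exact: measurable_snd.
rewrite lebesgue_int_rcons.
transitivity (lebesgue_int (fun t : k.-tuple R =>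
    \int[lebesgue_measure]_s Q (rcons_tuple t (s - \sum_(i < k) tnth t i)%R))%E).
  apply: eq_lebesgue_int => t; rewrite -(@lebesgue_shift R (- \sum_(i < k) tnth t i))//.
  by apply: measurableT_comp => //; exact: measurable_rcons.
rewrite -(@lebesgue_int_tonelli R k (fun z => Q (rcons_tuple z.2 (z.1 - \sum_(i < k) tnth z.2 i))))//.
pose G (z : R * k.-tuple R) : \bar R := ((z.1 ^+ k * \1_(`]0%R, +oo[%classic) z.1)%:E *
  Q [tuple (z.1 * tnth (simplex_point z.2) i)%R | i < k.+1])%E.
have GE s t : 0 < s -> G (s, t) =
    ((s ^+ k)%:E * Q [tuple (s * tnth (simplex_point t) i)%R | i < k.+1])%E.
  by move=> s0; rewrite /G /= indicE mem_set ?mulr1//= in_itv/= s0.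
have Gneg s t : s <= 0 -> G (s, t) = 0%E.
  by move=> s0; rewrite /G /= indicE memNset ?mulr0 ?mul0e//= in_itv/= andbT; apply/negP; rewrite -leNgt.
have G0 z : (0 <= G z)%E.
  case: z => s t; have [s0|s0] := leP s 0; first by rewrite Gneg.
  by rewrite GE// mule_ge0// lee_fin exprn_ge0// ltW.
have msc : measurable_fun [set: R * k.-tuple R]
    (fun z => Q [tuple (z.1 * tnth (simplex_point z.2) i)%R | i < k.+1]).
  apply: measurableT_comp => //.
  apply: (@measurableT_comp _ _ _ _ _ _ (fun z : R * k.+1.-tuple R => [tuple z.1 * tnth z.2 i | i < k.+1])
    _ (fun z : R * k.-tuple R => (z.1, simplex_point z.2))); first exact: measurable_scale_tuple.
  apply: measurable_fun_pair; first exact: measurable_fst.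
  apply: (@measurableT_comp _ _ _ _ _ _ (@simplex_point R k) _ snd).
    exact: measurable_simplex_point.
  exact: measurable_snd.
have mG : measurable_fun setT G.
  apply: emeasurable_funM => //; apply/measurable_EFinP; apply: measurable_funM.
    by apply: measurable_funX; exact: measurable_fst.
  by apply: measurableT_comp; [exact: measurable_indic|exact: measurable_fst].
transitivity (\int[lebesgue_measure]_s lebesgue_int (fun t => G (s, t)))%E.
  apply: eq_integral => s _; have [s0|s0] := leP s 0.
    rewrite [LHS]lebesgue_int_eq0 ?[RHS]lebesgue_int_eq0// => t; first exact: Gneg.
    rewrite /=; set u := rcons_tuple _ _.
    (* The coordinates of [u] add up to s <= 0. *)
    have [i ui] : exists i, tnth u i <= 0.
      apply: contrapT => /forallNP ui.
      have : 0 < \sum_(i < k.+1) tnth u i.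
        rewrite big_ord_recl ltr_pwDl//.
          by rewrite ltNge; apply/negP; exact: ui.
        by apply: sumr_ge0 => i _; rewrite leNgt; apply/negP => h; exact: (ui _ (ltW h)).
      by rewrite sum_rcons addrC subrK ltNge s0.
    exact: Qneg ui.
  have s0' := ltW s0.
  under [RHS]eq_lebesgue_int do rewrite GE//.
  rewrite lebesgue_intZl ?exprn_ge0//; last first.
    exact: (msec _ _ msc).
  rewrite -(lebesgue_int_scale s0)//; last first.
    exact: (msec _ _ mshift).
  congr (_ * _)%E; apply: eq_lebesgue_int => t; congr Q; apply: eq_from_tnth => i.
  rewrite tnth_mktuple /=.
  have [ik|ki] := ltnP i k.
    rewrite (_ : i = widen_ord (leqnSn k) (Ordinal ik)); last exact: val_inj.
    by rewrite !tnth_rcons_widen tnth_mktuple.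
  rewrite (_ : i = ord_max); last by apply/val_inj/eqP; rewrite /= eqn_leq ki andbT -ltnS ltn_ord.
  rewrite !tnth_rcons_max mulrBr mulr1; congr (_ - _).
  by rewrite mulr_sumr; apply: eq_bigr => j _; rewrite tnth_mktuple.
rewrite lebesgue_int_tonelli//; apply: eq_lebesgue_int => t.
rewrite [RHS]integral_mkcond; apply: eq_integral => s _; rewrite patchE.
case: ifPn => [/set_mem/=|/negP h]; first by rewrite in_itv/= andbT => /GE ->.
by rewrite Gneg// leNgt; apply/negP => s0; apply: h; rewrite inE/= in_itv/= s0.
Qed.

End rcons_tuples.

(** * The Bessel function: finiteness and scaling *)

Section bessel.
Context {R : realType}.
Let mu := @lebesgue_measure R.

Definition bessel_integrand (nu x t : R) : R :=
  t `^ (nu - 1) * expR (- (x / 2) * (t + t^-1)).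

Lemma powR_expR (t p : R) : 0 < t -> t `^ p = expR (p * ln t).
Proof. by move=> t0; rewrite /powR gt_eqF. Qed.

Lemma bessel_integrand_ge0 nu x t : 0 <= bessel_integrand nu x t.
Proof. by rewrite mulr_ge0 ?powR_ge0 ?expR_ge0. Qed.

Lemma measurable_bessel_integrand nu x : measurable_fun setT (bessel_integrand nu x).
Proof.
apply: measurable_funM; first exact: measurable_powR.
apply: measurableT_comp => //; apply: measurable_funM => //.
by apply: measurable_funD => //; exact: measurable_invr.
Qed.

(** The singularity of t^{nu - 1} at 0 is absorbed by e^{-x/(2t)}: apply ln y < y at y = e/t, with
    [e] chosen so that q e = x/2. *)
Lemma bessel_integrand_le nu x : 0 < x -> nu < 1 ->
  exists C : R, 0 <= C /\ forall t, 0 < t -> bessel_integrand nu x t <= C * expR (- (x / 2 * t)).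
Proof.
move=> x0 nu1; pose q := 1 - nu; have q0 : 0 < q by rewrite subr_gt0.
pose e := x / 2 / q; have e0 : 0 < e by rewrite !divr_gt0.
exists (expR (- q * ln e)); split; first exact: expR_ge0.
move=> t t0; rewrite /bessel_integrand powR_expR// -!expRD ler_expR.
have u0 : 0 < e / t by rewrite divr_gt0.
have := @ln_sublinear R (e / t) u0.
rewrite lnM ?posrE ?invr_gt0// lnV ?posrE// => h.
have -> : - (x / 2) * (t + t^-1) = - (x / 2 * t) - q * (e / t).
  by rewrite /e; field; rewrite !gt_eqF.
have -> : nu - 1 = - q by rewrite /q opprB.
by have := ltW h; rewrite -(ler_pM2l q0); lra.
Qed.

Lemma integral_expRN (c : R) : 0 < c ->
  (\int[mu]_(t in `]0%R, +oo[) (expR (- (c * t)))%:E < +oo)%E.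
Proof.
move=> c0; apply: (@le_lt_trans _ _ ((c^-1)%:E * \int[mu]_t (exponential_pdf c t)%:E)%E); last first.
  by rewrite integral_exponential_pdf// mule1 ltry.
rewrite -ge0_integralZl//; last 3 first.
- by apply/measurable_EFinP; exact: measurable_exponential_pdf.
- by move=> t _; rewrite lee_fin exponential_pdf_ge0// ltW.
- by rewrite lee_fin invr_ge0 ltW.
rewrite (_ : (\int[mu]_(t in _) _)%E =
  (\int[mu]_(t in `]0%R, +oo[) ((c^-1)%:E * (exponential_pdf c t)%:E))%E); last first.
  apply: eq_integral => t; rewrite inE/= in_itv/= andbT => t0.
  by rewrite exponential_pdfE ?(ltW t0)// -EFinM mulrA mulVf ?gt_eqF// mul1r mulNr.
apply: ge0_subset_integral => //.
- by apply: emeasurable_funM => //; apply/measurable_EFinP; exact: measurable_exponential_pdf.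
- by move=> t _; rewrite -EFinM lee_fin mulr_ge0 ?invr_ge0 ?exponential_pdf_ge0 ?(ltW c0).
Qed.

(** [besselK] is a real integral, which would read 0 in case of divergence; finiteness makes it
    usable in extended-real identities. *)
Lemma besselKE nu x : 0 < x -> nu < 1 ->
  (\int[mu]_(t in `]0%R, +oo[) (bessel_integrand nu x t)%:E = (2 * besselK nu x)%:E)%E.
Proof.
move=> x0 nu1; rewrite /besselK mulrA mulfV// mul1r /Rintegral.
rewrite [RHS](_ : _ = (fine (\int[mu]_(t in `]0%R, +oo[) (bessel_integrand nu x t)%:E))%:E)%E//.
rewrite fineK// ge0_fin_numE; last first.
  by apply: integral_ge0 => t _; rewrite lee_fin bessel_integrand_ge0.
have [C [C0 hC]] := bessel_integrand_le x0 nu1.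
apply: (@le_lt_trans _ _ (\int[mu]_(t in `]0%R, +oo[) (C%:E * (expR (- (x / 2 * t)))%:E))%E).
  apply: ge0_le_integral => //.
  - by move=> t _; rewrite lee_fin bessel_integrand_ge0.
  - by apply/measurable_EFinP; apply: measurable_funTS; exact: measurable_bessel_integrand.
  - apply: emeasurable_funM => //; apply/measurable_EFinP; apply: measurable_funTS.
    by apply: measurableT_comp => //; apply: measurableT_comp => //; exact: measurable_funM.
  - by move=> t; rewrite /= in_itv/= andbT => t0; rewrite -EFinM lee_fin hC.
rewrite ge0_integralZl//.
- by rewrite lte_mul_pinfty ?lee_fin// integral_expRN// divr_gt0.
- apply/measurable_EFinP; apply: measurable_funTS.
  by apply: measurableT_comp => //; apply: measurableT_comp => //; exact: measurable_funM.
Qed.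

(** The substitution s = sqrt(S) t turns S/s + s into sqrt(S) (t + 1/t). *)
Lemma bessel_scale (nu S : R) : 0 < S -> nu < 1 ->
  (\int[mu]_(s in `]0%R, +oo[) (s `^ (nu - 1) * expR (- (S / s + s) / 2))%:E =
   (2 * (besselK nu (Num.sqrt S) * S `^ (nu / 2)))%:E)%E.
Proof.
move=> S0 nu1; pose c := Num.sqrt S; have c0 : 0 < c by rewrite sqrtr_gt0.
have cS : c * c = S by rewrite -expr2 sqr_sqrtr// ltW.
pose h s : R := s `^ (nu - 1) * expR (- (S / s + s) / 2).
have h0 s : 0 <= h s by rewrite mulr_ge0 ?powR_ge0 ?expR_ge0.
have mh : measurable_fun setT h.
  apply: measurable_funM; first exact: measurable_powR.
  apply: measurableT_comp => //; apply: measurable_funM => //; apply: measurableT_comp => //.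
  by apply: measurable_funD => //; apply: measurable_funM => //; exact: measurable_invr.
pose f : R -> \bar R := (EFin \o h) \_ `]0, +oo[.
have mf : measurable_fun setT f.
  apply/(measurable_restrictT _ (measurable_itv _)); apply/measurable_EFinP.
  exact: measurable_funTS.
have f0 s : (0 <= f s)%E by rewrite /f patchE; case: ifP => // _; rewrite lee_fin.
transitivity (\int[mu]_s f s)%E; first by rewrite integral_mkcond.
rewrite -(lebesgue_scale c0 mf f0).
transitivity (c%:E * \int[mu]_(t in `]0%R, +oo[)
    ((c `^ (nu - 1))%:E * (bessel_integrand nu c t)%:E))%E.
  congr (_ * _)%E; rewrite [RHS]integral_mkcond; apply: eq_integral => t _.
  rewrite /f !patchE !mem_setE !in_itv/= !andbT pmulr_rgt0//.
  case: ifP => // t0; rewrite /= -EFinM /h /bessel_integrand mulrA; congr EFin.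
  rewrite powRM ?(ltW c0) ?(ltW t0)//; congr (_ * expR _).
  by rewrite -cS; field; rewrite !gt_eqF.
rewrite ge0_integralZl//; last 3 first.
- by apply/measurable_EFinP; apply: measurable_funTS; exact: measurable_bessel_integrand.
- by move=> t _; rewrite lee_fin bessel_integrand_ge0.
- by rewrite lee_fin powR_ge0.
rewrite besselKE// -!EFinM; congr EFin.
have -> : S `^ (nu / 2) = c * c `^ (nu - 1).
  rewrite !powR_expR// -{1}(lnK c0) -expRD; congr expR.
  by rewrite -cS lnM ?posrE//; field.
by ring.
Qed.

End bessel.

(** * The normalized inverse-Gaussian density as a radial integral *)

Section nig_density.
Context {R : realType}.
Let mu := @lebesgue_measure R.
Variables (k : nat) (g : nat -> R).
Hypothesis g0 : forall i, 0 < g i.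
Local Notation nig z := (nig_pdf (fun i : 'I_k.+1 => g i) z).

Let prod_ig_density s (z : k.+1.-tuple R) : R := \prod_(i < k.+1) ig_density (g i) (s * tnth z i).

Let const_nig : (Num.sqrt (2 * pi) ^+ k.+1)^-1 * 2 =
  (2 `^ (k.+1%:R / 2 - 1) * pi `^ (k.+1%:R / 2))^-1 :> R.
Proof.
have p0 : 0 < pi :> R := pi_gt0 R.
have p2 : 0 <= 2 * pi :> R by rewrite mulr_ge0// ltW.
rewrite -powR12_sqrt// -powR_mulrn ?powR_ge0// -powRrM [2^-1 * _]mulrC powRM ?(ltW p0)//.
rewrite (_ : 2 `^ (k.+1%:R / 2 - 1) = 2 `^ (k.+1%:R / 2) / 2); last first.
  by rewrite !powR_expR// mulrBl mul1r expRD expRN lnK ?posrE.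
by field; rewrite !gt_eqF ?powR_gt0.
Qed.

(** The power of s is k from the Jacobian and -3/2 from each of the k + 1 densities, in all -(k +
    1)/2 - 1: the Bessel integrand of index -(k + 1)/2. The linear terms add up to s because the z_i
    sum to 1. *)
Lemma nig_radial_integrand (z : k.+1.-tuple R) (s : R) :
  (forall i, 0 < tnth z i) -> \sum_(i < k.+1) tnth z i = 1 -> 0 < s ->
  s ^+ k * prod_ig_density s z =
  (expR (\sum_(i < k.+1) g i) * (\prod_(i < k.+1) g i) / Num.sqrt (2 * pi) ^+ k.+1 *
    \prod_(i < k.+1) (tnth z i) `^ (- (3 / 2))) *
  (s `^ (- (k.+1%:R / 2) - 1) *
    expR (- ((\sum_(i < k.+1) g i ^+ 2 / tnth z i) / s + s) / 2)).
Proof.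
move=> z0 z1 s0.
have E (i : 'I_k.+1) : ig_density (g i) (s * tnth z i) =
    g i * (Num.sqrt (2 * pi))^-1 * (s `^ (- (3 / 2)) * tnth z i `^ (- (3 / 2))) *
    expR (- ((g i ^+ 2 / tnth z i) / s + s * tnth z i) / 2 + g i).
  rewrite /ig_density patchE ifT; last by rewrite inE/= in_itv/= mulr_gt0.
  rewrite /ig_pdf powRM ?(ltW s0) ?(ltW (z0 i))//.
  rewrite (_ : g i ^+ 2 / (s * tnth z i) = g i ^+ 2 / tnth z i / s)//.
  by rewrite invfM mulrA mulrAC.
rewrite /prod_ig_density (eq_bigr _ (fun i _ => E i)).
rewrite !big_split/= !prodr_const card_ord -expR_sum.
have -> : \sum_(i < k.+1) (- ((g i ^+ 2 / tnth z i) / s + s * tnth z i) / 2 + g i) =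
    - ((\sum_(i < k.+1) g i ^+ 2 / tnth z i) / s + s) / 2 + \sum_(i < k.+1) g i.
  rewrite big_split/=; congr (_ + _).
  rewrite -mulr_suml sumrN big_split/= -mulr_suml -mulr_sumr z1 mulr1//.
have -> : s `^ (- (k.+1%:R / 2) - 1) = s ^+ k * (s `^ (- (3 / 2))) ^+ k.+1.
  rewrite !powR_expR// -{2}(lnK s0) -!expRM_natl -expRD; congr expR.
  by rewrite -[k.+1]addn1 natrD; field.
rewrite expRD exprVn; field.
by rewrite gt_eqF// exprn_gt0// sqrtr_gt0 mulr_gt0// pi_gt0.
Qed.

Lemma nig_radial (z : k.+1.-tuple R) : (forall i, 0 < tnth z i) ->
  \sum_(i < k.+1) tnth z i = 1 ->
  (\int[mu]_(s in `]0%R, +oo[) ((s ^+ k)%:E * (prod_ig_density s z)%:E) = (nig z)%:E)%E.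
Proof.
move=> z0 z1.
pose S := \sum_(i < k.+1) g i ^+ 2 / tnth z i.
have S0 : 0 < S.
  rewrite /S big_ord_recl ltr_pwDl//; first by rewrite divr_gt0// exprn_gt0.
  by apply: sumr_ge0 => i _; rewrite divr_ge0 ?sqr_ge0// ltW.
pose C := expR (\sum_(i < k.+1) g i) * (\prod_(i < k.+1) g i) / Num.sqrt (2 * pi) ^+ k.+1 *
    \prod_(i < k.+1) (tnth z i) `^ (- (3 / 2)).
have C0 : 0 <= C.
  rewrite !mulr_ge0 ?expR_ge0 ?invr_ge0 ?exprn_ge0 ?sqrtr_ge0//.
    by apply: prodr_ge0 => i _; rewrite ltW.
  by apply: prodr_ge0 => i _; rewrite powR_ge0.
pose h s : R := s `^ (- (k.+1%:R / 2) - 1) * expR (- (S / s + s) / 2).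
have mh : measurable_fun setT h.
  apply: measurable_funM; first exact: measurable_powR.
  apply: measurableT_comp => //; apply: measurable_funM => //; apply: measurableT_comp => //.
  by apply: measurable_funD => //; apply: measurable_funM => //; exact: measurable_invr.
transitivity (\int[mu]_(s in `]0%R, +oo[) (C%:E * (h s)%:E))%E.
  apply: eq_integral => s; rewrite inE/= in_itv/= andbT => s0.
  by rewrite -!EFinM nig_radial_integrand.
rewrite ge0_integralZl//; last 2 first.
- by apply/measurable_EFinP; exact: measurable_funTS.
- by move=> s _; rewrite lee_fin mulr_ge0 ?powR_ge0 ?expR_ge0.
have nu1 : - (k.+1%:R / 2) < 1 :> R by rewrite (@lt_trans _ _ 0)// oppr_lt0 divr_gt0.
rewrite bessel_scale//.
rewrite -EFinM; congr EFin; rewrite /nig_pdf -/S -const_nig /C.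
rewrite (_ : - (k.+1%:R / 2) / 2 = - (k.+1%:R / 4) :> R); last by field.
by ring.
Qed.

Let radialZ (c : R) (z : k.+1.-tuple R) : 0 <= c ->
  (c%:E * \int[mu]_(s in `]0%R, +oo[) ((s ^+ k)%:E * (prod_ig_density s z)%:E) =
   \int[mu]_(s in `]0%R, +oo[) (c%:E * ((s ^+ k)%:E * (prod_ig_density s z)%:E)))%E.
Proof.
move=> c0; rewrite ge0_integralZl//.
- apply: emeasurable_funM; apply/measurable_EFinP; apply: measurable_funTS => //.
  apply: measurable_prod => i _; apply: measurableT_comp; first exact: measurable_ig_density.
  exact: measurable_funM.
- move=> s; rewrite /= in_itv/= andbT => s0; rewrite -EFinM lee_fin mulr_ge0 ?exprn_ge0 ?(ltW s0)//.
  by apply: prodr_ge0 => i _; exact: ig_density_ge0.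
Qed.

Lemma nig_radial0 (z : k.+1.-tuple R) i : tnth z i <= 0 ->
  (\int[mu]_(s in `]0%R, +oo[) ((s ^+ k)%:E * (prod_ig_density s z)%:E) = 0)%E.
Proof.
move=> zi; apply: integral0_eq => s; rewrite /= in_itv/= andbT => s0.
rewrite /prod_ig_density (bigD1 i)//= /ig_density patchE ifN ?mul0r ?mule0//.
by rewrite notin_setE/= in_itv/= andbT; apply/negP; rewrite -leNgt pmulr_rle0.
Qed.

(** [powR] is 0 at base 0 and nonzero exponent, so the density vanishes on the faces of the simplex,
    as the radial integral does. *)
Lemma nig_pdf0 (z : k.+1.-tuple R) i : tnth z i = 0 -> nig z = 0.
Proof.
move=> zi; rewrite /nig_pdf [X in _ * X](bigD1 i)//= zi powR0 ?mul0r ?mulr0//.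
Qed.

Definition normalize (t : k.+1.-tuple R) : k.+1.-tuple R :=
  [tuple tnth t i / \sum_(j < k.+1) tnth t j | i < k.+1].

Lemma measurable_normalize : measurable_fun setT normalize.
Proof.
apply/measurable_fun_tnthP => i.
rewrite (_ : _ \o _ = fun t : k.+1.-tuple R => tnth t i / \sum_(j < k.+1) tnth t j).
  apply: measurable_funM; first exact: measurable_tnth.
  by apply: (measurableT_comp measurable_invr); exact: measurable_sum_tuple.
by apply/funext => t /=; rewrite tnth_mktuple.
Qed.

(** Normalization is constant along a ray, so the indicator of [B] leaves the radial integral and
    [nig_radial] evaluates the rest. *)
Lemma nig_normalized d (Omega : measurableType d) (P : probability Omega R)
    (W : Omega -> k.+1.-tuple R) :
  measurable_fun setT W ->
  (forall B : nat -> set R, (forall i, measurable (B i)) ->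
    P [set w | forall i : 'I_k.+1, B i (tnth (W w) i)] =
    (\prod_(i < k.+1) ig_prob (g0 i) (B i))%E) ->
  has_nig_law P (fun w => normalize (W w)) (fun i : 'I_k.+1 => g i).
Proof.
move=> mW hW; split.
  exact: (measurableT_comp measurable_normalize mW).
move=> B mB.
pose F (t : k.+1.-tuple R) : \bar R := (\1_B (normalize t))%:E.
have mF : measurable_fun setT F.
  apply/measurable_EFinP; apply: measurableT_comp; first exact: measurable_indic.
  exact: measurable_normalize.
have F0 t : (0 <= F t)%E by rewrite lee_fin.
have mnW : measurable ((fun w => normalize (W w)) @^-1` B).
  rewrite -[X in measurable X]setTI.
  exact: (measurableT_comp measurable_normalize mW).
transitivity (\int[P]_w F (W w))%E.
  transitivity (\int[P]_w (\1_((fun w => normalize (W w)) @^-1` B) w)%:E)%E => //.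
  by rewrite integral_indic// setIT.
rewrite (@pm_law _ _ _ P (fun i => ig_prob (g0 i)) k.+1 1 W)//; last first.
  by move=> B' mB'; rewrite mul1e; exact: hW.
rewrite mul1e (@integral_pm_density _ (fun i => ig_density (g i)))//; last 2 first.
- by move=> i; exact: measurable_ig_density.
- by move=> i x; exact: ig_density_ge0.
rewrite lebesgue_int_polar; last 3 first.
- apply: emeasurable_funM => //; apply/measurable_EFinP.
  apply: measurable_prod => i _; apply: measurableT_comp; first exact: measurable_ig_density.
  exact: measurable_tnth.
- move=> t; rewrite mule_ge0// lee_fin; apply: prodr_ge0 => i _; exact: ig_density_ge0.
- move=> t i ti; rewrite (bigD1 i)//= /ig_density patchE ifN ?mul0r ?mule0//.
  by rewrite notin_setE/= in_itv/= andbT; apply/negP; rewrite -leNgt.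
apply: eq_lebesgue_int => t; set z := simplex_point t.
have z1 : \sum_(i < k.+1) tnth z i = 1 by exact: simplex_pointD.
transitivity ((\1_B z)%:E *
   \int[mu]_(s in `]0%R, +oo[) ((s ^+ k)%:E * (prod_ig_density s z)%:E))%E.
  rewrite radialZ; last by rewrite indicE ler0n.
  apply: eq_integral => s; rewrite inE/= in_itv/= andbT => s0.
  rewrite muleCA; congr (_ * _)%E; last first.
    by congr (_ * EFin _)%E; apply: eq_bigr => i _; rewrite tnth_mktuple.
  rewrite /F (_ : normalize _ = z)//; apply: eq_from_tnth => i; rewrite !tnth_mktuple.
  under eq_bigr do rewrite tnth_mktuple.
  by rewrite -mulr_sumr z1 mulr1 mulrAC mulfV ?gt_eqF// mul1r.
(* If some coordinate is nonpositive the radial integral is 0; so is the other side, by [nig_pdf0]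
   on a face and by the indicator of the simplex outside it. *)
have [zpos|zneg] := pselect (forall i, 0 < tnth z i).
  rewrite nig_radial// -EFinM mulrC; congr (_ * _)%:E.
  rewrite !indicE in_setI [in RHS](_ : z \in _ = true)//.
  by apply: mem_set; split => // i; exact: ltW.
have [i /negP zi] : exists i, ~ 0 < tnth z i by exact/existsNP.
rewrite -leNgt in zi.
rewrite (nig_radial0 zi) mule0.
have [zi0|zi0] := eqVneq (tnth z i) 0; first by rewrite (nig_pdf0 zi0) mul0r.
rewrite indicE memNset ?mulr0// => -[[zge0 _] _].
by move: zi; rewrite leNgt lt_neqAle eq_sym zi0 zge0.
Qed.

End nig_density.

(** * Convergence of the approximating sums along a path *)

Section dominated_sums.
Context {R : realType}.

(** Dominated convergence for sums whose length grows with n: the terms beyond index M contribute at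
    most C/(M + 1), uniformly in n. *)
Lemma tannery (u : nat -> nat -> R) (v : nat -> R) (S C : R) :
  (forall i, u n i @[n --> \oo] --> v i) ->
  (\forall n \near \oo, forall i, (i <= n)%N -> 0 <= u n i <= C / i.+1%:R ^+ 2) ->
  \sum_(i < n) v i @[n --> \oo] --> S ->
  \sum_(i < n.+1) u n i @[n --> \oo] --> S.
Proof.
move=> uv uC vS.
have C0 : 0 <= C.
  have [N _ hN] := uC; have /(_ 0%N (leq0n _))/andP[h1 h2] := hN N (leqnn N).
  by have := le_trans h1 h2; rewrite expr1n divr1.
have tail M n : (M <= n)%N -> \sum_(M.+1 <= i < n.+1) (i.+1%:R ^+ 2)^-1 <= M.+1%:R^-1 - n.+1%:R^-1 :> R.
  elim: n => [|n IH]; first by rewrite leqn0 => /eqP ->; rewrite big_geq// subrr.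
  rewrite leq_eqVlt => /predU1P[->|Mn]; first by rewrite big_geq// subrr.
  rewrite big_nat_recr//=; apply: (le_trans (lerD (IH _) (lexx _))) => //.
  have n0 : 0 < n.+1%:R :> R by rewrite ltr0n.
  rewrite -[n.+2]addn1 natrD; set x := n.+1%:R in n0 *.
  rewrite -subr_ge0 (_ : _ - _ = (x * (x + 1) ^+ 2)^-1).
    by rewrite invr_ge0 mulr_ge0 ?sqr_ge0// ltW.
  by field; rewrite !gt_eqF// ltr_pwDl// ?ltW.
apply/cvgrPdist_lt => e e0.
have e3 : 0 < e / 3 by rewrite divr_gt0.
have [M1 _ hM1] : \forall n \near \oo, `|S - \sum_(i < n) v i| < e / 3.
  by move/cvgrPdist_lt : vS; exact.
have [M2 _ hM2] : \forall n \near \oo, C / n.+1%:R < e / 3.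
  have : C / n.+1%:R @[n --> \oo] --> (0 : R).
    by rewrite -[X in _ --> X](mulr0 C); apply: cvgM; [exact: cvg_cst|exact: cvg_harmonic].
  by move=> /(cvgr_lt 0); apply.
(* [M1] controls the remainder of the limit series, [M2] the common tail bound. *)
pose M := maxn M1 M2.
have hu : \sum_(i < M.+1) u n i @[n --> \oo] --> \sum_(i < M.+1) v i.
  by apply: cvg_big => [|i _]; [exact: add_continuous|exact: uv].
near=> n.
have Mn : (M <= n)%N by near: n; exact: nbhs_infty_ge.
have h1 : `|\sum_(i < M.+1) v i - \sum_(i < M.+1) u n i| < e / 3.
  by near: n; move/cvgrPdist_lt : hu; exact.
have h2 : forall i, (i <= n)%N -> 0 <= u n i <= C / i.+1%:R ^+ 2 by near: n.
have h3 : 0 <= \sum_(M.+1 <= i < n.+1) u n i < e / 3.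
  apply/andP; split.
    rewrite big_nat; apply: sumr_ge0 => i /andP[_]; rewrite ltnS => /h2.
    by case/andP.
  apply: (@le_lt_trans _ _ (\sum_(M.+1 <= i < n.+1) C * (i.+1%:R ^+ 2)^-1)).
    rewrite big_nat [leRHS]big_nat; apply: ler_sum => i /andP[_]; rewrite ltnS => /h2.
    by case/andP.
  rewrite -mulr_sumr; apply: (@le_lt_trans _ _ (C / M.+1%:R)).
    by rewrite ler_wpM2l// (le_trans (tail _ _ Mn))// gerBl.
  apply: le_lt_trans (hM2 M2 (leqnn _)).
  by rewrite ler_wpM2l// lef_pV2 ?posrE ?ltr0n// ler_nat ltnS leq_maxr.
have h4 : `|S - \sum_(i < M.+1) v i| < e / 3.
  by apply: hM1; rewrite /= (leq_trans (leq_maxl M1 M2)).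
rewrite -(big_mkord predT (u n)) (@big_cat_nat _ _ _ M.+1)//= big_mkord.
have /andP[h5 h6] := h3.
rewrite (_ : S - _ = (S - \sum_(i < M.+1) v i) +
  (\sum_(i < M.+1) v i - \sum_(i < M.+1) u n i) - \sum_(M.+1 <= i < n.+1) u n i); last by ring.
apply: (le_lt_trans (ler_normB _ _)); rewrite (ger0_norm h5).
have := ler_normD (S - \sum_(i < M.+1) v i) (\sum_(i < M.+1) v i - \sum_(i < M.+1) u n i).
lra.
Unshelve. all: end_near. Qed.

End dominated_sums.

Section ig_arrival_sums.
Context {R : realType} {Omega : Type}.
Variables (a : R) (E : nat -> Omega -> R) (w : Omega).
Hypothesis a_gt0 : 0 < a.
Hypothesis E_gt0 : forall i, 0 < E i w.
Hypothesis slln : arrival E n w / n%:R @[n --> \oo] --> (1 : R).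

(** G_n is taken at [n.+1], so Gamma_{n+1} reads [arrival] at [n.+2]; the gap between n + 1 and n +
    2 disappears because the arrivals tend to +oo. *)
Let ratio_cvg : n.+1%:R / arrival E n.+2 w @[n --> \oo] --> (1 : R).
Proof.
have h1 : n.+2%:R / arrival E n.+2 w @[n --> \oo] --> (1 : R).
  have : (arrival E n w / n%:R)^-1 @[n --> \oo] --> (1^-1 : R) by apply: cvgV.
  rewrite invr1 -(cvg_shiftn 2).
  by under eq_fun do rewrite /= addn2 invf_div.
have h2 : (arrival E n.+2 w)^-1 @[n --> \oo] --> (0 : R).
  have /gtr0_cvgV0 h : \forall n \near \oo, 0 < arrival E n.+2 w.
    by apply: nearW => n; exact: arrival_gt0.
  apply/h; have := arrival_cvgy E_gt0 slln.
  by rewrite -(cvg_shiftn 2); under eq_fun do rewrite /= addn2.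
rewrite -[X in _ --> X]subr0 (_ : (fun n => _) =
  (fun n => n.+2%:R / arrival E n.+2 w - (arrival E n.+2 w)^-1)); first exact: cvgB.
apply/funext => n; have -> : n.+2%:R = n.+1%:R + 1 :> R by rewrite -[n.+2]addn1 natrD.
by rewrite mulrDl mul1r addrK.
Qed.

(** The weights [b] stand for the indicators of theta_i in B: the full space gives the denominator,
    a general B the numerator. *)
Lemma cvg_ig_sum (b : nat -> R) (S : R) : (forall i, 0 <= b i <= 1) ->
  \sum_(i < n) levy_tail_inv a (arrival E i.+1 w) * b i @[n --> \oo] --> S ->
  \sum_(i < n.+1) ig_tail_inv a n.+1 (arrival E i.+1 w / arrival E n.+2 w) * b i
    @[n --> \oo] --> S.
Proof.
move=> b01; have [c c0 hc] := arrival_linear E_gt0 slln.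
pose K := expR a * (2 * (a / Num.sqrt (2 * pi))).
have K0 : 0 <= K by rewrite !mulr_ge0 ?expR_ge0 ?invr_ge0 ?sqrtr_ge0// ltW.
(* From [ig_inv_le]: the arrival of index i + 1 is at least c (i + 1), and (n + 1) over the last
   arrival is eventually above 1/2. *)
pose C := (K / (c / 2)) ^+ 2.
apply: (@tannery R (fun n i => ig_tail_inv a n.+1 (arrival E i.+1 w / arrival E n.+2 w) * b i)
  (fun i => levy_tail_inv a (arrival E i.+1 w) * b i) S C).
- move=> i; apply: cvgM; last exact: cvg_cst.
  apply: (cvg_ig_inv a_gt0 (arrival_gt0 E_gt0 i)).
  rewrite -[X in _ --> X](mulr1 (arrival E i.+1 w)).
  under eq_fun do rewrite mulrCA.
  by apply: cvgM; [exact: cvg_cst|exact: ratio_cvg].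
- have [N _ hN] : \forall n \near \oo, 2^-1 < n.+1%:R / arrival E n.+2 w.
    by apply: (cvgr_gt 1 ratio_cvg); rewrite invf_lt1// ltr1n.
  exists N => // n /= Nn i _; have /andP[bi0 bi1] := b01 i.
  have i0 := ig_inv_ge0 a_gt0 n (arrival E i.+1 w / arrival E n.+2 w).
  rewrite mulr_ge0//=; apply: (@le_trans _ _ _ _ _ (ler_piMr i0 bi1)).
  have u0 : 0 < arrival E i.+1 w / arrival E n.+2 w by rewrite divr_gt0// arrival_gt0.
  apply: (le_trans (ig_inv_le a_gt0 n u0)); rewrite -/K /C -expr_div_n.
  have cu : c / 2 * i.+1%:R <= n.+1%:R * (arrival E i.+1 w / arrival E n.+2 w).
    rewrite mulrCA mulrAC; apply: ler_pM => //; rewrite ?mulr_ge0 ?invr_ge0 ?(ltW c0)//.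
    exact/ltW/hN.
  have p1 : 0 < n.+1%:R * (arrival E i.+1 w / arrival E n.+2 w) by rewrite mulr_gt0.
  have p2 : 0 < c / 2 * i.+1%:R by rewrite mulr_gt0// divr_gt0.
  have -> : K / (c / 2) / i.+1%:R = K / (c / 2 * i.+1%:R) by rewrite [in RHS]invfM mulrA.
  apply: lerXn2r; rewrite ?nnegrE.
  + exact: (divr_ge0 K0 (ltW p1)).
  + exact: (divr_ge0 K0 (ltW p2)).
  + by rewrite ler_wpM2l// lef_pV2.
Qed.

End ig_arrival_sums.

Section nig_law_ae.
Context {R : realType} d (Omega : measurableType d) (P : probability Omega R).

Lemma has_nig_law_ae k (U V : Omega -> k.+1.-tuple R) g :
  measurable_fun setT V -> {ae P, forall w, V w = U w} ->
  has_nig_law P U g -> has_nig_law P V g.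
Proof.
move=> mV UV [mU UE]; split => // B mB; rewrite -UE//.
have mpre (W : Omega -> k.+1.-tuple R) : measurable_fun setT W -> measurable (W @^-1` B).
  by move=> mW; rewrite -[X in measurable X]setTI; exact: mW.
have E (W : Omega -> k.+1.-tuple R) : measurable_fun setT W ->
    P (W @^-1` B) = (\int[P]_w (\1_(W @^-1` B) w)%:E)%E.
  by move=> mW; rewrite integral_indic ?setIT//; exact: mpre.
rewrite !E//; apply: ae_eq_integral => //.
- by apply/measurable_EFinP; apply: measurable_indic; exact: mpre.
- by apply/measurable_EFinP; apply: measurable_indic; exact: mpre.
apply: filterS UV => w VU _.
have wE : (w \in V @^-1` B) = (w \in U @^-1` B) by rewrite -[LHS]/(V w \in B) VU.
by rewrite !indicE wE.
Qed.

End nig_law_ae.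

(** * The limiting random probability measure and its finite-dimensional laws *)

Section nig_process.
Context {R : realType} d (Omega : measurableType d) (P : probability Omega R).
Context d' (X : measurableType d') (H : probability X R).
Variables (a : R) (theta : nat -> {RV P >-> X}) (E : nat -> {RV P >-> R}).
Hypothesis a_gt0 : 0 < a.
Hypothesis theta_iid : iid_seq theta H.
Hypothesis E_iid : iid_seq E (exponential_prob 1).
Hypothesis theta_Gamma_indep : indep_seqs P theta (fun i => arrival E i.+1).

Local Notation jump := (jump a E).
Local Notation bsum := (block_sum a theta E).
Local Notation total := (bsum setT).

Let total_ge0 w : 0 <= total w. Proof. exact: block_sum_ge0. Qed.

(** A positive [total w] also certifies that the series of jumps converges, since [fine] sends +oo
    to 0. *)
Lemma series_block_sum B w : 0 < total w ->
  (\sum_(0 <= i <oo) (jump i w * \1_B (theta i w))%:E = (bsum B w)%:E)%E.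
Proof.
move=> T0; rewrite /block_sum fineK// ge0_fin_numE; last first.
  by apply: nneseries_ge0 => i _ _; rewrite lee_fin mulr_ge0 ?jump_ge0.
apply: (@le_lt_trans _ _ (\sum_(0 <= i <oo) (jump i w * \1_setT (theta i w))%:E)%E).
  apply: lee_nneseries => i; first by move=> *; rewrite lee_fin mulr_ge0 ?jump_ge0.
  move=> _; rewrite lee_fin; apply: ler_wpM2l; first exact: jump_ge0.
  by rewrite indicT/= indicE; case: (_ \in _).
move: T0; rewrite /block_sum.
by case: (X in fine X) => [r|/=|/=]; rewrite ?ltry ?ltxx.
Qed.

(* The second summand makes the weights sum to 1 on the null set where the series of
   jumps vanishes or diverges: there [total w = 0], hence [jump i w / total w = 0]. *)
Definition nig_weight i w : R := jump i w / total w + (i == 0%N)%:R * \1_[set 0] (total w).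

Lemma nig_weight_ge0 i w : 0 <= nig_weight i w.
Proof. by rewrite addr_ge0 ?mulr_ge0 ?jump_ge0 ?invr_ge0. Qed.

Lemma nig_weightE i w : 0 < total w -> nig_weight i w = jump i w / total w.
Proof.
move=> T0; rewrite /nig_weight indicE memNset ?mulr0 ?addr0// => /= T.
by move: T0; rewrite T ltxx.
Qed.

Lemma nig_weight0 i w : total w = 0 -> nig_weight i w = (i == 0%N)%:R.
Proof. by move=> T; rewrite /nig_weight T invr0 mulr0 add0r indicE mem_set ?mulr1. Qed.

Lemma measurable_nig_weight i : measurable_fun setT (nig_weight i).
Proof.
have mT : measurable_fun setT total by exact: measurable_block_sum.
apply: measurable_funD; apply: measurable_funM => //.
- exact: measurable_jump.
- exact: (measurableT_comp measurable_invr mT).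
- by apply: (measurableT_comp (measurable_indic _) mT); exact: measurable_set1.
Qed.

Definition nig_kernel (w : Omega) : {measure set X -> \bar R} :=
  mseries (fun i => mscale (NngNum (nig_weight_ge0 i w)) \d_(theta i w)) 0.

Lemma nig_kernelE w B :
  nig_kernel w B = (\sum_(0 <= i <oo) ((nig_weight i w)%:E * \d_(theta i w) B))%E.
Proof. by []. Qed.

Lemma nig_kernel_gt0 w B : 0 < total w -> nig_kernel w B = (bsum B w / total w)%:E.
Proof.
move=> T0; rewrite nig_kernelE mulrC EFinM -series_block_sum// -nneseriesZl; last first.
  by move=> i _; rewrite lee_fin mulr_ge0 ?jump_ge0.
apply: eq_eseriesr => i _; rewrite nig_weightE// diracE -!EFinM; congr EFin.
by rewrite indicE; ring.
Qed.

Lemma nig_kernel_setT w : nig_kernel w setT = 1%E.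
Proof.
have [T0|T0] := ltP 0 (total w).
  by rewrite nig_kernel_gt0// divff// gt_eqF.
have {}T0 : total w = 0 by apply/eqP; rewrite eq_le T0 total_ge0.
rewrite nig_kernelE nneseries_recl//; last first.
  by move=> i _; rewrite mule_ge0// lee_fin nig_weight_ge0.
rewrite eseries0; last by move=> i i1 _; rewrite nig_weight0// gtn_eqF// mul0e.
by rewrite nig_weight0//= mul1e adde0 diracT.
Qed.

Lemma measurable_nig_kernel B : measurable B -> measurable_fun setT (nig_kernel ^~ B).
Proof.
move=> mB; apply: ge0_emeasurable_sum => i *.
  by rewrite mule_ge0// lee_fin nig_weight_ge0.
apply: emeasurable_funM; first by apply/measurable_EFinP; exact: measurable_nig_weight.
rewrite (_ : (fun w => _) = fun w => (\1_B (theta i w))%:E).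
  apply/measurable_EFinP; apply: measurableT_comp => //; exact: measurable_indic.
by [].
Qed.

HB.instance Definition _ := isKernel.Build _ _ Omega X R nig_kernel measurable_nig_kernel.
HB.instance Definition _ :=
  Kernel_isProbability.Build _ _ Omega X R nig_kernel nig_kernel_setT.

Definition nig_pker : R.-pker Omega ~> X := nig_kernel.

Let cvg_total w : (forall i, 0 < E i w) -> arrival E n w / n%:R @[n --> \oo] --> (1 : R) ->
  0 < total w.
Proof.
move=> E0 slln; have h : \sum_(i < n) jump i w * \1_setT (theta i w) @[n --> \oo] --> total w.
  exact: cvg_block_sum.
apply: (@lt_le_trans _ _ (jump 0 w)); first exact: levy_inv_gt0 (arrival_gt0 E0 0).
rewrite -(cvg_lim _ h)//; apply: limr_ge; first by apply/cvg_ex; exists (total w).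
exists 1%N => // n /= n1.
rewrite -(prednK n1) big_ord_recl indicT mulr1 lerDl sumr_ge0// => i _.
by rewrite mulr_ge0 ?jump_ge0.
Qed.

Lemma good_total : {ae P, forall w, [/\ forall i, 0 < E i w,
  arrival E n w / n%:R @[n --> \oo] --> (1 : R) & 0 < total w]}.
Proof.
by apply: filterS (good_arrivals E_iid) => w [E0 slln]; split => //; exact: cvg_total.
Qed.

Lemma nig_series_kernel w B : 0 < total w -> nig_series a theta E w B = nig_kernel w B.
Proof.
move=> T0; rewrite nig_kernelE /nig_series; apply: eq_eseriesr => i _.
rewrite nig_weightE//; congr (_ * _)%E.
rewrite (_ : (\sum_(0 <= j <oo) _)%E = (total w)%:E).
  by rewrite inver gt_eqF.
rewrite -series_block_sum//; apply: eq_eseriesr => j _.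
by rewrite indicT mulr1.
Qed.

Lemma nig_approx_cvg w B : (forall i, 0 < E i w) ->
  arrival E n w / n%:R @[n --> \oo] --> (1 : R) -> 0 < total w ->
  nig_approx a theta E n w B @[n --> \oo] --> nig_kernel w B.
Proof.
(* The shift discards n = 0, where the parameter a / n degenerates, and matches the indexing of
   [cvg_ig_sum]. *)
move=> E0 slln T0; rewrite nig_kernel_gt0//; rewrite -cvg_shiftS.
pose s A n := \sum_(i < n.+1) ig_tail_inv a n.+1 (arrival E i.+1 w / arrival E n.+2 w) *
  \1_A (theta i w).
have hs A : s A n @[n --> \oo] --> bsum A w.
  apply: (@cvg_ig_sum R Omega a E w a_gt0 E0 slln (fun i => \1_A (theta i w)) (bsum A w)).
    by move=> i; rewrite indicE; case: (theta i w \in A); rewrite /= ?ler01 ?lexx.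
  exact: cvg_block_sum.
rewrite (_ : (fun n => _) = fun n => (s B n / s setT n)%:E).
  apply: cvg_EFin; first exact: nearW.
  apply: cvgM; first exact: hs.
  by apply: cvgV; [rewrite gt_eqF|exact: hs].
apply/funext => n; rewrite /nig_approx /=.
rewrite (_ : s setT n = \sum_(i < n.+1) ig_tail_inv a n.+1 (arrival E i.+1 w / arrival E n.+2 w)).
  rewrite /s mulr_suml -sumEFin; apply: eq_bigr => i _.
  by rewrite diracE -EFinM indicE mulrAC.
by apply: eq_bigr => i _; rewrite indicT mulr1.
Qed.

Lemma theta_null (B : set X) : measurable B -> H B = 0%E ->
  {ae P, forall w, forall i, ~ B (theta i w)}.
Proof.
move=> mB HB; apply: ae_foralln => i; exists (theta i @^-1` B); split.
- by rewrite -[X in measurable X]setTI; exact: measurable_funPT.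
- by rewrite -HB -(theta_iid.1 i).
- by move=> w /= /contrapT.
Qed.

(** Almost surely no mark falls in a block of H-mass 0. Hence [total] is the sum over the charged
    blocks, and dividing by it is the normalization of [nig_normalized] up to a null set. *)
Lemma nig_pker_process : is_nig_process P H a nig_pker.
Proof.
move=> m A mA A_triv A_cover; split.
  move=> j HA; apply: filterS (theta_null (mA j) HA) => w h.
  rewrite [LHS]nig_kernelE eseries0// => i _ _.
  by rewrite diracE memNset ?mule0.
move=> k s s_inj Hs.
have Hs0 j : (0 < H (A (s j)))%E by apply/Hs; exists j.
(* The default 1 keeps the parameters positive at every index. *)
pose g (i : nat) : R := if insub i is Some j then a * fine (H (A (s j))) else 1.
have g0 i : 0 < g i.
  rewrite /g; case: insubP => [j _ _|_] //; rewrite mulr_gt0// fine_gt0// Hs0/=.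
  by rewrite ltey_eq fin_num_measure.
have gE (j : 'I_k.+1) : g j = a * fine (H (A (s j))) by rewrite /g valK.
pose W w : k.+1.-tuple R := [tuple bsum (A (s j)) w | j < k.+1].
have mW : measurable_fun setT W.
  apply/measurable_fun_tnthP => j; rewrite (_ : _ \o _ = bsum (A (s j))).
    exact: measurable_block_sum.
  by apply/funext => w /=; rewrite tnth_mktuple.
have lawW := @nig_normalized R k g g0 _ Omega P W mW.
rewrite (_ : (fun j => _) = (fun j : 'I_k.+1 => g j)); last by apply/funext => j; rewrite gE.
apply: has_nig_law_ae (lawW _); last first.
- move=> B mB; rewrite -(block_sum_law a_gt0 theta_iid E_iid theta_Gamma_indep mA A_triv A_cover g0 s_inj gE mB).
  by congr (P _); apply/seteqP; split => w /= hB j; have := hB j; rewrite tnth_mktuple.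
- have null : {ae P, forall w, forall j, (H (A j) = 0)%E -> forall i, ~ A j (theta i w)}.
    (* [ae_foralln] quantifies over [nat], so ordinals are traded for naturals with a bound. *)
    suff : {ae P, forall w, forall (n : nat) (nm : (n < m)%N), (H (A (Ordinal nm)) = 0)%E ->
        forall i, ~ A (Ordinal nm) (theta i w)}.
      by apply: filterS => w h j; have := h j (ltn_ord j); rewrite (_ : Ordinal _ = j)//; exact: val_inj.
    apply: ae_foralln => n.
    have [nm|nm] : (n < m)%N \/ ~~ (n < m)%N by apply/orP; rewrite orbN.
      2: by apply: aeW => w nm'; rewrite nm' in nm.
    have [H0|H0] := eqVneq (H (A (Ordinal nm))) 0%E.
      apply: filterS (theta_null (mA _) H0) => w h nm'.
      by rewrite (_ : Ordinal nm' = Ordinal nm)//; exact: val_inj.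
    apply: aeW => w nm'; rewrite (_ : Ordinal nm' = Ordinal nm); last exact: val_inj.
    by move=> /eqP; rewrite (negbTE H0).
  apply: filterS2 null good_total => w null [E0 slln T0].
  apply: eq_from_tnth => j; rewrite !tnth_mktuple [in LHS]/= nig_kernel_gt0//=.
  congr (_ / _).
  have one i : \sum_(j0 < k.+1) \1_(A (s j0)) (theta i w) = 1 :> R.
    have : (\bigcup_j A j) (theta i w) by rewrite A_cover.
    case=> b _ Ab; have Hb : (0 < H (A b))%E.
      rewrite lt0e measure_ge0 andbT; apply/eqP => Hb; exact: null Hb _ Ab.
    have [j0 sj0] := (Hs b).1 Hb.
    rewrite (bigD1 j0)//= indicE mem_set ?sj0// big1 ?addr0// => j1 j10.
    rewrite indicE memNset// => Aj1; move/eqP: j10; apply; apply: s_inj; rewrite sj0.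
    by apply: (A_triv _ _ I I); exists (theta i w).
  have h1 : \sum_(i < n) jump i w * \1_setT (theta i w) @[n --> \oo] --> total w.
    exact: cvg_block_sum.
  have h2 : \sum_(i < n) jump i w * \1_setT (theta i w) @[n --> \oo] -->
      \sum_(j0 < k.+1) bsum (A (s j0)) w.
    rewrite (_ : (fun n => _) = fun n => \sum_(j0 < k.+1) \sum_(i < n) jump i w * \1_(A (s j0)) (theta i w)).
      by apply: cvg_big => [|j0 _]; [exact: add_continuous|exact: cvg_block_sum].
    apply/funext => n; rewrite exchange_big/=; apply: eq_bigr => i _.
    by rewrite indicT mulr1 -mulr_sumr one mulr1.
  rewrite (cvg_unique _ h1 h2)//.
  by apply: eq_bigr => j0 _; rewrite tnth_mktuple.
- apply/measurable_fun_tnthP => j.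
  rewrite (_ : _ \o _ = fun w => fine (nig_kernel w (A (s j)))).
    by apply: measurableT_comp; [exact: fine_measurable|exact: measurable_nig_kernel].
  by apply/funext => w /=; rewrite tnth_mktuple.
Qed.

End nig_process.

Theorem theorem4 (R : realType)
    (d : measure_display) (Omega : measurableType d) (P : probability Omega R)
    (d' : measure_display) (X : measurableType d') (H : probability X R)
    (a : R) (theta : nat -> {RV P >-> X}) (E : nat -> {RV P >-> R})
    (a_gt0 : 0 < a)
    (theta_iid : iid_seq theta H)
    (E_iid : iid_seq E (exponential_prob 1))
    (theta_Gamma_indep :
       indep_seqs P theta (fun i => arrival E i.+1)) :
  exists PHa : R.-pker Omega ~> X,
    [/\ is_nig_process P H a PHa,
        {ae P, forall w, forall B : set X, measurable B ->
           PHa w B = nig_series a theta E w B}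
      & {ae P, forall w, forall B : set X, measurable B ->
           (fun n => nig_approx a theta E n w B) @ \oo --> PHa w B}].
Proof.
exists (nig_pker theta E a_gt0); split; first exact: nig_pker_process.
(* The event of [good_total] does not involve [B], so one null set serves all measurable sets, here
   and in the convergence. *)
- by apply: filterS (good_total theta a_gt0 E_iid) => w [_ _ T0] B _; rewrite nig_series_kernel.
- have := good_total theta a_gt0 E_iid; apply: filterS => w [E0 slln T0] B _.
  exact: nig_approx_cvg.
Qed.
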